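(* Let $G$ be a simple algebraic group defined and split over $F_q$ and let $c$ be a family of irreducible representations of its Weyl group. Let $\mathcal U_c$ be the corresponding set of unipotent representations of $G(F_q)$, identified with $M(\mathcal G_c)$; let $M(\mathcal G_c)=\bigsqcup_{\gamma}M(\mathcal G_c)^{\gamma}$ be the partition into Harish-Chandra series and let $\alpha_c:M(\mathcal G_c)\to\overline{\mathcal H}_c$ be the surjective map described in the context, where $\overline{\mathcal H}_c$ is a set of pairs of subgroups of $\mathcal G_c$. For any $\gamma$ let $$\overline{\mathcal H}_c^{\gamma}=\{h\in\overline{\mathcal H}_c:\ |\alpha_c^{-1}(h)\cap M(\mathcal G_c)^{\gamma}|=1\}.$$ Then the map $\overline{\mathcal H}_c^{\gamma}\to M(\mathcal G_c)^{\gamma}$ which sends $h$ to the unique element of $\alpha_c^{-1}(h)\cap M(\mathcal G_c)^{\gamma}$ is a bijection. In particular $\mathcal U_c^\gamma=M(\mathcal G_c)^{\gamma}$ is in natural bijection with a subset of $\overline{\mathcal H}_c$.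
   Context: For a finite group $\Gamma$, $M(\Gamma)$ is the set of $\Gamma$-conjugacy classes of pairs $(x,\rho)$, $x\in\Gamma$, $\rho$ an irreducible complex representation of the centralizer of $x$. Lusztig attaches to $c$ a finite group $\mathcal G_c$ and a bijection $\mathcal U_c\leftrightarrow M(\mathcal G_c)$. The data $M(\mathcal G_c)$, its partition into Harish-Chandra series, the set $\overline{\mathcal H}_c$ of pairs of subgroups of $\mathcal G_c$, and $\alpha_c$ are as follows. **Type A.** Everything is a one element set. **Combinatorics for types B, C, D.** $\mathbb F=\mathbb Z/2$; $[a,b]=\{z\in\mathbb Z:a\le z\le b\}$. For $D\in\mathbb N$, $V_D$ is the $\mathbb F$-vector space with basis $e_1,\dots,e_D$; $V_{D'}\subset V_D$ for $D'\le D$. $\mathcal I_D$ is the set of intervals $[a,b]$, $1\le a\le b\le D$; $e_I=\sum_{i\in I}e_i$; $R_D$ is the set of subsets of $\mathcal I_D$. For $D\ge2$, $i\in[1,D]$: $\xi_i([a',b'])=[a'+2,b'+2]$ if $i\le a'$; $=[a',b']$ if $i\ge b'+2$; $=[a',b'+2]$ if $a'<i<b'+2$ (for $[a',b']\in\mathcal I_{D-2}$); $t_i(B')=\{\xi_i(I'):I'\in B'\}\sqcup\{[i,i]\}$ for $B'\in R_{D-2}$. $\mathbb S^{prim}_D$ consists of $\emptyset$ and: if $D$ is even, $\{[1,D],[2,D-1],\dots,[k,D+1-k]\}$, $k\in[1,D/2]$; if $D$ is odd, $\{[1,D-1],\dots,[k,D-k]\}$ and $\{[2,D],[3,D-1],\dots,[k+1,D+1-k]\}$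 for odd $k\in[1,(D-1)/2]$. $\mathbb S_0=\{\emptyset\}$, $\mathbb S_1=\{\emptyset,\{[1,1]\}\}$; for $D\ge2$, $B\in\mathbb S_D$ iff $B\in\mathbb S_D^{prim}$ or $B=t_i(B')$ for some $i\in[1,D]$, $B'\in\mathbb S_{D-2}$. $S_D=\{B\in\mathbb S_D:|I|\text{ odd }\forall I\in B\}$. $\mathbf E_B=\mathrm{span}\{e_I:I\in B\}$ for $B\in\mathbb S_D$; $\mathcal F(V_D)=\{\mathbf E_B:B\in S_D\}$. $(\,,)$ is the symplectic form on $V_D$ with $(e_i,e_j)=1$ iff $i-j=\pm1$. $V_D^\delta=\mathrm{span}\{e_i:i\equiv\delta\bmod2\}$; for $Z\subset V_D^{1-\delta}$, $Z^!=\{x\in V_D^\delta:(x,y)=0\ \forall y\in Z\}$; $E^\delta=E\cap V_D^\delta$. *The sets $B(k)$.* For $B\in S_D$ put $B(0)=B$. If $|B|<D/2$ ($D$ even) or $|B|<(D+1)/2$ ($D$ odd) let $\Delta=D-2|B|\ge1$; write $\bigcup_{I\in B}I=[a_1,b_1]\cup\dots\cup[a_s,b_s]$ with $a_i\le b_i$, $b_i+2\le a_{i+1}$; $b_0=-1$, $a_{s+1}=D+2$. Let $i_1<\dots<i_t$ be the $i\in[1,s+1]$ with $a_i-b_{i-1}\ge3$. The intervals $[a_{i_u}-1,b_{i_{u+1}-1}+1]$ ($u\in[1,t-1]$) and $[j,j]$ for $j\in[b_{i-1}+2,a_i-2]$, $i\in[1,s+1]$ with $a_i-b_{i-1}\ge4$,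 are $\Delta$ consecutive disjoint intervals, listed from left to right as $I_1,\dots,I_\Delta$; $I_{[c,d]}=I_c\cup\dots\cup I_d$. Put $B(k)=B\sqcup\{I_{[1,\Delta]},I_{[2,\Delta-1]},\dots,I_{[k,\Delta+1-k]}\}$ if $D$ even, $k\in[1,\Delta/2]$; $B(k)=B\sqcup\{I_{[1,\Delta-1]},\dots,I_{[k,\Delta-k]}\}$ if $D$ odd, $k\in[1,(\Delta-1)/2]$ odd. Then $B(k)\in\mathbb S_D$. *The vector $\epsilon_D$.* Let $\mathbf a$ be a symbol, $\overline{[1,D]}=[1,D]\sqcup\{\mathbf a\}$, $e_{\mathbf a}=e_{[1,D]}$. For $I\in\mathcal I_D$ let $I^*=I$ if $|I|$ is odd, $I^*=\overline{[1,D]}\setminus I$ if $|I|$ is even; for $C\in\mathbb S_D$ let $C^*=\{I^*:I\in C\}$ and let $n_j$ be the number of elements of $C^*$ containing $j$. Let $\epsilon_D(C^* )=\sum_{j\in\overline{[1,D]}}\epsilon^je_j\in V_D$ where $\epsilon^j=n_j(n_j+1)/2\bmod 2$, except in the following situation: $D$ is odd, $j\ne\mathbf a$, and $j$ lies in the union $[C^*]$ of all members of $C^*$ containing $\mathbf a$; then $[C^*]\setminus\{\mathbf a\}=[1,l]\sqcup[l',D]$ with $0\le l<D$, $1<l'\le D+1$, $l'\ge l+2$; put $u=l'$ if $j\in[l',D]$, $u=l$ if $j\in[1,l]$; if $u\equiv j\bmod2$ then $\epsilon^j=(n_j+1)(n_j+2)/2\bmod2$ (and otherwise $\epsilon^j=n_j(n_j+1)/2$).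 *The functions $\tilde u$.* Any $v\in V_D$ is uniquely $e_{[a_1,b_1]}+\dots+e_{[a_r,b_r]}$ with $a_s\le b_s$, $b_s+2\le a_{s+1}$; let $u(v)=\sum_{s:\,a_s\not\equiv b_s\bmod2}(-1)^{a_s}$. If $D$ is even: $\tilde u(v)=2u(v)$ if $u(v)\ge0$, $-2u(v)-1$ if $u(v)<0$. If $D$ is odd: $\tilde u(v)=2u(v)-1$ if $u(v)>0$, $-2u(v)+1$ if $u(v)<0$, $0$ if $u(v)=0$. **Types B, C.** $\mathcal G_c=V_D^\delta$ for some even $D$ and $\delta\in\{0,1\}$, and $M(\mathcal G_c)=V_D^\delta\oplus\mathrm{Hom}(V_D^\delta,\mathbb F)=V_D^\delta\oplus V_D^{1-\delta}=V_D$ via $(\,,)$. The sets $M(\mathcal G_c)^\gamma$ are the fibres of $\tilde u:V_D\to\mathbb N$. $\overline{\mathcal H}_c=\{(E^\delta,(E^{1-\delta})^!):E\in\mathcal F(V_D)\}$. Every $v\in V_D$ is $\epsilon_D(B(k)^* )$ for a unique pair $(B,k)$, $B\in S_D$, $k\in[0,D/2-|B|]$; $\alpha_c(v)=(E^\delta,(E^{1-\delta})^!)$ with $E=\mathbf E_B$. **Type D.** $D$ is odd, $\eta_D=e_1+e_3+\dots+e_D$, $V'_D=V_D/\mathbb F\eta_D$, $\pi:V_D\to V'_D$ the quotient map; $\mathcal G_c=\pi(V_D^1)$ and $M(\mathcal G_c)=\pi(V_D^1)\oplus\pi(V_D^0)=V'_D$ via the induced form. The sets $M(\mathcal G_c)^\gamma$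 are the fibres of $\tilde u':V'_D\to\mathbb N$, the composition of the inverse of $\pi|_{V_{D-1}}:V_{D-1}\to V'_D$ (an isomorphism), the inclusion $V_{D-1}\subset V_D$, and $\tilde u:V_D\to\mathbb N$ ($D$ odd). $\overline{\mathcal H}_c=\{(\pi(E^1),\pi((E^0)^!)):E\in\mathcal F(V_D)\}$. Every $v'\in V'_D$ is $\pi(\epsilon_D(B(k)^* ))$ for a unique pair $(B,k)$ such that either $B\in S_{D-1}$ (viewed as a subset of $S_D$) and $k$ is $0$ or an odd number in $[1,(D-2|B|-1)/2]$, or $B\in S_D\setminus S_{D-1}$, $|B|<(D-1)/2$ and $k\in[1,(D-2|B|-1)/2]$ is odd; $\alpha_c(v')=(\pi(E^1),\pi((E^0)^!))$ with $E=\mathbf E_B$. **Exceptional types.** $\mathcal G_c=S_n$, $n\in\{1,2,3,4,5\}$. $H_{k!}$ denotes a standard subgroup $S_k$; $H_{2!2!}=S_2\times S_2$, $H_{2!3!}=S_2\times S_3$, $H_8$ a dihedral subgroup of order 8 containing $H_{2!2!}$; $H_{1!}=1$. Elements of $M(S_n)$ are written in Lusztig's notation ($i$ a primitive 4th, $\theta$ a primitive cubic, $\zeta$ a primitive 5th root of 1). Below ''$(Y,X)$: list'' means that $(Y,X)\in\overline{\mathcal H}_c$ and $\alpha_c^{-1}(Y,X)$ is the list. - $S_1$: $(1,1)$: the unique element. One series. - $S_2$: $(1,H_{2!})$: $(1,1),(g_2,\epsilon)$; $(H_{2!},H_{2!})$: $(g_2,1)$; $(1,1)$: $(1,\epsilon)$.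 Series: if $|c|=3$, $\{(1,1),(g_2,1),(1,\epsilon)\}$, $\{(g_2,\epsilon)\}$; if $|c|=2$, $\{(1,1),(g_2,1)\}$, $\{(g_2,\epsilon)\}$, $\{(1,\epsilon)\}$. - $S_3$: $(1,H_{3!})$: $(1,1),(g_3,\theta),(g_3,\theta^2)$; $(H_{3!},H_{3!})$: $(g_3,1)$; $(1,H_{2!})$: $(1,r),(g_2,\epsilon)$; $(H_{2!},H_{2!})$: $(g_2,1)$; $(1,1)$: $(1,\epsilon)$. Series: each of $(g_3,\theta),(g_3,\theta^2),(g_2,\epsilon)$ alone; the remaining elements form one series if $|c|=5$; if $|c|=4$ (type $G_2$) $(1,\epsilon)$ is also alone and the remaining 4 elements form one series. - $S_4$ (type $F_4$): $(1,H_{4!})$: $(1,1),(g_4,i),(g_4,-i)$; $(H_{4!},H_{4!})$: $(g_4,1)$; $(H_{2!2!},H_8)$: $(g_2',1),(g_4,-1)$; $(H_8,H_8)$: $(g_2',\epsilon')$; $(1,H_{2!2!})$: $(1,\sigma),(g_2,\epsilon'),(g_2',\epsilon)$; $(H_{2!},H_{2!2!})$: $(g_2,1),(g_2',r)$; $(H_{2!2!},H_{2!2!})$: $(g_2',\epsilon'')$; $(1,H_{3!})$: $(1,\lambda^1),(g_3,\theta),(g_3,\theta^2)$; $(H_{3!},H_{3!})$: $(g_3,1)$; $(1,H_{2!})$: $(1,\lambda^2),(g_2,\epsilon)$; $(H_{2!},H_{2!})$: $(g_2,\epsilon'')$; $(1,1)$: $(1,\lambda^3)$. Series: each of $(g_4,\pm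 i),(g_3,\theta),(g_3,\theta^2),(g_2',\epsilon),(g_2,\epsilon),(1,\lambda^3)$ alone; $\{(g_2,\epsilon'),(g_2',r),(g_4,-1)\}$; the remaining 11 elements. - $S_5$ (type $E_8$): $(1,H_{5!})$: $(1,1),(g_5,\zeta^j)$ ($j=1,2,3,4$); $(H_{5!},H_{5!})$: $(g_5,1)$; $(1,H_{4!})$: $(1,\lambda^1),(g_4,i),(g_4,-i)$; $(H_{4!},H_{4!})$: $(g_4,1)$; $(1,H_{2!3!})$: $(1,\nu),(g_2,-1),(g_3,\theta),(g_3,\theta^2),(g_6,-\theta),(g_6,-\theta^2)$; $(H_{2!},H_{2!3!})$: $(g_2,1),(g_6,\theta),(g_6,\theta^2)$; $(H_{3!},H_{2!3!})$: $(g_3,1),(g_6,-1)$; $(H_{2!3!},H_{2!3!})$: $(g_6,1)$; $(H_{2!2!},H_8)$: $(g_2',1),(g_4,-1)$; $(H_8,H_8)$: $(g_2',\epsilon')$; $(1,H_{2!2!})$: $(1,\nu'),(g_2,-r),(g_2',\epsilon)$; $(H_{2!},H_{2!2!})$: $(g_2,r),(g_2',r)$; $(H_{2!2!},H_{2!2!})$: $(g_2',\epsilon'')$; $(1,H_{3!})$: $(1,\lambda^2),(g_3,\epsilon\theta),(g_3,\epsilon\theta^2)$; $(H_{3!},H_{3!})$: $(g_3,\epsilon)$; $(1,H_{2!})$: $(1,\lambda^3),(g_2,-\epsilon)$; $(H_{2!},H_{2!})$: $(g_2,\epsilon)$; $(1,1)$: $(1,\lambda^4)$. Series: each of $(g_5,\zeta^j)$,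 $(g_4,\pm i)$, $(g_6,-\theta^{j})$, $(g_3,\epsilon\theta^{j})$ ($j=1,2$ in the last two), $(g_2',\epsilon)$, $(g_2,-\epsilon)$, $(1,\lambda^4)$ alone; $\{(g_3,\theta^j),(g_6,\theta^j)\}$ for $j=1$ and for $j=2$; $\{(g_2,-1),(g_2,-r),(g_2',r),(g_4,-1),(g_6,-1)\}$; the remaining 17 elements. *)

(* Defs.v *)
From HB Require Import structures.
From mathcomp Require Import all_boot all_order all_algebra all_fingroup.
From mathcomp Require Import all_solvable all_field all_character.
From mathcomp Require Import finmap.

Set Implicit Arguments.
Unset Strict Implicit.
Unset Printing Implicit Defensive.

Import Order.TTheory GRing.Theory Num.Theory.

Local Open Scope ring_scope.

(* A family c enters only through the data below.  [Mset] is the set M(G_c),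
   a subset of the ambient finite type [Mtype]; [Gtype] carries the elements of
   the finite group G_c, whose subgroups are represented by their underlying
   sets; [HCseries] is the set of the parts M(G_c)^gamma. *)
Record Udata_type := UData {
  Mtype : finType;
  Mset : {set Mtype};
  Gtype : finType;
  HCseries : {set {set Mtype}};
  Hbar : {set {set Gtype} * {set Gtype}};
  alpha : Mtype -> {set Gtype} * {set Gtype}
}.

Definition alpha_fibre (F : Udata_type) (h : {set Gtype F} * {set Gtype F}) :
    {set Mtype F} :=
  [set m in Mset F | alpha m == h].

Definition Hbar_gamma (F : Udata_type) (g : {set Mtype F}) :
    {set {set Gtype F} * {set Gtype F}} :=
  [set h in Hbar F | #|alpha_fibre h :&: g| == 1%N].

(** * Combinatorics for types B, C, D *)

(* (a, b) stands for the interval [a,b] of integers, 1 <= a <= b. *)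
Definition intv := (nat * nat)%type.

Definition in_int (j : nat) (I : intv) : bool := (I.1 <= j <= I.2)%N.
Definition int_len (I : intv) : nat := (I.2.+1 - I.1)%N.

Definition xi (i : nat) (I : intv) : intv :=
  if (i <= I.1)%N then (I.1.+2, I.2.+2)
  else if (I.2.+2 <= i)%N then I
  else (I.1, I.2.+2).

Definition t_map (i : nat) (B : {fset intv}) : {fset intv} :=
  ((i, i) |` [fset xi i J | J in B])%fset.

Definition primS (D : nat) : {fset {fset intv}} :=
  if odd D then
    (fset0 |`
      ([fset [fset (m, D - m)%N | m in iota 1 k]
         | k in [seq k <- iota 1 (D.-1)./2 | odd k]] `|`
       [fset [fset (m.+1, D.+1 - m)%N | m in iota 1 k]
         | k in [seq k <- iota 1 (D.-1)./2 | odd k]]))%fset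
  else
    (fset0 |` [fset [fset (m, D.+1 - m)%N | m in iota 1 k]
                | k in iota 1 D./2])%fset.

Fixpoint bbS (D : nat) : {fset {fset intv}} :=
  match D with
  | 0 => [fset fset0]%fset
  | 1 => [fset fset0; [fset (1, 1)%N]]%fset
  | D'.+2 => (primS D'.+2 `|`
              [fset t_map i B | i in iota 1 D'.+2, B in bbS D'])%fset
  end.

Definition Sodd (D : nat) : {fset {fset intv}} :=
  [fset B in bbS D | all (fun I => odd (int_len I)) (enum_fset B)]%fset.

(* The maximal intervals of {j in [1,D] : P j}, from left to right. *)
Definition runs (D : nat) (P : pred nat) : seq intv :=
  zip [seq j <- iota 1 D | P j && ((j == 1%N) || ~~ P j.-1)]
      [seq j <- iota 1 D | P j && ((j == D) || ~~ P j.+1)].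

(* With [a_1,b_1], ..., [a_s,b_s] the maximal intervals of the union of B, this
   is the list of the pairs (b_{i-1} + 1, a_i), i in [1,s+1], where b_0 = -1 and
   a_{s+1} = D + 2; the shift of b_{i-1} keeps everything in nat. *)
Definition gaps (D : nat) (B : {fset intv}) : seq (nat * nat) :=
  let r := runs D (fun j => has (in_int j) (enum_fset B)) in
  zip (0%N :: [seq J.2.+1 | J <- r]) (rcons [seq J.1 | J <- r] D.+2).

(* The intervals I_1, ..., I_Delta, Delta = D - 2|B|, sorted from left to right. *)
Definition blocks (D : nat) (B : {fset intv}) : seq intv :=
  let g := gaps D B in
  let big := [seq p <- g | p.1.+2 <= p.2]%N in
  sort (fun I J : intv => I.1 <= J.1)%N
    ([seq (p.1.-1, p.2) | p <- zip [seq p.2 | p <- big] (behead [seq p.1 | p <- big])]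
     ++ [seq (j, j) | p <- g, j <- iota p.1.+1 (p.2 - p.1 - 2)]).

(* I_{[c,d]}: the I_j are consecutive, so their union is an interval. *)
Definition block_union (D : nat) (B : {fset intv}) (c d : nat) : intv :=
  ((nth (0, 0)%N (blocks D B) c.-1).1, (nth (0, 0)%N (blocks D B) d.-1).2).

Definition Bk (D : nat) (B : {fset intv}) (k : nat) : {fset intv} :=
  let Delta := (D - 2 * #|` B|)%N in
  let top := (if odd D then Delta else Delta.+1) in
  (B `|` [fset block_union D B m (top - m)%N | m in iota 1 k])%fset.

Definition V (D : nat) := 'rV['F_2]_D.

(* The basis is e_1, ..., e_D, while matrix columns are numbered from 0. *)
Definition ebas (D : nat) (i : nat) : V D := \row_(j < D) (j.+1 == i)%:R.

Definition eint (D : nat) (I : intv) : V D :=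
  \sum_(I.1 <= i < I.2.+1) ebas D i.

Definition span_set (D : nat) (s : seq (V D)) : {set V D} :=
  [set v | v \in <<s>>%VS].

Definition sform (D : nat) (x y : V D) : 'F_2 :=
  \sum_(i < D) \sum_(j < D | (i == j.+1 :> nat) || (j == i.+1 :> nat))
     x 0 i * y 0 j.

(* V_D^delta, with delta = 1 encoded as true *)
Definition Vdelta (D : nat) (delta : bool) : {set V D} :=
  span_set [seq ebas D i | i <- iota 1 D & odd i == delta].

(* Z^! for Z contained in V_D^(1 - delta) *)
Definition bang (D : nat) (delta : bool) (Z : {set V D}) : {set V D} :=
  [set x in Vdelta D delta | [forall y in Z, sform x y == 0]].

Definition EB (D : nat) (B : {fset intv}) : {set V D} :=
  span_set [seq eint D J | J <- enum_fset B].

Definition calF (D : nat) : {set {set V D}} :=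
  [set:: [seq EB D B | B <- enum_fset (Sodd D)]].

(* The symbol a is encoded as 0, so that [1,D] + {a} becomes [0,D]. *)
Definition in_star (j : nat) (I : intv) : bool :=
  if odd (int_len I) then in_int j I else ~~ in_int j I.

Definition ebar (D : nat) (j : nat) : V D :=
  if j == 0%N then eint D (1, D)%N else ebas D j.

Definition nstar (C : {fset intv}) (j : nat) : nat :=
  count (in_star j) (enum_fset C).

(* j lies in the union of all members of C^* that contain a *)
Definition in_union_a (C : {fset intv}) (j : nat) : bool :=
  has (fun I => in_star 0 I && in_star j I) (enum_fset C).

(* The complement of this union in [1,D] is [l+1,l'-1]. *)
Definition coreC (D : nat) (C : {fset intv}) : seq nat :=
  [seq j <- iota 1 D | ~~ in_union_a C j].
Definition core_l (D : nat) (C : {fset intv}) : nat := (head 0%N (coreC D C)).-1.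
Definition core_l' (D : nat) (C : {fset intv}) : nat := (last 0%N (coreC D C)).+1.

Definition eps_coef (D : nat) (C : {fset intv}) (j : nat) : 'F_2 :=
  let n := nstar C j in
  let u := if (core_l' D C <= j)%N then core_l' D C else core_l D C in
  if [&& odd D, j != 0%N, in_union_a C j & odd u == odd j]
  then ((n.+1 * n.+2)./2)%:R
  else ((n * n.+1)./2)%:R.

(* epsilon_D(C^* ) *)
Definition eps (D : nat) (C : {fset intv}) : V D :=
  \sum_(0 <= j < D.+1) eps_coef D C j *: ebar D j.

Definition supp (D : nat) (v : V D) : pred nat :=
  fun i => [exists j : 'I_D, (j.+1 == i) && (v 0 j != 0)].

Definition ufun (D : nat) (v : V D) : int :=
  \sum_(J <- runs D (supp v) | odd J.1 != odd J.2) (-1) ^+ J.1.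

Definition utilde (D : nat) (v : V D) : nat :=
  let x := ufun v in
  if odd D then
    if 0 < x then absz (2 * x - 1)%R
    else if x < 0 then absz (- 2 * x + 1)%R else 0%N
  else
    if 0 <= x then absz (2 * x)%R else absz (- 2 * x - 1)%R.

(** * Types B and C *)

(* M(V_D^delta) is identified with V_D. *)

Definition pairBC (D : nat) (delta : bool) (E : {set V D}) :
    {set V D} * {set V D} :=
  (E :&: Vdelta D delta, bang delta (E :&: Vdelta D (~~ delta))).

Definition indexBC (D : nat) : seq ({fset intv} * nat) :=
  [seq (B, k) | B <- enum_fset (Sodd D), k <- iota 0 (D./2 - #|` B|).+1].

(* Exactly one index gives v, so the head of the filtered list is that index. *)
Definition alphaBC (D : nat) (delta : bool) (v : V D) : {set V D} * {set V D} :=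
  let p := head (fset0, 0%N)
             [seq p <- indexBC D | eps D (Bk D p.1 p.2) == v] in
  pairBC delta (EB D p.1).

Definition dataBC (D : nat) (delta : bool) : Udata_type :=
  @UData (V D) [set: V D] (V D)
    (preim_partition (@utilde D) [set: V D])
    [set pairBC delta E | E in calF D]
    (@alphaBC D delta).

(** * Type D *)

Definition etaD (D : nat) : V D := \sum_(1 <= i < D.+1 | odd i) ebas D i.

(* V'_D = V_D / F eta_D is the set of cosets pi(v) = {v, v + eta_D}. *)
Definition piD (D : nat) (v : V D) : {set V D} := [set v; v + etaD D].

Definition VD' (D : nat) : {set {set V D}} := [set piD v | v in [set: V D]].

(* V_{D'} as a subspace of V_D *)
Definition Vsub (D D' : nat) : {set V D} :=
  span_set [seq ebas D i | i <- iota 1 D'].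

Definition utilde' (D : nat) (v' : {set V D}) : nat :=
  if [pick v in Vsub D D.-1 | piD v == v'] is Some v then utilde v else 0%N.

Definition pairD (D : nat) (E : {set V D}) :
    {set {set V D}} * {set {set V D}} :=
  ([set piD x | x in E :&: Vdelta D true],
   [set piD x | x in bang true (E :&: Vdelta D false)]).

Definition oddks (D : nat) (B : {fset intv}) : seq nat :=
  [seq k <- iota 1 ((D - 2 * #|` B| - 1)./2) | odd k].

Definition indexD (D : nat) : seq ({fset intv} * nat) :=
  [seq (B, k) | B <- enum_fset (Sodd D.-1), k <- 0%N :: oddks D B] ++
  [seq (B, k) | B <- [seq B <- enum_fset (Sodd D `\` Sodd D.-1)%fset
                      | 2 * #|` B| < D.-1]%N,
                k <- oddks D B].

(* Exactly one index gives v', so the head of the filtered list is that index. *)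
Definition alphaD (D : nat) (v' : {set V D}) :
    {set {set V D}} * {set {set V D}} :=
  let p := head (fset0, 0%N)
             [seq p <- indexD D | piD (eps D (Bk D p.1 p.2)) == v'] in
  pairD (EB D p.1).

Definition dataD (D : nat) : Udata_type :=
  @UData {set V D} (VD' D) {set V D}
    (preim_partition (@utilde' D) (VD' D))
    [set pairD E | E in calF D]
    (@alphaD D).

(** * Type A *)

Definition dataA : Udata_type :=
  @UData unit [set: unit] unit [set [set: unit]]
    [set ([set: unit], [set: unit])] (fun _ => ([set: unit], [set: unit])).

(** * The set M(Gamma) of a finite group *)

(* An irreducible complex representation of the centralizer of x is given by
   (the index of) its character. *)
Definition Mpair (gT : finGroupType) : finType := {x : gT & Iirr 'C[x]%g}.

Definition Mconj (gT : finGroupType) (p q : Mpair gT) : bool :=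
  [exists g : gT, (tag q == tag p ^ g)%g &&
    [forall z in 'C[tag p]%g, 'chi_(tagged q) (z ^ g)%g == 'chi_(tagged p) z]].

Definition Mgrp (gT : finGroupType) : {set {set Mpair gT}} :=
  equivalence_partition (@Mconj gT) [set: Mpair gT].

(* The element (x, rho) of M(Gamma), for rho the irreducible representation of
   the centralizer of x whose character is (the restriction of) f. *)
Definition Melt (gT : finGroupType) (x : gT) (f : gT -> algC) :
    {set Mpair gT} :=
  [set p | [exists g : gT, (tag p == x ^ g)%g &&
     [forall z in 'C[x]%g, 'chi_(tagged p) (z ^ g)%g == f z]]].

(** * Symmetric groups: subgroups, elements and characters *)

(* Everything is defined for the permutations of the n + 1 points 0, ..., n. *)
Local Notation perms n := {perm 'I_n.+1}.

(* The standard subgroup of type S_2 moves the last two points and those of type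
   S_3, S_4, S_5 the first ones, so that the inclusions H_{2!}, H_{3!} < H_{2!3!}
   and H_{2!} < H_{2!2!} < H_8 hold. *)
Definition Hfirst {n : nat} (k : nat) : {set perms n} :=
  perm.Sym [set j : 'I_n.+1 | j < k]%N.
Definition Hone {n : nat} : {set perms n} := [set 1%g].
Definition H2 {n : nat} : {set perms n} :=
  perm.Sym [set j : 'I_n.+1 | n <= j.+1]%N.
Definition H3 {n : nat} : {set perms n} := Hfirst 3.
Definition H4 {n : nat} : {set perms n} := Hfirst 4.
Definition H5 {n : nat} : {set perms n} := Hfirst 5.
Definition H22 {n : nat} : {set perms n} := (Hfirst 2 * H2)%g.
Definition H23 {n : nat} : {set perms n} := (H2 * Hfirst 3)%g.
Definition H8 {n : nat} : {set perms n} :=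
  <<(tperm (inord 0) (inord n.-1) * tperm (inord 1) (inord n))%g |: H22>>%g.

(* The cycle (0 1 ... m-1), products of permutations being read from left to
   right. *)
Definition gcyc {n : nat} (m : nat) : perms n :=
  (\prod_(1 <= k < m) tperm (inord 0) (inord k))%g.
Definition g2' {n : nat} : perms n :=
  (tperm (inord 0) (inord 1) * tperm (inord 2) (inord 3))%g.
Definition g6 {n : nat} : perms n :=
  (gcyc 3 * tperm (inord 3) (inord 4))%g.

Definition chi1 {n : nat} : perms n -> algC := fun _ => 1.
Definition sgn {n : nat} : perms n -> algC := fun s => (-1) ^+ odd_perm s.

Definition fixpts {n : nat} (s : perms n) : nat := #|[set j | s j == j]|.
Definition fixpairs {n : nat} (s : perms n) : nat :=
  #|[set A : {set 'I_n.+1} | (#|A| == 2%N) && (s @: A == A)]|.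

(* The reflection representation lambda^1 and its exterior square lambda^2.  The
   other exterior powers are given by lambda^(n-k) = lambda^k (x) sgn. *)
Definition lam1 {n : nat} : perms n -> algC := fun s => (fixpts s)%:R - 1.
Definition lam2 {n : nat} : perms n -> algC :=
  fun s => (lam1 s ^+ 2 - lam1 (s * s)%g) / 2.

(* For n + 1 >= 4, the irreducible representation attached to the partition
   (n-1,2), i.e., sigma for S_4 and nu for S_5 (while nu' = nu (x) sgn): it is the
   difference of the permutation representations on pairs and on points. *)
Definition chi_two {n : nat} : perms n -> algC :=
  fun s => (fixpairs s)%:R - (fixpts s)%:R.

(* An element of the centralizer of gcyc m which maps 0 to k < m acts on the points
   0, ..., m-1 as the k-th power of gcyc m.  For w ^+ m = 1 this is therefore the
   linear character of the centralizer with value w at gcyc m that is trivial on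
   the permutations of the other points. *)
Definition cych {n : nat} (w : algC) : perms n -> algC :=
  fun s => w ^+ s (inord 0).

(* Centralizer of g_2 = (0 1) in S_5: the two-dimensional representation of the
   factor permuting the points 2, 3, 4. *)
Definition refl3 {n : nat} : perms n -> algC :=
  fun s => #|[set j : 'I_n.+1 | (1 < j)%N && (s j == j)]|%:R - 1.

(* Centralizer of g_2' = (0 1)(2 3), dihedral of order 8, identified with the
   Weyl group of type B_2 having r as reflection representation: epsilon is the
   sign (determinant of r), epsilon' is the restriction of sgn, epsilon'' is -1
   exactly on the elements that exchange {0,1} and {2,3}. *)
Definition dih' {n : nat} : perms n -> algC := sgn.
Definition dih'' {n : nat} : perms n -> algC :=
  fun s => (-1) ^+ (1 < s (inord 0))%N.
Definition dih_eps {n : nat} : perms n -> algC := dih' \* dih''.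
Definition dih_r {n : nat} : perms n -> algC :=
  fun s => if s == 1%g then 2 else if s == g2' then - 2 else 0.

(** * Exceptional types *)

(* Lists the pairs (Y, X) in Hbar_c together with the corresponding
   fibres of alpha_c. *)
Definition alpha_table (gT : finGroupType) :=
  seq (({set gT} * {set gT}) * seq {set Mpair gT}).

Definition table_alpha (gT : finGroupType) (t : alpha_table gT)
    (m : {set Mpair gT}) : {set gT} * {set gT} :=
  (head ((set0, set0), [::]) [seq r <- t | m \in r.2]).1.

Definition dataExc (gT : finGroupType) (t : alpha_table gT)
    (s : seq {set {set Mpair gT}}) : Udata_type :=
  @UData {set Mpair gT} (Mgrp gT) gT [set:: s]
    [set:: [seq r.1 | r <- t]] (table_alpha t).

Definition alone (T : finType) (s : seq T) : seq {set T} := [seq [set x] | x <- s].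

(* Adds to a list of series the one formed by the remaining elements of M. *)
Definition with_rest (gT : finGroupType) (s : seq {set {set Mpair gT}}) :
    seq {set {set Mpair gT}} :=
  (Mgrp gT :\: \bigcup_(A <- s) A) :: s.

(** ** S_1 *)

Definition tableS1 : alpha_table {perm 'I_1} :=
  [:: ((Hone, Hone), [:: Melt 1%g chi1])].

Definition dataS1 : Udata_type := dataExc tableS1 [:: Mgrp {perm 'I_1}].

(** ** S_2 *)

Definition tableS2 : alpha_table {perm 'I_2} :=
  let g2 := gcyc 2 in
  [:: ((Hone, H2), [:: Melt 1%g chi1; Melt g2 sgn]);
      ((H2, H2), [:: Melt g2 chi1]);
      ((Hone, Hone), [:: Melt 1%g sgn])].

Definition dataS2_3 : Udata_type :=
  let g2 := gcyc 2 in
  dataExc tableS2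
    [:: [set:: [:: Melt 1%g chi1; Melt g2 chi1; Melt 1%g sgn]];
        [set Melt g2 sgn]].

Definition dataS2_2 : Udata_type :=
  let g2 := gcyc 2 in
  dataExc tableS2
    [:: [set:: [:: Melt 1%g chi1; Melt g2 chi1]];
        [set Melt g2 sgn]; [set Melt 1%g sgn]].

(** ** S_3 *)

Definition tableS3 (theta : algC) : alpha_table {perm 'I_3} :=
  let g2 := gcyc 2 in
  let g3 := gcyc 3 in
  [:: ((Hone, H3), [:: Melt 1%g chi1; Melt g3 (cych theta);
                       Melt g3 (cych (theta ^+ 2))]);
      ((H3, H3), [:: Melt g3 chi1]);
      ((Hone, H2), [:: Melt 1%g lam1; Melt g2 sgn]);
      ((H2, H2), [:: Melt g2 chi1]);
      ((Hone, Hone), [:: Melt 1%g sgn])].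

Definition aloneS3 (theta : algC) : seq {set Mpair {perm 'I_3}} :=
  let g2 := gcyc 2 in
  let g3 := gcyc 3 in
  [:: Melt g3 (cych theta); Melt g3 (cych (theta ^+ 2)); Melt g2 sgn].

Definition dataS3_5 (theta : algC) : Udata_type :=
  dataExc (tableS3 theta) (with_rest (alone (aloneS3 theta))).

Definition dataS3_4 (theta : algC) : Udata_type :=
  dataExc (tableS3 theta)
    (with_rest (alone (Melt 1%g sgn :: aloneS3 theta))).

(** ** S_4 *)

(* The representations epsilon', epsilon'', epsilon of the centralizer of g_2,
   which is generated by (0 1) and (2 3), are -1, 1, -1 on (0 1) and 1, -1, -1 on
   (2 3). *)
Definition tableS4 (i theta : algC) : alpha_table {perm 'I_4} :=
  let g2 := gcyc 2 in
  let g3 := gcyc 3 in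
  let g4 := gcyc 4 in
  let ep' := cych (-1) in
  let ep'' := cych (-1) \* sgn in
  [:: ((Hone, H4), [:: Melt 1%g chi1; Melt g4 (cych i); Melt g4 (cych (- i))]);
      ((H4, H4), [:: Melt g4 chi1]);
      ((H22, H8), [:: Melt g2' chi1; Melt g4 (cych (-1))]);
      ((H8, H8), [:: Melt g2' dih']);
      ((Hone, H22), [:: Melt 1%g chi_two; Melt g2 ep'; Melt g2' dih_eps]);
      ((H2, H22), [:: Melt g2 chi1; Melt g2' dih_r]);
      ((H22, H22), [:: Melt g2' dih'']);
      ((Hone, H3), [:: Melt 1%g lam1; Melt g3 (cych theta);
                       Melt g3 (cych (theta ^+ 2))]);
      ((H3, H3), [:: Melt g3 chi1]);
      ((Hone, H2), [:: Melt 1%g lam2; Melt g2 sgn]);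
      ((H2, H2), [:: Melt g2 ep'']);
      ((Hone, Hone), [:: Melt 1%g sgn])].

Definition dataS4 (i theta : algC) : Udata_type :=
  let g2 := gcyc 2 in
  let g3 := gcyc 3 in
  let g4 := gcyc 4 in
  dataExc (tableS4 i theta) (with_rest
    ([set:: [:: Melt g2 (cych (-1)); Melt g2' dih_r; Melt g4 (cych (-1))]] ::
     alone [:: Melt g4 (cych i); Melt g4 (cych (- i)); Melt g3 (cych theta);
               Melt g3 (cych (theta ^+ 2)); Melt g2' dih_eps; Melt g2 sgn;
               Melt 1%g sgn])).

(** ** S_5 *)

(* Centralizer of g_2: representations 1, r, epsilon of the factor S_3, preceded
   by a sign - when g_2 acts as -1; thus -epsilon is the restriction of sgn.
   Centralizer of g_3: epsilon is the restriction of sgn.  Centralizer of g_6: the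
   representations are named after the value at g_6, where sgn is -1. *)
Definition tableS5 (i theta zeta : algC) : alpha_table {perm 'I_5} :=
  let g2 := gcyc 2 in
  let g3 := gcyc 3 in
  let g4 := gcyc 4 in
  let g5 := gcyc 5 in
  let neg := cych (-1) in
  let th := cych theta in
  let th2 := cych (theta ^+ 2) in
  [:: ((Hone, H5), [:: Melt 1%g chi1; Melt g5 (cych zeta);
                       Melt g5 (cych (zeta ^+ 2)); Melt g5 (cych (zeta ^+ 3));
                       Melt g5 (cych (zeta ^+ 4))]);
      ((H5, H5), [:: Melt g5 chi1]);
      ((Hone, H4), [:: Melt 1%g lam1; Melt g4 (cych i); Melt g4 (cych (- i))]);
      ((H4, H4), [:: Melt g4 chi1]);
      ((Hone, H23), [:: Melt 1%g chi_two; Melt g2 neg; Melt g3 th; Melt g3 th2;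
                        Melt g6 (sgn \* th); Melt g6 (sgn \* th2)]);
      ((H2, H23), [:: Melt g2 chi1; Melt g6 th; Melt g6 th2]);
      ((H3, H23), [:: Melt g3 chi1; Melt g6 sgn]);
      ((H23, H23), [:: Melt g6 chi1]);
      ((H22, H8), [:: Melt g2' chi1; Melt g4 (cych (-1))]);
      ((H8, H8), [:: Melt g2' dih']);
      ((Hone, H22), [:: Melt 1%g (chi_two \* sgn); Melt g2 (neg \* refl3);
                        Melt g2' dih_eps]);
      ((H2, H22), [:: Melt g2 refl3; Melt g2' dih_r]);
      ((H22, H22), [:: Melt g2' dih'']);
      ((Hone, H3), [:: Melt 1%g lam2; Melt g3 (sgn \* th);
                       Melt g3 (sgn \* th2)]);
      ((H3, H3), [:: Melt g3 sgn]);
      ((Hone, H2), [:: Melt 1%g (lam1 \* sgn); Melt g2 sgn]);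
      ((H2, H2), [:: Melt g2 (neg \* sgn)]);
      ((Hone, Hone), [:: Melt 1%g sgn])].

Definition dataS5 (i theta zeta : algC) : Udata_type :=
  let g2 := gcyc 2 in
  let g3 := gcyc 3 in
  let g4 := gcyc 4 in
  let g5 := gcyc 5 in
  let neg := cych (-1) in
  let th := cych theta in
  let th2 := cych (theta ^+ 2) in
  dataExc (tableS5 i theta zeta) (with_rest
    ([set:: [:: Melt g3 th; Melt g6 th]] ::
     [set:: [:: Melt g3 th2; Melt g6 th2]] ::
     [set:: [:: Melt g2 neg; Melt g2 (neg \* refl3); Melt g2' dih_r;
                Melt g4 (cych (-1)); Melt g6 sgn]] ::
     alone [:: Melt g5 (cych zeta); Melt g5 (cych (zeta ^+ 2));
               Melt g5 (cych (zeta ^+ 3)); Melt g5 (cych (zeta ^+ 4));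
               Melt g4 (cych i); Melt g4 (cych (- i));
               Melt g6 (sgn \* th); Melt g6 (sgn \* th2);
               Melt g3 (sgn \* th); Melt g3 (sgn \* th2);
               Melt g2' dih_eps; Melt g2 sgn; Melt 1%g sgn])).

(** * All families *)

(* The index of an exceptional family with G_c = S_2 or S_3 is followed by |c|. *)
Inductive Wfamily : Type :=
  | FamA
  | FamBC (D : nat) (delta : bool) of ~~ odd D
  | FamD (D : nat) of odd D
  | FamS1
  | FamS2_3
  | FamS2_2
  | FamS3_5
  | FamS3_4
  | FamS4
  | FamS5.

(* i, theta, zeta are primitive roots of 1 of order 4, 3, 5. *)
Definition Udata (i theta zeta : algC) (c : Wfamily) : Udata_type :=
  match c with
  | FamA => dataA
  | FamBC D delta _ => dataBC D delta
  | FamD D _ => dataD D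
  | FamS1 => dataS1
  | FamS2_3 => dataS2_3
  | FamS2_2 => dataS2_2
  | FamS3_5 => dataS3_5 theta
  | FamS3_4 => dataS3_4 theta
  | FamS4 => dataS4 i theta
  | FamS5 => dataS5 i theta zeta
  end.

(* Main.v *)
Require Import Defs.
From mathcomp Require Import all_boot all_order all_algebra all_fingroup.
From mathcomp Require Import all_solvable all_field all_character.
From mathcomp Require Import finmap.
From mathcomp Require Import zify ring.

Set Implicit Arguments.
Unset Strict Implicit.
Unset Printing Implicit Defensive.

Import Order.TTheory GRing.Theory Num.Theory.

Local Open Scope ring_scope.

(** Every element m of a series lies in the fibre of alpha over alpha m.  Hence the
    map from the h that meet the series exactly once to the series is a bijection
    as soon as alpha is injective on the series ([series_bijection]), and this is
    what is proved in each type.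

    Types B and C.  An interval [a,b] of [1,D] is viewed as the pair of points a and
    b + 1 of [1,D+1], and a vector v as the even set of points where its coordinates
    change.  A set B in S_D is then a noncrossing matching with no unmatched point
    under an arc, built by inserting adjacent pairs of points ([arcs]); the intervals
    I_1, I_2, etc. are bounded by consecutive unmatched points ([blocksE]), and B(k)
    adds k nested pairs of these.
    A vector is also a lattice path, with a step for each point, and the end of the
    path is at height 4 u(v), plus 1 if D is even ([ufunE]).  Let K be k for even k
    and - (k + 1) for odd k.  If n_j counts the starred members of B(k) that contain
    j, with the correction made for odd D ([level]), then n_j + j is odd exactly
    where the path of eps (B(k)) is above K ([path_Bk]).  The proof is by induction
    on B: inserting a pair of points inserts a detour of two opposite steps which
    leads away from K, and does not change the end.  So the end only depends on k, and 2 u = K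
    ([ufun_Bk]).  Conversely, if all such detours are removed from a path, the
    remaining path is determined by its end; therefore every vector is of the form
    eps (B(k)) ([Bk_surj]).

    Now let v and w, from (B, k) and (C, l), be in the same series with the same
    image under alpha.  Then u(v) = u(w), so k = l.  The space E_B consists of the
    unions of matched pairs, so an interval I with e_I in E_B belongs to B
    ([EB_eint]).  It is the sum of its even and odd parts ([EB_split]); one of them
    is given by alpha v, the other one is recovered from its annihilator
    ([bang_EB_sub]).  Hence B = C, and v = w.

    Type D.  Adding eta complements the set of points and turns the path upside
    down, so a coset has a representative with u <= 0, and this is the one which is
    of the form eps (B(k)).  The function on cosets uses the representative with
    last coordinate 0; whether this is the same one depends only on B
    ([supp_last_Bk]), so that it still determines k.  An interval may also
    belong to E_B up to complement, but only when B leaves at most two points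
    unmatched ([EB_eint_eta]), and the restrictions on the pairs (B, k) prevent this
    from identifying two of them ([pairD_sub]).

    Exceptional types.  The table of alpha and the series are finite lists, and the
    claim is that a series meets a row of the table at most once.  This is decided
    on positions in an enumeration of M(S_n), for which one needs that the elements
    are distinct and exhaust M(S_n) ([Melts_complete]).  Both facts follow from the
    regular character: if a list of irreducible characters, weighted by their
    degrees, adds up to it, then each irreducible character occurs in the list
    exactly once ([irr_list_complete]).  All required identities are checked on
    permutations written as lists of images. *)

(** * Intervals and matchings *)

(** Coordinates are numbered from 0 to D + 1, the outer two being 0, and the
    point x of [1,D+1] lies between the coordinates x - 1 and x.  Removing the
    points i and i + 1 merges the coordinates i - 1, i, i + 1 into one. *)
Definition del (i j : nat) : nat :=
  if (j < i)%N then j else if j == i then i.-1 else (j - 2)%N.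

(** The renumbering of the remaining points that goes with [del]. *)
Definition bump2 (i x : nat) : nat := if (x < i)%N then x else x.+2.

Definition covered (B : {fset intv}) (j : nat) : bool :=
  has (in_int j) (enum_fset B).

Lemma xi_inj i : injective (xi i).
Proof.
move=> [a b] [c d]; rewrite /xi /=.
case: (leqP i a) => ia; case: (leqP i c) => ic;
  case: (leqP b.+2 i) => ib; case: (leqP d.+2 i) => id [] ? ?;
  congr (_, _); lia.
Qed.

Lemma xi_neq i J : xi i J != (i, i).
Proof.
case: J => [a b]; rewrite /xi /=; apply/eqP.
by case: (leqP i a) => ia; case: (leqP b.+2 i) => ib [] ? ?; lia.
Qed.

Lemma int_len_xi i J : odd (int_len (xi i J)) = odd (int_len J).
Proof.
case: J => [a b]; rewrite /xi /int_len /=.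
case: (leqP i a) => ia; case: (leqP b.+2 i) => ib /=; lia.
Qed.

(** The interval [xi i J] is J after insertion of the points i and i + 1. *)
Lemma in_int_xi i j J : (0 < i)%N -> in_int j (xi i J) = in_int (del i j) J.
Proof.
case: J => [a b] i0; rewrite /xi /in_int /del /=.
case: (leqP i a) => ia; case: (leqP b.+2 i) => ib /=;
  case: (ltngtP j i) => ji; lia.
Qed.

Lemma in_star_xi i j J : (0 < i)%N -> in_star j (xi i J) = in_star (del i j) J.
Proof. by move=> i0; rewrite /in_star int_len_xi in_int_xi. Qed.

Lemma mem_t_map i B J :
  (J \in t_map i B) = (J == (i, i)) || (J \in [seq xi i L | L <- enum_fset B]).
Proof.
rewrite /t_map in_fset1U; congr (_ || _).
apply/imfsetP/mapP => -[L LB ->]; exists L => //.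
Qed.

Lemma big_t_map (R : Type) (idx : R) (op : Monoid.com_law idx) i B (F : intv -> R) :
  \big[op/idx]_(J <- t_map i B) F J =
  op (F (i, i)) (\big[op/idx]_(J <- B) F (xi i J)).
Proof.
rewrite /t_map big_fsetU1.
  by congr (op _ _); rewrite big_imfset //= => x y _ _; apply: xi_inj.
by apply/imfsetP => -[J _ /eqP]; rewrite eq_sym (negPf (xi_neq _ _)).
Qed.

Lemma card_t_map i B : #|` t_map i B| = #|` B|.+1.
Proof.
rewrite /t_map cardfsU1 card_imfset; last exact: xi_inj.
case: imfsetP => [[J _ /eqP]|//].
by rewrite eq_sym (negPf (xi_neq _ _)).
Qed.

Lemma nstarE C j : nstar C j = (\sum_(J <- C) in_star j J)%N.
Proof. by rewrite /nstar -sum1_count big_mkcond; apply: eq_bigr. Qed.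

Lemma nstar_t_map i C j : (0 < i)%N ->
  nstar (t_map i C) j = (nstar C (del i j) + (j == i))%N.
Proof.
move=> i0; rewrite !nstarE big_t_map /= addnC; congr addn.
  by apply: eq_bigr => J _; rewrite in_star_xi.
by rewrite /in_star /int_len /in_int subSnn /= eqn_leq andbC.
Qed.

Lemma covered_t_map i B j : (0 < i)%N ->
  covered (t_map i B) j = (j == i) || covered B (del i j).
Proof.
move=> i0; apply/hasP/orP => [[J]|[/eqP->|/hasP[J JB jJ]]].
- rewrite mem_t_map => /orP[/eqP->|/mapP[L LB ->]].
    by rewrite /in_int /= => ?; left; lia.
  by rewrite in_int_xi // => jL; right; apply/hasP; exists L.
- by exists (i, i); rewrite ?mem_t_map ?eqxx // /in_int /= leqnn.
exists (xi i J); last by rewrite in_int_xi.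
by rewrite mem_t_map map_f ?orbT.
Qed.

(** An interval [a,b] stands for the pair of points a, b + 1 of [1,D+1], and B for
    a noncrossing matching, built by inserting adjacent pairs of points.  For odd D
    the members of [Sodd D] that match all points are left out. *)
Inductive arcs : nat -> {fset intv} -> Prop :=
  | arcs0 D : arcs D fset0
  | arcsS D i B : (0 < i <= D.+2)%N -> arcs D B -> arcs D.+2 (t_map i B).

Lemma arcs_widen D B : arcs D B -> arcs D.+1 B.
Proof.
elim=> [D'|D' i B' i_le _ IH]; first exact: arcs0.
by apply: arcsS => //; lia.
Qed.

Lemma arcs_card D B : arcs D B -> (2 * #|` B| <= D)%N.
Proof.
by elim=> [D'|D' i B' _ _ IH]; rewrite ?cardfs0 // card_t_map; lia.
Qed.

Lemma arcs_mem D B J : arcs D B -> J \in B ->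
  [/\ (0 < J.1)%N, (J.1 <= J.2)%N, (J.2 <= D)%N & odd (int_len J)].
Proof.
move=> BD; elim: BD J => [D'|D' i B' i_le _ IH] J; first by rewrite inE.
rewrite mem_t_map => /orP[/eqP->|/mapP[L /IH[L0 L12 LD oL] ->]].
  by case/andP: i_le; split; rewrite /= ?/int_len ?subSnn //=.
rewrite int_len_xi; case: L L0 L12 LD oL => a b /= L0 L12 LD oL; split=> //;
  rewrite /xi /=; by case: (leqP i a) => ?; case: (leqP b.+2 i) => ? /=; lia.
Qed.

Lemma bbS_SS D B : B \in bbS D.+2 <->
  B \in primS D.+2 \/ exists i B', [/\ (0 < i <= D.+2)%N, B' \in bbS D & B = t_map i B'].
Proof.
rewrite -[bbS D.+2]/(_ `|` _)%fset in_fsetU; split.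
  case/orP=> [|/imfset2P[i i_in [B' B'D ->]]]; first by left.
  have : i \in iota 1 D.+2 by exact: i_in.
  by rewrite mem_iota => i_le; right; exists i, B'; split=> //; lia.
case=> [->//|[i [B' [i_le B'D ->]]]]; apply/orP; right.
have i_in : i \in iota 1 D.+2 by rewrite mem_iota; lia.
by apply/imfset2P; exists i; [exact: i_in | exists B'].
Qed.

Definition all_odd (B : {fset intv}) : bool :=
  all (fun I => odd (int_len I)) (enum_fset B).

Lemma in_Sodd D B : (B \in Sodd D) = (B \in bbS D) && all_odd B.
Proof. by rewrite /Sodd !inE. Qed.

Lemma all_odd_t_map i B : all_odd (t_map i B) = all_odd B.
Proof.
apply/allP/allP => oB J.
  by move=> JB; rewrite -(int_len_xi i) oB // mem_t_map map_f ?orbT.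
rewrite mem_t_map => /orP[/eqP->|/mapP[L LB ->]].
  by rewrite /int_len /=; lia.
by rewrite int_len_xi oB.
Qed.

(** Every nonempty primitive set contains an interval of even length. *)
Lemma primS_odd D B : B \in primS D -> all_odd B -> B = fset0.
Proof.
have key k f : (0 < k)%N -> ~~ odd (int_len (f 1%N)) ->
    B = [fset f m | m in iota 1 k]%fset -> all_odd B -> B = fset0.
  move=> k0 of1 BE /allP oB; case/negP: of1; apply: oB; rewrite BE.
  by apply/imfsetP; exists 1%N => //=; rewrite mem_iota; lia.
rewrite /primS; case: ifP => oD; rewrite !in_fsetU !in_fset1.
  case/or3P=> [/eqP->//|/imfsetP[k] /=|/imfsetP[k] /=];
    rewrite mem_filter mem_iota => k_le BE; apply: key BE; rewrite /int_len /=; lia.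
case/orP=> [/eqP->//|/imfsetP[k] /=].
rewrite mem_iota => k_le BE; apply: key BE; rewrite /int_len /=; lia.
Qed.

Lemma arcs_Sodd D B : arcs D B -> B \in Sodd D.
Proof.
rewrite in_Sodd; elim=> [[|[|D']]|D' i B' i_le _ /andP[IHb IHo]].
- by rewrite /= inE.
- by rewrite /= !inE eqxx.
- apply/andP; split; last by apply/allP => J; rewrite inE.
  apply/bbS_SS; left; rewrite /primS.
  by case: ifP => _; rewrite !in_fsetU !in_fset1 eqxx.
rewrite all_odd_t_map IHo andbT; apply/bbS_SS; right.
by exists i, B'.
Qed.

Lemma Sodd_arcs D B : B \in Sodd D -> (2 * #|` B| <= D)%N -> arcs D B.
Proof.
rewrite in_Sodd => /andP[BD oB]; elim/ltn_ind: D B BD oB => -[|[|D]] IH B.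
- by rewrite inE => /eqP-> *; apply: arcs0.
- rewrite !inE => /orP[/eqP-> *|/eqP-> _]; first exact: arcs0.
  by rewrite cardfs1.
case/bbS_SS=> [Bp oB _|[i [B' [i_le B'D ->]]]].
  by rewrite (primS_odd Bp oB); apply: arcs0.
rewrite all_odd_t_map card_t_map => oB cB.
by apply: arcsS => //; apply: IH => //; lia.
Qed.

Lemma Sodd_even_card D B : ~~ odd D -> B \in Sodd D -> (2 * #|` B| <= D)%N.
Proof.
rewrite in_Sodd => oD /andP[BD oB]; elim/ltn_ind: D B oD BD oB => -[|[|D]] IH B //.
  by rewrite inE => _ /eqP-> _; rewrite cardfs0.
move=> oD /bbS_SS[Bp oB|[i [B' [i_le B'D ->]]]].
  by rewrite (primS_odd Bp oB) cardfs0.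
rewrite all_odd_t_map card_t_map => oB.
have : (2 * #|` B'| <= D)%N by apply: IH => //; lia.
lia.
Qed.

Lemma covered_out D B j : arcs D B -> covered B j -> (0 < j <= D)%N.
Proof.
move=> BD /hasP[[a b] /(arcs_mem BD)[/= ? ? ? _]]; rewrite /in_int /=; lia.
Qed.

(** If D is not covered, the last point is unmatched and can be dropped.  For even D
    the result may match all points, and then it does not come from [arcs]. *)
Lemma arcs_shrink D B : arcs D B -> odd D -> ~~ covered B D -> arcs D.-1 B.
Proof.
elim=> [D' _ _|D' i B' i_le BD' IH oD]; first exact: arcs0.
rewrite covered_t_map; last lia.
rewrite negb_or => /andP[iD]; have lt_iD : (i < D'.+2)%N by lia.
rewrite /del ltnNge (ltnW lt_iD) /= (negPf iD) subn2 /= => cB.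
case: D' i_le BD' IH oD iD lt_iD cB => [//|D'] i_le BD' IH oD iD lt_iD cB.
by apply: arcsS; [lia | apply: IH => //; lia].
Qed.

(** * The unmatched points and the sets B(k) *)

(** The point x touches the coordinates x - 1 and x. *)
Definition outside (U : pred nat) (m : nat) : seq nat :=
  [seq x <- iota 1 m | ~~ U x && ~~ U x.-1].

(** For p = (b + 1, a), where b is the end of a run and a the start of the next
    one, these are the points that lie strictly between the two runs. *)
Definition gap_points (p : nat * nat) : seq nat := iota p.1.+1 (p.2 - p.1 - 1).

Definition links (s : seq nat) : seq intv :=
  [seq (p.1, p.2.-1) | p <- zip s (behead s)].

Lemma filter_iotaS (p : pred nat) m :
  [seq x <- iota 1 m.+1 | p x] =
  if p m.+1 then rcons [seq x <- iota 1 m | p x] m.+1 else [seq x <- iota 1 m | p x].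
Proof. by rewrite -[m.+1]addn1 iotaD filter_cat /= add1n addn1; case: ifP; rewrite ?cats1 ?cats0. Qed.

(** The induction on m scans the coordinates from left to right.  S and T are the
    starts of the runs of U and the first coordinates after them; when m lies in
    U, the last run is still open and S is longer than T by one. *)
Lemma gap_points_flatten (U : pred nat) m : ~~ U 0%N ->
  let S := [seq j <- iota 1 m | U j && ~~ U j.-1] in
  let T := [seq j <- iota 1 m | ~~ U j && U j.-1] in
  size S = (size T + U m)%N /\
  flatten [seq gap_points p | p <- zip (0%N :: T) (if U m then S else rcons S m.+1)] =
    outside U m.
Proof.
move=> U0; elim: m => [|m]; first by rewrite (negPf U0).
cbv zeta; case; rewrite /outside !filter_iotaS [m.+1.-1]succnK.
set S := [seq j <- _ | U j && _]; set T := [seq j <- _ | _ && U _].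
case: (boolP (U m)) => Um; case: (boolP (U m.+1)) => Um1 /=; rewrite ?addn0 ?addn1 => sz <-.
- by rewrite sz.
- rewrite size_rcons sz; split=> //.
  rewrite -rcons_cons zip_rcons /= ?sz // map_rcons -cats1 flatten_cat /= cats0.
  have ->: gap_points (m.+1, m.+2) = [::] by rewrite /gap_points /=; have ->: (m.+2 - m.+1 - 1 = 0)%N by lia.
  by rewrite cats0.
- by rewrite size_rcons sz.
split=> //.
rewrite lastI !zip_rcons ?size_belast ?sz // !map_rcons -!cats1 !flatten_cat /= !cats0 -catA.
congr (_ ++ _); set l := last _ _.
have lm : (l <= m)%N.
  have : l \in 0%N :: T by apply: mem_last.
  by rewrite inE mem_filter mem_iota => /orP[/eqP->//|]; lia.
rewrite /gap_points /=.
have ->: (m.+2 - l - 1 = (m.+1 - l - 1) + 1)%N by lia.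
by rewrite iotaD /=; congr (_ ++ [:: _]); lia.
Qed.

Lemma runsE (U : pred nat) D : ~~ U 0%N -> ~~ U D.+1 ->
  let S := [seq j <- iota 1 D.+1 | U j && ~~ U j.-1] in
  let T := [seq j <- iota 1 D.+1 | ~~ U j && U j.-1] in
  runs D U = zip S (map predn T) /\ size S = size T.
Proof.
move=> U0 UD S T; have [sz _] := gap_points_flatten D.+1 U0.
rewrite (negPf UD) addn0 -/S -/T in sz; split=> //; rewrite /runs; congr zip.
  rewrite /S filter_iotaS (negPf UD) /=; apply: eq_in_filter => j.
  by rewrite mem_iota; case: j => [|[|j]] //= _; rewrite (negPf U0) andbT.
rewrite /T -[iota 1 D.+1]/(1%N :: iota 2 D) /= (negPf U0) andbF.
rewrite -[2%N]/(1 + 1)%N iotaDl filter_map -map_comp map_id_in => [|j _]; last by [].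
apply: eq_in_filter => j; rewrite mem_iota /= => jD; rewrite andbC add1n.
by case: (eqVneq j D) => [->|_] //; rewrite UD.
Qed.

Lemma gapsE D B : ~~ covered B 0 -> ~~ covered B D.+1 ->
  flatten [seq gap_points p | p <- gaps D B] = outside (covered B) D.+1.
Proof.
move=> U0 UD; have [_ <-] := gap_points_flatten D.+1 U0.
have [runE sz] := runsE U0 UD; rewrite (negPf UD).
congr flatten; congr map; rewrite /gaps -/(covered B) runE.
set S := [seq j <- _ | _ && ~~ _] in sz *; set T := [seq j <- _ | ~~ _ && _] in sz *.
have -> : [seq J.1 | J <- zip S (map predn T)] = S.
  by rewrite -/(unzip1 _) unzip1_zip // size_map sz.
have -> // : [seq J.2.+1 | J <- zip S (map predn T)] = T.
rewrite (map_comp succn snd) -/(unzip2 _) unzip2_zip ?size_map ?sz // -map_comp.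
by apply: map_id_in => j; rewrite mem_filter mem_iota => /andP[_ /andP[j0 _]]; apply: prednK.
Qed.

Lemma last_iota a n : last a (iota a.+1 n) = (a + n)%N.
Proof. by elim: n a => [|n IH] a /=; rewrite ?addn0 // IH addSnnS. Qed.

Lemma links_iota a n : links (iota a n.+1) = [seq (j, j) | j <- iota a n].
Proof. by elim: n a => // n IH a; rewrite [in RHS]/= -IH. Qed.

Lemma links_cat x s y t :
  links ((x :: s) ++ y :: t) = links (x :: s) ++ (last x s, y.-1) :: links (y :: t).
Proof. by elim: s x => //= z s IH x; rewrite -[in RHS]IH. Qed.

(** Inside a gap, two consecutive points bound a single coordinate.  The last
    point of a gap and the first point of the next gap that has points bound the
    runs in between, enlarged by one coordinate on either side. *)
Lemma big_gaps_links (g big : seq (nat * nat)) :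
  big = [seq p <- g | p.1.+2 <= p.2]%N ->
  perm_eq
    ([seq (p.1.-1, p.2) | p <- zip [seq p.2 | p <- big] (behead [seq p.1 | p <- big])]
     ++ [seq (j, j) | p <- g, j <- iota p.1.+1 (p.2 - p.1 - 2)])
    (links (flatten [seq gap_points p | p <- g])).
Proof.
move=> bigE.
have ->: [seq (j, j) | p <- g, j <- iota p.1.+1 (p.2 - p.1 - 2)] =
         [seq (j, j) | p <- big, j <- iota p.1.+1 (p.2 - p.1 - 2)].
  rewrite bigE; elim: g {bigE} => //= p g ->; case: leqP => //= h.
  by have ->: (p.2 - p.1 - 2 = 0)%N by lia.
have ->: flatten [seq gap_points p | p <- g] = flatten [seq gap_points p | p <- big].
  rewrite bigE; elim: g {bigE} => //= p g ->; case: leqP => //= h.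
  by rewrite /gap_points; have ->: (p.2 - p.1 - 1 = 0)%N by lia.
have: all (fun p => p.1.+2 <= p.2)%N big by rewrite bigE; apply: filter_all.
elim: big {g bigE} => // -[a b] [|[c d] g] IH /= /andP[ab gP].
  rewrite !cats0 /gap_points /=.
  have ->: (b - a - 1 = (b - a - 2).+1)%N by lia.
  by rewrite links_iota perm_refl.
have cd : (c.+2 <= d)%N by case/andP: gP.
move: (IH gP) => /=; rewrite /gap_points [(a, b).1]/= [(a, b).2]/= [(c, d).1]/= [(c, d).2]/=.
have ->: (b - a - 1 = (b - a - 2).+1)%N by lia.
have ->: (d - c - 1 = (d - c - 2).+1)%N by lia.
move=> {}IH; set r := flatten [seq gap_points p | p <- g] in IH *.
rewrite -[iota c.+1 (d - c - 2).+1 ++ r]/(c.+1 :: (iota c.+2 (d - c - 2) ++ r)) in IH *.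
rewrite -[iota a.+1 (b - a - 2).+1]/(a.+1 :: iota a.+2 (b - a - 2)) links_cat.
rewrite -[a.+1 :: iota a.+2 _]/(iota a.+1 (b - a - 2).+1) links_iota.
have ->: last a.+1 (iota a.+2 (b - a - 2)) = b.-1.
  by rewrite last_iota; lia.
rewrite -cat_cons perm_catC -!catA perm_cat2l.
by rewrite catA perm_catC /= perm_cons.
Qed.

Lemma size_links s : size (links s) = (size s).-1.
Proof. by rewrite /links size_map size_zip size_behead; lia. Qed.

Lemma nth_links s r : (r.+1 < size s)%N ->
  nth (0, 0)%N (links s) r = (nth 0%N s r, (nth 0%N s r.+1).-1).
Proof.
move=> rs; rewrite (nth_map (0, 0)%N) ?size_zip ?size_behead; last lia.
by rewrite nth_zip_cond size_zip size_behead nth_behead /=; case: ifP => //; lia.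
Qed.

Lemma linksP s J : J \in links s ->
  exists2 r, (r.+1 < size s)%N & J = (nth 0%N s r, (nth 0%N s r.+1).-1).
Proof.
case/(nthP (0, 0)%N) => r; rewrite size_links => rs <-; exists r; first by lia.
by rewrite nth_links //; lia.
Qed.

Lemma links_inj s : uniq s -> {in links s &, injective (fun J : intv => J.1)}.
Proof.
move=> us J J' /linksP[r rs ->] /linksP[r' rs' ->] /= /eqP.
by rewrite nth_uniq; [move/eqP-> | exact: ltnW | exact: ltnW |].
Qed.

Lemma sorted_links s : sorted ltn s -> sorted (fun J J' : intv => J.1 <= J'.1)%N (links s).
Proof.
by elim: s => // x [//|y [//|z s]] IH /= /andP[xy /IH /= ->]; rewrite ltnW.
Qed.

Definition unmatched (D : nat) (B : {fset intv}) : seq nat := outside (covered B) D.+1.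

Lemma unmatched_sorted D B : sorted ltn (unmatched D B).
Proof. by apply: sorted_filter (iota_ltn_sorted _ _); apply: ltn_trans. Qed.

Lemma unmatched_uniq D B : uniq (unmatched D B).
Proof. exact/filter_uniq/iota_uniq. Qed.

(** Between two consecutive unmatched points lies either nothing or a block of
    arcs: these are the intervals that the construction of B(k) lists. *)
Lemma blocksE D B : arcs D B -> blocks D B = links (unmatched D B).
Proof.
move=> BD; set leI := fun J J' : intv => (J.1 <= J'.1)%N.
have U0 : ~~ covered B 0 by apply/negP => /(covered_out BD).
have UD : ~~ covered B D.+1 by apply/negP => /(covered_out BD); lia.
have leT : total leI by move=> J J'; apply: leq_total.
have le_tr : transitive leI by move=> J J' J''; apply: leq_trans.
have := @big_gaps_links (gaps D B) _ erefl.
rewrite (gapsE U0 UD) -/(unmatched D B) => Eperm.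
rewrite -[RHS](sorted_sort le_tr (sorted_links (unmatched_sorted D B))).
apply/perm_sort_inP => //.
- by move=> ? ? _ _; apply: leT.
- by move=> ? ? ? _ _ _; apply: le_tr.
move=> J J'; rewrite !(perm_mem Eperm) => JL J'L.
rewrite /leI -eqn_leq => /eqP; exact: (links_inj (unmatched_uniq D B)).
Qed.

Lemma unmatched_t_map D i B : (0 < i <= D.+2)%N ->
  unmatched D.+2 (t_map i B) = map (bump2 i) (unmatched D B).
Proof.
move=> i_le; apply: (irr_sorted_eq ltn_trans ltnn (unmatched_sorted _ _)).
  rewrite sorted_map; apply: sub_sorted (unmatched_sorted D B) => x y /=.
  by rewrite /bump2; case: (ltnP x i) => ?; case: (ltnP y i) => ?; lia.
move=> x; rewrite mem_filter mem_iota !covered_t_map; try lia.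
apply/idP/mapP => [|[y]].
  rewrite !negb_or => /andP[/andP[/andP[xi cx] /andP[x1i cx1]] xD].
  have {}x1i : x != i.+1 by apply: contra x1i => /eqP->.
  exists (if (x < i)%N then x else (x - 2)%N); last first.
    by rewrite /bump2; case: (ltnP x i) => ?; case: ltnP => ?; lia.
  rewrite mem_filter mem_iota; move: cx cx1; rewrite /del.
  case: (ltnP x i) => xi' //=; rewrite ?(negPf xi).
    have ->: (x.-1 < i)%N by lia.
    by move=> -> -> /=; lia.
  have ->: (x.-1 < i)%N = false by lia.
  have ->: (x.-1 == i) = false by lia.
  have ->: (x.-1 - 2 = (x - 2).-1)%N by lia.
  by move=> -> -> /=; lia.
rewrite mem_filter mem_iota => /andP[/andP[cy cy1] yD] ->.
rewrite /bump2 /del; case: (ltnP y i) => yi.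
  have ->: (y.-1 < i)%N by lia.
  by rewrite yi !negb_or cy cy1; lia.
have ->: (y.+2 < i)%N = false by lia.
have ->: (y.+2 == i)%N = false by lia.
rewrite /=; have ->: (y.+1 < i)%N = false by lia.
have ->: (y.+1 == i)%N = false by lia.
by rewrite !subSS subn0 subn1 cy cy1 /=; lia.
Qed.

Lemma unmatched0 D : unmatched D fset0 = iota 1 D.+1.
Proof. by rewrite /unmatched /outside (@eq_filter _ _ xpredT) ?filter_predT. Qed.

Lemma size_unmatched D B : arcs D B -> size (unmatched D B) = (D.+1 - 2 * #|` B|)%N.
Proof.
elim=> [D'|D' i B' i_le BD' IH]; first by rewrite unmatched0 size_iota cardfs0.
by rewrite unmatched_t_map // size_map IH card_t_map; have := arcs_card BD'; lia.
Qed.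

(** Matched points come in pairs, so unmatched points alternate in parity. *)
Lemma odd_unmatched D B r : arcs D B -> (r < size (unmatched D B))%N ->
  odd (nth 0%N (unmatched D B) r) = ~~ odd r.
Proof.
move=> BD; elim: BD r => [D'|D' i B' i_le BD' IH] r.
  by rewrite unmatched0 size_iota => rD; rewrite nth_iota.
rewrite unmatched_t_map // size_map => rs; rewrite (nth_map 0%N) // -IH //.
by rewrite /bump2; case: ifP => //= _; rewrite negbK.
Qed.

Lemma nth_unmatched_lt D B r r' : (r < r' < size (unmatched D B))%N ->
  (nth 0%N (unmatched D B) r < nth 0%N (unmatched D B) r')%N.
Proof.
move=> /andP[rr' r's].
exact: (sorted_ltn_nth ltn_trans 0%N (unmatched_sorted D B) _ _ (ltn_trans rr' r's) r's rr').
Qed.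

Lemma nth_unmatched_in D B r : (r < size (unmatched D B))%N ->
  (0 < nth 0%N (unmatched D B) r <= D.+1)%N.
Proof. by move/(mem_nth 0%N); rewrite mem_filter mem_iota add1n => /andP[_]. Qed.

(** * Coordinates *)

Lemma F2_addb (a b : bool) : a%:R + b%:R = (a (+) b)%:R :> 'F_2.
Proof. by case: a; case: b; apply/val_inj. Qed.

Lemma F2_bool (x : 'F_2) : x = (x != 0)%:R.
Proof. by case: x => -[|[|n]] h; apply/val_inj. Qed.

Lemma F2_natr n : (n%:R : 'F_2) = (odd n)%:R.
Proof. by apply/val_inj; rewrite /= !val_Zp_nat //= modn2; case: odd. Qed.

Lemma F2_neq0 (b : bool) : (b%:R != 0 :> 'F_2) = b.
Proof. by case: b. Qed.

Lemma suppE D (v : V D) (j : 'I_D) : supp v j.+1 = (v 0 j != 0).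
Proof.
apply/existsP/idP => [[l /andP[/eqP[/val_inj->]]]//|vj].
by exists j; rewrite eqxx.
Qed.

Lemma supp_out D (v : V D) j : supp v j -> (0 < j <= D)%N.
Proof. by case/existsP=> l /andP[/eqP<- _]; rewrite ltn_ord. Qed.

(** A vector is handled through its boolean coordinates [supp v j], which make
    sense for all j and vanish outside [1,D]. *)
Lemma suppP D (v w : V D) : (forall j, (0 < j <= D)%N -> supp v j = supp w j) -> v = w.
Proof.
move=> vw; apply/rowP => j; rewrite [LHS]F2_bool [RHS]F2_bool -!suppE.
by rewrite vw //= ltn_ord.
Qed.

Lemma supp_row D (f : nat -> bool) j :
  supp (\row_(l < D) (f l.+1)%:R : V D) j = (0 < j <= D)%N && f j.
Proof.
apply/existsP/andP => [[l /andP[/eqP<-]]|[]].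
  by rewrite mxE F2_neq0 ltn_ord.
case: j => // j jD fj; exists (Ordinal jD).
by rewrite eqxx mxE F2_neq0.
Qed.

Lemma supp0 D j : supp (0 : V D) j = false.
Proof. by apply/existsP => -[l]; rewrite mxE eqxx andbF. Qed.

Lemma suppD D (v w : V D) j : supp (v + w) j = supp v j (+) supp w j.
Proof.
case: (boolP (0 < j <= D)%N) => [|jD]; last first.
  by rewrite !(contraNF (@supp_out D _ j)).
case: j => // j jD; rewrite -[j]/(val (Ordinal jD)) !suppE mxE.
by rewrite [v _ _]F2_bool [w _ _]F2_bool F2_addb !F2_neq0.
Qed.

Lemma suppZ D c (v : V D) j : supp (c *: v) j = (c != 0) && supp v j.
Proof.
by rewrite [c]F2_bool; case: (c != 0); rewrite ?scale1r ?scale0r ?supp0.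
Qed.

Lemma supp_ebas D i j : supp (ebas D i) j = (0 < j <= D)%N && (j == i).
Proof. exact: (supp_row D (fun l => l == i)). Qed.

Lemma supp_sum D (I : Type) (r : seq I) (P : pred I) (f : I -> V D) j :
  supp (\sum_(i <- r | P i) f i) j = \big[addb/false]_(i <- r | P i) supp (f i) j.
Proof.
apply: (big_morph (fun v : V D => supp v j)); last exact: supp0.
by move=> v w; apply: suppD.
Qed.

Lemma big_addb_pred1 m n j (P : pred nat) :
  \big[addb/false]_(m <= i < n | P i) (j == i) = (m <= j < n)%N && P j.
Proof.
case: (boolP (m <= j < n)%N) => jmn; last first.
  rewrite big1_seq // => i /andP[_]; rewrite mem_index_iota => imn.
  by apply/negbTE; apply: contra jmn => /eqP->.
rewrite big_mkcond (bigD1_seq j) ?mem_index_iota ?iota_uniq //= eqxx.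
rewrite big1 ?addbF ?if_same; first by case: (P j).
by move=> i /negPf ij; rewrite eq_sym ij if_same.
Qed.

Lemma supp_eint D J j : supp (eint D J) j = (0 < j <= D)%N && in_int j J.
Proof.
rewrite /eint supp_sum (eq_bigr (fun i => (0 < j <= D)%N && (j == i))); last first.
  by move=> i _; rewrite supp_ebas.
case: (0 < j <= D)%N => /=; last by rewrite big1_eq.
by rewrite (big_addb_pred1 _ _ _ xpredT) andbT ltnS.
Qed.

Lemma supp_eps D C j : (0 < j <= D)%N ->
  supp (eps D C) j = (eps_coef D C j != 0) (+) (eps_coef D C 0 != 0).
Proof.
move=> jD; rewrite /eps supp_sum big_ltn // addbC /=.
rewrite suppZ {2}/ebar eqxx supp_eint /in_int jD /= andbT.
rewrite (eq_big_nat _ _ (F2 := fun i => (eps_coef D C j != 0) && (j == i))); last first.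
  move=> i i0; rewrite suppZ /ebar; have ->: (i == 0%N) = false by lia.
  by rewrite supp_ebas jD /=; case: (eqVneq j i) => [->|_]; rewrite ?andbT ?andbF.
case: (eps_coef D C j != 0); last by rewrite /= big1_eq.
by rewrite (big_addb_pred1 _ _ _ xpredT) ltnS jD.
Qed.

(** ** The nested intervals added to B *)

Definition topk D (B : {fset intv}) := (if odd D then D - 2 * #|` B| else (D - 2 * #|` B|).+1)%N.

(** The blocks are bounded by consecutive unmatched points, so the m-th added
    interval is bounded by the unmatched points number m - 1 and top - m, counted
    from 0. *)
Definition nest D B m : intv :=
  (nth 0%N (unmatched D B) m.-1, (nth 0%N (unmatched D B) (topk D B - m)).-1).

Definition kvalid D (B : {fset intv}) k : bool :=
  (2 * k + 2 * #|` B| <= D)%N && (odd D ==> (k == 0%N) || odd k).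

Arguments nest : simpl never.

Lemma kvalid_t_map D i B k : kvalid D.+2 (t_map i B) k = kvalid D B k.
Proof. by rewrite /kvalid card_t_map /= negbK; congr (_ && _); lia. Qed.

Lemma odd_topk D B : arcs D B -> odd (topk D B).
Proof.
move=> /arcs_card BD; rewrite /topk; case: (boolP (odd D)) => oD; last first.
  by rewrite /= oddB // oddM (negPf oD).
by rewrite oddB // oddM oD.
Qed.

Lemma topk_t_map D i B : topk D.+2 (t_map i B) = topk D B.
Proof. by rewrite /topk card_t_map /= negbK; case: odd; lia. Qed.

Section Nest.
Variables (D : nat) (B : {fset intv}) (k : nat).
Hypotheses (BD : arcs D B) (kv : kvalid D B k).

Lemma nest_idx m : (0 < m <= k)%N ->
  (m.-1 < topk D B - m < size (unmatched D B))%N.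
Proof.
move=> mk; rewrite size_unmatched // /topk; move: kv; rewrite /kvalid.
by have := arcs_card BD; case: (boolP (odd D)) => oD; lia.
Qed.

Lemma BkE : Bk D B k = (B `|` [fset nest D B m | m in iota 1 k])%fset.
Proof.
have nestE m : m \in iota 1 k -> block_union D B m (topk D B - m) = nest D B m.
  rewrite mem_iota => mk; have {}mk : (0 < m <= k)%N by lia.
  have := nest_idx mk; rewrite /block_union blocksE // => m_idx.
  by rewrite !nth_links ?prednK //=; lia.
rewrite /Bk -/(topk D B); congr (_ `|` _)%fset; apply/fsetP => J.
by apply/imfsetP/imfsetP => -[m mk ->]; exists m; rewrite ?nestE.
Qed.

Lemma nest_in m : (0 < m <= k)%N ->
  [/\ (0 < (nest D B m).1)%N, ((nest D B m).1 <= (nest D B m).2)%N,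
      ((nest D B m).2 <= D)%N & ~~ odd (int_len (nest D B m))].
Proof.
move=> mk; have m_idx := nest_idx mk; have m0 : (0 < m)%N by case/andP: mk.
have lt12 := nth_unmatched_lt m_idx.
have in2 := nth_unmatched_in (proj2 (andP m_idx)).
have in1 := nth_unmatched_in (ltn_trans (proj1 (andP m_idx)) (proj2 (andP m_idx))).
have o1 := odd_unmatched BD (ltn_trans (proj1 (andP m_idx)) (proj2 (andP m_idx))).
have o2 := odd_unmatched BD (proj2 (andP m_idx)).
rewrite /nest /int_len /=; split; try lia.
move: lt12 o1 o2 in1 in2; set p := nth _ _ _; set q := nth _ _ _ => lt12 o1 o2 in1 in2.
have -> : (q.-1.+1 - p = q - p)%N by lia.
rewrite oddB; last lia.
rewrite o1 o2 oddB; last lia.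
rewrite (odd_topk BD) addTb.
case: m m0 {mk m_idx o1 o2 lt12 in1 in2 p q} => // m _ /=.
by case: (odd m).
Qed.

Lemma nest_nested m m' : (0 < m)%N -> (m < m' <= k)%N ->
  ((nest D B m).1 < (nest D B m').1)%N && ((nest D B m').2 < (nest D B m).2)%N.
Proof.
move=> m0 mm'; have m_idx : (m.-1 < topk D B - m < size (unmatched D B))%N.
  by apply: nest_idx; lia.
have m'_idx : (m'.-1 < topk D B - m' < size (unmatched D B))%N.
  by apply: nest_idx; lia.
have h1 : (nth 0%N (unmatched D B) m.-1 < nth 0%N (unmatched D B) m'.-1)%N.
  by apply: nth_unmatched_lt; lia.
have h2 : (nth 0%N (unmatched D B) (topk D B - m') <
           nth 0%N (unmatched D B) (topk D B - m))%N.
  by apply: nth_unmatched_lt; lia.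
have h3 := nth_unmatched_in (proj2 (andP m'_idx)).
by rewrite /nest /= h1 /=; lia.
Qed.

(** Both k and the number of blocks are odd here, and unmatched points alternate
    in parity. *)
Lemma nest_odd_ends : odd D -> (0 < k)%N ->
  odd (nest D B k).1 && ~~ odd (nest D B k).2.
Proof.
move=> oD k0; have kk : (0 < k <= k)%N by rewrite k0 leqnn.
have k_idx := nest_idx kk.
have o1 := odd_unmatched BD (ltn_trans (proj1 (andP k_idx)) (proj2 (andP k_idx))).
have o2 := odd_unmatched BD (proj2 (andP k_idx)).
have h3 := nth_unmatched_in (proj2 (andP k_idx)).
rewrite /nest /= o1; move: o2 h3; set q := nth _ _ _ => o2 h3.
have -> : odd q.-1 = ~~ odd q by case: q h3 {o2} => //= q; rewrite negbK.
rewrite o2; move: kv k_idx; rewrite /kvalid /topk oD; have := arcs_card BD.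
lia.
Qed.

Lemma nstar_Bk j :
  nstar (Bk D B k) j = (nstar B j + \sum_(1 <= m < k.+1) ~~ in_int j (nest D B m))%N.
Proof.
rewrite BkE !nstarE.
have nest_eq m : m \in iota 1 k -> (0 < m <= k)%N by rewrite mem_iota; lia.
rewrite (perm_big (enum_fset B ++ [seq nest D B m | m <- iota 1 k])) /=.
  rewrite big_cat big_map /index_iota subSS subn0 /=; congr addn.
  rewrite big_seq [RHS]big_seq; apply: eq_bigr => m /nest_eq/nest_in[_ _ _ oJ].
  by rewrite /in_star (negPf oJ).
apply: uniq_perm; first exact: fset_uniq.
  rewrite cat_uniq fset_uniq /= map_inj_in_uniq ?iota_uniq ?andbT.
    apply/hasPn => J /mapP[m /nest_eq/nest_in[_ _ _ oJ] ->].
    by apply/negP => /(arcs_mem BD)[_ _ _]; rewrite (negPf oJ).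
  move=> m m' /nest_eq mk /nest_eq m'k Em.
  case: (ltngtP m m') => // mm'.
    by have := @nest_nested m m'; rewrite Em ltnn; lia.
  by have := @nest_nested m' m; rewrite Em ltnn; lia.
move=> J; rewrite in_fsetU mem_cat; congr (_ || _).
by apply/imfsetP/mapP => -[m mk ->]; exists m.
Qed.

End Nest.

(** * The level function of B(k) *)

Lemma nest_t_map D i B k m : arcs D B -> (0 < i <= D.+2)%N -> kvalid D B k ->
  (0 < m <= k)%N -> nest D.+2 (t_map i B) m = xi i (nest D B m).
Proof.
move=> BD i_le kv mk; have m_idx := nest_idx BD kv mk.
rewrite /nest topk_t_map unmatched_t_map // !(nth_map 0%N); try lia.
have := nth_unmatched_lt m_idx.
set p := nth _ _ m.-1; set q := nth _ _ _ => pq; rewrite /bump2 /xi /=.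
case: (leqP i p) => ip.
  by congr pair; have -> : (q < i)%N = false; lia.
case: (ltnP q i) => iq; first by have -> : (q.-1.+2 <= i)%N by lia.
have -> : (q.-1.+2 <= i)%N = false by lia.
by congr pair; lia.
Qed.

Lemma Bk_t_map D i B k : arcs D B -> (0 < i <= D.+2)%N -> kvalid D B k ->
  Bk D.+2 (t_map i B) k = t_map i (Bk D B k).
Proof.
move=> BD i_le kv; rewrite !BkE ?kvalid_t_map //; last exact: arcsS.
rewrite /t_map imfsetU -fsetUA; congr (_ `|` (_ `|` _))%fset.
rewrite -imfset_comp; apply/fsetP => J.
have nestE m : m \in iota 1 k -> nest D.+2 (t_map i B) m = xi i (nest D B m).
  by rewrite mem_iota => mk; apply: nest_t_map kv _ => //; lia.
by apply/imfsetP/imfsetP => -[m mk ->]; exists m; rewrite /= ?nestE.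
Qed.

(** In the exceptional case of the definition of epsilon, which concerns the
    coordinates outside the innermost added interval, n_j is replaced by n_j + 1 or
    kept, so that the result plus j is odd on the left of that interval and even on
    its right.  The rule of the definition shifts n_j under a condition on j alone;
    this makes no difference, since n (n + 1) / 2 has the same parity for n and
    n + 1 when n is odd. *)
Definition level D B k j : nat :=
  let n := nstar (Bk D B k) j in
  let J := nest D B k in
  if odd D && (0 < k)%N then
    if (j < J.1)%N then (n + ~~ odd (n + j))%N
    else if (J.2 < j)%N then (n + odd (n + j))%N else n
  else n.

Lemma del_lt i j J : (J.1 <= J.2)%N -> (0 < i)%N ->
  (j < (xi i J).1)%N = (del i j < J.1)%N.
Proof.
case: J => a b /= ab i0; rewrite /xi /del /=.
case: (leqP i a) => ?; case: (leqP b.+2 i) => ? /=; case: (ltngtP j i) => ?; lia.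
Qed.

Lemma del_gt i j J : (J.1 <= J.2)%N -> (0 < i)%N ->
  ((xi i J).2 < j)%N = (J.2 < del i j)%N.
Proof.
case: J => a b /= ab i0; rewrite /xi /del /=.
case: (leqP i a) => ?; case: (leqP b.+2 i) => ? /=; case: (ltngtP j i) => ?; lia.
Qed.

Lemma odd_del i j : (0 < i)%N -> odd (del i j) = odd j (+) (j == i).
Proof. by move=> i0; rewrite /del; case: (ltngtP j i) => ?; lia. Qed.

Lemma level_t_map D i B k j : arcs D B -> (0 < i <= D.+2)%N -> kvalid D B k ->
  level D.+2 (t_map i B) k j = (level D B k (del i j) + (j == i))%N.
Proof.
move=> BD i_le kv; have i0 : (0 < i)%N by lia.
rewrite /level Bk_t_map // nstar_t_map //; cbv zeta.
have -> : odd D.+2 = odd D by rewrite /= negbK.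
case: ifP => // /andP[oD k0].
have kk : (0 < k <= k)%N by lia.
have [_ J12 _ _] := nest_in BD kv kk.
rewrite (nest_t_map BD i_le kv kk) del_lt // del_gt //.
have -> : odd (nstar (Bk D B k) (del i j) + (j == i) + j) =
          odd (nstar (Bk D B k) (del i j) + del i j).
  by rewrite !oddD odd_del // oddb -addbA (addbC (j == i)).
by case: ifP => _; [|case: ifP => _]; rewrite // addnAC.
Qed.

Lemma sum_nat_negb (k : nat) (p : pred nat) :
  (forall m, (0 < m <= k)%N -> ~~ p m) -> (\sum_(1 <= m < k.+1) ~~ p m)%N = k.
Proof.
move=> kp; rewrite (eq_big_nat _ _ (F2 := fun=> 1%N)).
  by rewrite sum_nat_const_nat; lia.
by move=> m mk; rewrite kp //; lia.
Qed.

Lemma nstar_covered0 D B j : arcs D B -> ~~ covered B j -> nstar B j = 0%N.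
Proof.
move=> BD cj; rewrite nstarE big_seq big1 // => J JB.
have [_ _ _ oJ] := arcs_mem BD JB; rewrite /in_star oJ.
by apply/eqP; rewrite eqb0; apply: contra cj => jJ; apply/hasP; exists J.
Qed.

(** The symbol a, encoded as 0, can also be placed after the last point. *)
Lemma nstar_ends D B k j : arcs D B -> kvalid D B k -> ~~ (0 < j <= D)%N ->
  nstar (Bk D B k) j = k.
Proof.
move=> BD kv jD; rewrite nstar_Bk // (nstar_covered0 BD); last first.
  by apply: contra jD => /(covered_out BD).
rewrite sum_nat_negb // => m mk; apply: contra jD.
by have [] := nest_in BD kv mk; rewrite /in_int; lia.
Qed.

Definition tri (n : nat) : bool := odd (n * n.+1)./2.

Lemma triS n : tri n.+1 = tri n (+) ~~ odd n.
Proof.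
rewrite /tri; have -> : (n.+1 * n.+2 = n * n.+1 + n.+1.*2)%N by lia.
by rewrite halfD odd_double andbF doubleK add0n oddD.
Qed.

Lemma tri_odd n : odd n -> tri n.+1 = tri n.
Proof. by move=> on; rewrite triS on addbF. Qed.

Lemma in_union_aE D B k j : arcs D B -> kvalid D B k -> (0 < k)%N -> (0 < j <= D)%N ->
  in_union_a (Bk D B k) j = ~~ in_int j (nest D B k).
Proof.
move=> BD kv k0 jD; rewrite /in_union_a BkE //.
apply/hasP/idP => [[J]|jJ].
  rewrite in_fsetU => /orP[/(arcs_mem BD)[J0 _ _ oJ]|/imfsetP[m]].
    by rewrite /in_star oJ /in_int; case: J J0 {oJ} => a b /=; lia.
  rewrite /= mem_iota => mk ->; have {}mk : (0 < m <= k)%N by lia.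
  have [_ _ _ /negPf oJ] := nest_in BD kv mk; rewrite /in_star oJ => /andP[_].
  apply: contra; rewrite /in_int.
  case: (ltnP m k) => [mk'|km]; last by have -> : m = k by lia.
  by have := @nest_nested _ _ _ BD kv m k; lia.
exists (nest D B k).
  rewrite in_fsetU; apply/orP; right; apply/imfsetP; exists k => //=.
  by rewrite mem_iota; lia.
have kk : (0 < k <= k)%N by lia.
have [J0 _ _ /negPf oJ] := nest_in BD kv kk.
by rewrite /in_star oJ jJ /in_int; lia.
Qed.

Lemma filter_in_int D a b : (0 < a)%N -> (a <= b <= D)%N ->
  [seq j <- iota 1 D | in_int j (a, b)] = iota a (b.+1 - a).
Proof.
move=> a0 abD; apply: (irr_sorted_eq ltn_trans ltnn).
- by apply: sorted_filter (iota_ltn_sorted _ _); apply: ltn_trans.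
- exact: iota_ltn_sorted.
by move=> j; rewrite mem_filter !mem_iota /in_int /=; lia.
Qed.

Lemma coreE D B k : arcs D B -> kvalid D B k -> (0 < k)%N ->
  core_l D (Bk D B k) = (nest D B k).1.-1 /\ core_l' D (Bk D B k) = (nest D B k).2.+1.
Proof.
move=> BD kv k0; have kk : (0 < k <= k)%N by lia.
have [J0 J12 JD _] := nest_in BD kv kk.
rewrite /core_l /core_l' /coreC.
have -> : [seq j <- iota 1 D | ~~ in_union_a (Bk D B k) j] =
          [seq j <- iota 1 D | in_int j ((nest D B k).1, (nest D B k).2)].
  apply: eq_in_filter => j; rewrite mem_iota => jD.
  by rewrite in_union_aE // ?negbK //; lia.
rewrite filter_in_int //; last by rewrite J12.
have -> : ((nest D B k).2.+1 - (nest D B k).1 =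
           ((nest D B k).2 - (nest D B k).1).+1)%N by rewrite subSn.
by rewrite /= last_iota subnKC.
Qed.

Lemma natr_tri n : ((n * n.+1)./2%:R != 0 :> 'F_2) = tri n.
Proof. by rewrite F2_natr F2_neq0. Qed.

Lemma tri_shift a b n j : odd a -> ~~ odd b -> (a <= b)%N ->
  (if ~~ in_int j (a, b) && (odd (if (b < j)%N then b.+1 else a.-1) == odd j)
   then tri n.+1 else tri n) =
  tri (if (j < a)%N then n + ~~ odd (n + j)
       else if (b < j)%N then n + odd (n + j) else n)%N.
Proof.
move=> oa ob ab; rewrite /in_int /=.
have oa1 : odd a.-1 = false by case: a oa {ab} => //= a /negPf.
case: (ltnP j a) => ja /=.
  have -> : (b < j)%N = false by lia.
  rewrite oa1 oddD; case: (odd j) => /=; case: (boolP (odd n)) => on /=;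
    by rewrite ?addn1 ?addn0 // tri_odd.
case: (ltnP b j) => bj //=.
rewrite ob oddD; case: (odd j) => /=; case: (boolP (odd n)) => on /=;
  by rewrite ?addn1 ?addn0 // tri_odd.
Qed.

Lemma eps_coef_level D B k j : arcs D B -> kvalid D B k -> (0 < j <= D)%N ->
  (eps_coef D (Bk D B k) j != 0) = tri (level D B k j).
Proof.
move=> BD kv jD.
pose n := nstar (Bk D B k) j.
have -> : (eps_coef D (Bk D B k) j != 0) =
  if [&& odd D, in_union_a (Bk D B k) j &
         odd (if (core_l' D (Bk D B k) <= j)%N then core_l' D (Bk D B k)
              else core_l D (Bk D B k)) == odd j]
  then tri n.+1 else tri n.
  rewrite /eps_coef -/n; have -> : (j != 0%N) = true by lia.
  by rewrite andTb; case: ifP => _; rewrite natr_tri.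
rewrite /level -/n; cbv zeta.
case: (boolP (odd D)) => [oD|//]; rewrite !andTb.
case: (posnP k) kv => [E kv|k0 kv].
  have -> : in_union_a (Bk D B k) j = false; last by [].
  apply/hasPn => J; rewrite BkE // E in_fsetU => /orP[/(arcs_mem BD)[J0 _ _ oJ]|].
    by rewrite /in_star oJ /in_int; case: J J0 {oJ} => a b /=; lia.
  by case/imfsetP.
have kk : (0 < k <= k)%N by lia.
have [_ J12 _ _] := nest_in BD kv kk.
rewrite in_union_aE //; have [-> ->] := coreE BD kv k0.
have /andP[oJ1 oJ2] := nest_odd_ends BD kv oD k0.
by rewrite -tri_shift //; case: (nest D B k).
Qed.

Lemma tri_level_ends D B k j : arcs D B -> kvalid D B k -> ~~ (0 < j <= D)%N ->
  tri (level D B k j) = tri k.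
Proof.
move=> BD kv jD; rewrite /level nstar_ends //.
case: (boolP (odd D)) => oD //=; case: (posnP k) kv => [//|k0 kv] /=.
have ok : odd k by move: kv; rewrite /kvalid; lia.
by case: ifP => _; [|case: ifP => _]; rewrite //;
   case: (odd _); rewrite /= ?addn1 ?addn0 // tri_odd.
Qed.

(** The vector attached to B(k), read off from the level function; the special
    rule for odd D is what makes this formula uniform in the parity of D. *)
Lemma supp_eps_Bk D B k j : arcs D B -> kvalid D B k -> (j <= D.+1)%N ->
  supp (eps D (Bk D B k)) j = tri (level D B k j) (+) tri k.
Proof.
move=> BD kv jD; case: (boolP (0 < j <= D)%N) => [j_in|j_out]; last first.
  by rewrite tri_level_ends // addbb (contraNF (@supp_out _ _ _) j_out).
rewrite supp_eps // eps_coef_level //; congr (_ (+) _).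
by rewrite /eps_coef /= andbF natr_tri nstar_ends.
Qed.

(** * Lattice paths *)

(** The path of a vector goes up at the odd points where the coordinate does not
    change and at the even points where it changes, and down at the other ones. *)
Definition letter (c : nat -> bool) (x : nat) : bool := c x.-1 (+) c x (+) odd x.

Definition step (b : bool) : int := if b then 1 else -1.

Fixpoint height (c : nat -> bool) (j : nat) : int :=
  if j is j'.+1 then height c j' + step (letter c j'.+1) else 0.

Lemma heightS c j : height c j.+1 = height c j + step (letter c j.+1).
Proof. by []. Qed.

Lemma eq_height c c' N : (forall j, (j <= N)%N -> c j = c' j) ->
  forall j, (j <= N)%N -> height c j = height c' j.
Proof.
move=> cc'; elim=> // j IH jN; rewrite !heightS IH; last exact: ltnW.
by rewrite /letter !cc' //; apply: leq_trans (leq_pred _) jN.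
Qed.

Lemma height_bound c j : - j%:Z <= height c j <= j%:Z.
Proof. by elim: j => // j; rewrite heightS /step; case: letter; lia. Qed.

(** Inserting the points i, i + 1 inserts two opposite steps into the path; the
    bit b is the difference of the new coordinate from its neighbours. *)
Definition insert_pair (i : nat) (b : bool) (c : nat -> bool) (j : nat) : bool :=
  c (del i j) (+) (b && (j == i)).

Lemma height_insert i b c j : (0 < i)%N ->
  height (insert_pair i b c) j =
  height c (del i j) + (if j == i then step (b (+) odd i) else 0).
Proof.
move=> i0; elim: j => [|j IH].
  by rewrite /del i0 /=; have -> : (0 == i)%N = false by lia.
rewrite heightS {}IH /letter /insert_pair /=.
case: (ltngtP j.+1 i) => [ji|ij|ji].
- have [-> ->] : del i j.+1 = j.+1 /\ del i j = j.
    rewrite /del; have -> : (j < i)%N = true by lia.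
    by rewrite ji.
  have -> : (j == i) = false by lia.
  by rewrite !andbF !addbF !addr0.
- case: (eqVneq j i) => [->|/negPf jni].
    have [-> ->] : del i i.+1 = i.-1 /\ del i i = i.-1.
      rewrite /del ltnn eqxx; have -> : (i.+1 < i)%N = false by lia.
      have -> : (i.+1 == i)%N = false by lia.
      by rewrite subn2.
    rewrite andbT andbF addbF -addrA; congr (_ + _).
    by rewrite /step /=; case: b; case: (odd i); case: (c i.-1).
  have [-> ->] : del i j.+1 = (j - 2).+1 /\ del i j = (j - 2)%N.
    rewrite /del jni; have -> : (j < i)%N = false by lia.
    have -> : (j.+1 < i)%N = false by lia.
    have -> : (j.+1 == i)%N = false by lia.
    by split; lia.
  rewrite !andbF !addbF !addr0 heightS /letter /=; congr (_ + step (_ (+) _)).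
  by rewrite oddB /=; [rewrite addbF | lia].
have Ei : i = j.+1 by lia.
have -> : (j == i) = false by lia.
have [-> ->] : del i j.+1 = j /\ del i j = j.
  by rewrite /del -Ei ltnn eqxx Ei ltnSn.
by rewrite andbT andbF addbF addr0 Ei /= addbA addbb.
Qed.

(** Around the threshold K, a pair of opposite steps leading away from the
    threshold and back can be removed; a path has no such pair exactly when it
    never turns back after having moved away. *)
Definition tight (K : int) (N : nat) (c : nat -> bool) : Prop :=
  forall j, (j.+2 <= N)%N -> letter c j.+1 = (K < height c j) ->
    letter c j.+2 = letter c j.+1.

(** A tight path that moves away from the threshold keeps its direction. *)
Lemma tight_end K N c j : tight K N c -> (j < N)%N ->
  letter c j.+1 = (K < height c j) ->
  height c N = height c j + step (letter c j.+1) * (N - j)%:Z.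
Proof.
move=> cK jN lj.
have key m : (j + m < N)%N -> letter c (j + m).+1 = letter c j.+1 /\
    height c (j + m) = height c j + step (letter c j.+1) * m%:Z.
  elim: m => [|m IH] jm; first by rewrite addn0 mulr0 addr0.
  have [lm hm] : letter c (j + m).+1 = letter c j.+1 /\
    height c (j + m) = height c j + step (letter c j.+1) * m%:Z by apply: IH; lia.
  rewrite addnS heightS lm hm; split.
    rewrite -lm; apply: cK; first by lia.
    by rewrite hm lm; move: lj; rewrite /step; case: (letter c j.+1) => /esym; lia.
  by rewrite /step; case: (letter c j.+1); lia.
have N1 : (j + (N - j).-1 < N)%N by lia.
have [lm hm] := key _ N1.
have -> : N = (j + (N - j).-1).+1 by lia.
rewrite heightS lm hm; have -> : ((j + (N - j).-1).+1 - j = (N - j).-1.+1)%N by lia.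
by rewrite /step; case: (letter c j.+1); lia.
Qed.

Lemma height_end_le c j N : (j < N)%N ->
  height c N <= height c j.+1 + (N - j.+1)%:Z /\
  height c j.+1 - (N - j.+1)%:Z <= height c N.
Proof.
move=> jN; have -> : N = (j.+1 + (N - j.+1))%N by lia.
move: (N - j.+1)%N => m; rewrite addKn.
elim: m => [|m IH]; first by rewrite addn0; lia.
by rewrite addnS heightS /step; case: letter; lia.
Qed.

(** At the first place where two such paths separate, one of them moves away
    from the threshold for good, and the other one cannot catch up with it. *)
Lemma tight_unique K N c c' : tight K N c -> tight K N c' ->
  height c N = height c' N -> c 0%N = c' 0%N ->
  forall j, (j <= N)%N -> c j = c' j.
Proof.
move=> cK c'K EN c0.
suff key j : (j <= N)%N -> height c j = height c' j /\ c j = c' j.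
  by move=> j /key[].
elim: j => // j IH jN; have [hj cj] := IH (ltnW jN).
have ll' : letter c j.+1 = letter c' j.+1.
  apply/eqP/contraT => ll'.
  have [|] : letter c j.+1 = (K < height c j) \/ letter c' j.+1 = (K < height c' j).
  - by move: ll'; rewrite hj; case: (letter c _); case: (letter c' _); case: (K < _); auto.
  - move=> /(tight_end cK jN); have := height_end_le c' jN; rewrite heightS -hj -EN.
    by move: ll'; rewrite /step; case: (letter c _); case: (letter c' _) => //; lia.
  move=> /(tight_end c'K jN); have := height_end_le c jN; rewrite heightS -hj EN.
  by move: ll'; rewrite /step; case: (letter c _); case: (letter c' _) => //; lia.
rewrite !heightS hj ll'; split=> //.
by move: ll'; rewrite /letter /= cj; case: (c' j); case: (c _); case: (c' _); case: odd.
Qed.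

(** * The path of B(k) *)

(** Adjacent pairs inserted into the path of B(k) go up and back from the heights
    above this number K, and down and back from the other ones; they never use the
    step between K and K + 1. *)
Definition threshold (k : nat) : int := if odd k then - k.+1%:Z else k%:Z.

(** For B empty, the path goes straight from 0 to the pair of heights K, K + 1,
    then alternates between them until it leaves for its end at this point. *)
Definition base_turn D k : nat := if odd D && (0 < k)%N then (D - k)%N else (D.+1 - k)%N.

Lemma nest_fset0 D k m : kvalid D fset0 k -> (0 < m <= k)%N ->
  nest D fset0 m = (m, (topk D fset0 - m)%N).
Proof.
move=> kv mk; have := nest_idx (arcs0 D) kv mk.
rewrite /nest unmatched0 size_iota => m_idx.
by rewrite !nth_iota; [congr pair; lia | lia | lia].
Qed.

Lemma sum_ltn_const k c : (\sum_(1 <= m < k.+1) (c < m)%N)%N = (k - c)%N.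
Proof.
elim: k => [|k IH]; first by rewrite big_nil.
by rewrite big_nat_recr //= IH; case: ltnP; lia.
Qed.

Lemma level_fset0 D k j : kvalid D fset0 k -> (j <= D.+1)%N ->
  level D fset0 k j = ((k - j) + (j - base_turn D k))%N.
Proof.
move=> kv jD; have BD := arcs0 D.
have topE : topk D fset0 = if odd D then D else D.+1 by rewrite /topk cardfs0 muln0 subn0.
have nE : (j <= topk D fset0)%N ->
    nstar (Bk D fset0 k) j = (k - minn j (topk D fset0 - j))%N.
  move=> jT; rewrite nstar_Bk // (nstar_covered0 BD) // -sum_ltn_const.
  apply: eq_big_nat => m mk; rewrite (nest_fset0 kv); last lia.
  by rewrite /in_int /=; congr nat_of_bool; move: kv; rewrite /kvalid cardfs0; lia.
have kD : (2 * k <= D)%N by move: kv; rewrite /kvalid cardfs0; lia.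
rewrite /level /base_turn; cbv zeta; case: ifP => [/andP[oD k0]|].
  have kk : (0 < k <= k)%N by lia.
  have ok : odd k by move: kv; rewrite /kvalid; lia.
  rewrite (nest_fset0 kv kk) topE oD /=.
  rewrite topE oD in nE; case: (ltnP D j) => [Dj|jD'].
    rewrite (nstar_ends BD kv); last lia.
    have -> : (j < k)%N = false by lia.
    have -> : (D - k < j)%N by lia.
    have -> : odd (k + j) by lia.
    by lia.
  rewrite nE //.
  case: (ltnP j k) => jk.
    have -> : odd (k - minn j (D - j) + j) by lia.
    by lia.
  case: (ltnP (D - k) j) => kj; last by lia.
  have -> : odd (k - minn j (D - j) + j) = false by lia.
  by lia.
case: (boolP (odd D)) => oD /= k0; last by rewrite nE topE (negPf oD) //; lia.
have {k0} -> : k = 0%N by lia.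
rewrite (nstar_Bk BD) ?(nstar_covered0 BD) // ?big_nil //; first lia.
by rewrite /kvalid cardfs0 oD.
Qed.

Lemma base_turnP D k : kvalid D fset0 k ->
  [/\ (k <= base_turn D k <= D.+1)%N,
      odd (base_turn D k) = ~~ odd D && ~~ odd k &
      threshold k + (odd (base_turn D k))%:Z +
        step (odd (base_turn D k)) * (D.+1 - base_turn D k)%:Z =
      2 * threshold k + (~~ odd D)%:Z].
Proof.
move=> kv; set t := base_turn D k.
have [turn_le turn_odd tE] : [/\ (k <= t <= D.+1)%N, odd t = ~~ odd D && ~~ odd k &
    t = if odd D && odd k then (D - k)%N else (D.+1 - k)%N].
  rewrite /t /base_turn; move: kv; rewrite /kvalid cardfs0.
  by case: (posnP k) => k0; case: (boolP (odd D)) => oD /=;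
    case: (boolP (odd k)) => ok /= kv; split; lia.
split=> //; rewrite turn_odd /step /threshold; move: kv turn_le tE.
rewrite /kvalid cardfs0; case: (boolP (odd D)) => oD /=; last by case: (odd k) => /=; lia.
by case: (boolP (odd k)) => ok /=; lia.
Qed.

Lemma letter_base D k j (c := supp (eps D (Bk D fset0 k))) :
  kvalid D fset0 k -> (j <= D)%N ->
  letter c j.+1 = if (j < k)%N then ~~ odd k
                  else if (j < base_turn D k)%N then ~~ odd j
                  else odd (base_turn D k).
Proof.
move=> kv jD; have [turn_le turn_odd _] := base_turnP kv.
rewrite /letter /c !supp_eps_Bk ?level_fset0 //=; try exact: arcs0; try lia.
set t := base_turn D k in turn_le turn_odd *.
rewrite addbACA addbb addbF.
case: (ltnP j k) => jk.
  have -> : ((k - j) + (j - t) = (k - j.+1).+1)%N by lia.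
  have -> : ((k - j.+1) + (j.+1 - t) = (k - j.+1))%N by lia.
  rewrite triS oddB //=.
  by case: (tri _); case: (odd k); case: (odd j).
case: (ltnP j t) => jt.
  have -> : ((k - j) + (j - t) = 0)%N by lia.
  by have -> : ((k - j.+1) + (j.+1 - t) = 0)%N by lia.
have -> : ((k - j) + (j - t) = (j - t))%N by lia.
have -> : ((k - j.+1) + (j.+1 - t) = (j - t).+1)%N by lia.
rewrite triS oddB //=.
by case: (tri _); case: (odd j); case: (odd t).
Qed.

Lemma height_base D k j (c := supp (eps D (Bk D fset0 k))) :
  kvalid D fset0 k -> (j <= D.+1)%N ->
  height c j = if (j <= k)%N then step (~~ odd k) * j%:Z
               else if (j <= base_turn D k)%N then threshold k + (odd j)%:Z
               else threshold k + (odd (base_turn D k))%:Z +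
                    step (odd (base_turn D k)) * (j - base_turn D k)%:Z.
Proof.
move=> kv; have [turn_le turn_odd _] := base_turnP kv.
elim: j => [|j IH] jD; first by rewrite mulr0.
rewrite heightS IH; last exact: ltnW.
rewrite letter_base //; move: turn_le turn_odd; rewrite /threshold /step.
set t := base_turn D k => turn_le turn_odd.
case: (ltnP j k) => jk; first by rewrite (ltnW jk); case: (odd k) => /=; lia.
case: (ltnP j t) => jt.
  case: (ltnP k j) => kj; last have -> : j = k by lia.
    by rewrite (ltnW jt); case: (odd k); case: (boolP (odd j)) => oj /=; lia.
  by case: (boolP (odd k)) => ok /=; lia.
case: (ltnP t j) => tj; last have -> : j = t by lia.
  have -> : (j <= k)%N = false by lia.
  by case: (odd k); case: (odd t) => /=; lia.
case: (ltnP k t) => kt; first by case: (odd k); case: (odd t) => /=; lia.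
have -> : t = k by lia.
have : odd t = odd k by congr odd; lia.
by case: (odd k); case: (odd t) => //=; lia.
Qed.

(** The coordinate inserted with a pair counts one interval more than its two
    neighbours. *)
Lemma supp_eps_t_map D i B k j : arcs D B -> (0 < i <= D.+2)%N -> kvalid D B k ->
  (j <= D.+3)%N ->
  supp (eps D.+2 (Bk D.+2 (t_map i B) k)) j =
  insert_pair i (~~ odd (level D B k i.-1)) (supp (eps D (Bk D B k))) j.
Proof.
move=> BD i_le kv jD; rewrite supp_eps_Bk ?kvalid_t_map //; last exact: arcsS.
have i0 : (0 < i)%N by lia.
rewrite /insert_pair supp_eps_Bk //; last by rewrite /del; case: (ltngtP j i) => ?; lia.
rewrite level_t_map //; case: eqVneq => [->|_]; last by rewrite addn0 andbF addbF.
by rewrite /del ltnn eqxx addn1 triS andbT addbAC.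
Qed.

(** At an inserted coordinate, level plus position has the same parity as at its
    place before the insertion; this parity tells in which direction the two new
    steps point, namely away from the threshold. *)
Lemma path_Bk D B k (c := supp (eps D (Bk D B k))) : arcs D B -> kvalid D B k ->
  (forall j, (j <= D.+1)%N -> odd (level D B k j + j) = (threshold k < height c j)) /\
  height c D.+1 = 2 * threshold k + (~~ odd D)%:Z.
Proof.
rewrite {}/c => BD; elim: BD => {D B} [D kv|D i B i_le BD IH].
  have [turn_le turn_odd <-] := base_turnP kv.
  split=> [j jD|]; last first.
    rewrite height_base //; move: turn_le turn_odd; rewrite /threshold /step.
    set t := base_turn D k => turn_le turn_odd.
    case: (ltnP k D.+1) => kD; last by move: kv; rewrite /kvalid cardfs0; lia.
    case: (ltnP t D.+1) => tD; first by lia.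
    by have -> : t = D.+1; lia.
  rewrite level_fset0 // height_base //; move: turn_le turn_odd.
  have kv1 : odd D -> (0 < k)%N -> odd k by move: kv; rewrite /kvalid; lia.
  rewrite /threshold /step; set t := base_turn D k => turn_le turn_odd.
  case: (leqP j k) => jk.
    have -> : odd (k - j + (j - t) + j) = odd k by lia.
    by case: (odd k) => /=; lia.
  case: (leqP j t) => jt.
    have -> : odd (k - j + (j - t) + j) = odd j by lia.
    by case: (odd k); case: (odd j) => /=; lia.
  have -> : odd (k - j + (j - t) + j) = odd t by lia.
  by case: (odd k); case: (odd t) => /=; lia.
rewrite kvalid_t_map => kv; have [inv hN] := IH kv; have i0 : (0 < i)%N by lia.
set b := ~~ odd (level D B k i.-1).
have hE j : (j <= D.+3)%N -> height (supp (eps D.+2 (Bk D.+2 (t_map i B) k))) j =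
    height (supp (eps D (Bk D B k))) (del i j) + (if j == i then step (b (+) odd i) else 0).
  move=> jD; rewrite -height_insert //; apply: (@eq_height _ _ D.+3) => // l lD.
  exact: supp_eps_t_map.
have delii : del i i = i.-1 by rewrite /del ltnn eqxx.
split=> [j jD|]; last first.
  rewrite hE //; have -> : (D.+3 == i) = false by lia.
  have -> : del i D.+3 = D.+1 by rewrite /del; case: (ltngtP D.+3 i) => ?; lia.
  by rewrite addr0 hN /= negbK.
rewrite hE // level_t_map //.
case: (eqVneq j i) => [->|/negPf ji].
  have := inv i.-1; rewrite delii /b.
  have -> : odd (level D B k i.-1 + 1 + i) = odd (level D B k i.-1 + i.-1) by lia.
  have -> : ~~ odd (level D B k i.-1) (+) odd i = odd (level D B k i.-1 + i.-1) by lia.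
  move=> -> //; last by lia.
  by rewrite /step; case: (boolP (threshold k < _)); lia.
rewrite addr0 addn0 -inv; last by rewrite /del; case: (ltngtP j i) => ?; lia.
by rewrite !oddD odd_del // ji addbF.
Qed.

Definition unpair_at i (c : nat -> bool) (j : nat) : bool :=
  if (j < i)%N then c j else c j.+2.

Lemma unpairK i c j : (0 < i)%N -> c i.-1 = c i.+1 ->
  insert_pair i (c i (+) c i.-1) (unpair_at i c) j = c j.
Proof.
move=> i0 ci; rewrite /insert_pair /unpair_at /del.
case: (ltngtP j i) => [ji|ij|->].
- by rewrite ji andbF addbF.
- rewrite andbF addbF; case: (ltnP (j - 2) i) => ji; last by congr c; lia.
  have -> : (j - 2 = i.-1)%N by lia.
  by rewrite ci; congr c; lia.
have -> : (i.-1 < i)%N by lia.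
by rewrite andbT addbC addbK.
Qed.

Lemma leq_del i l n : (i <= n.+1)%N -> (l <= n.+2)%N -> (del i l <= n)%N.
Proof. by rewrite /del; case: (ltngtP l i) => ? ? ?; lia. Qed.

Lemma unpair_vector D (v : V D.+2) i : (0 < i <= D.+2)%N ->
  supp v i.-1 = supp v i.+1 ->
  exists2 v' : V D, forall l, (l <= D.+1)%N -> supp v' l = unpair_at i (supp v) l &
    forall l, (l <= D.+3)%N ->
      supp v l = insert_pair i (supp v i (+) supp v i.-1) (supp v') l.
Proof.
move=> /andP[i0 iD] ci.
have vN : supp v D.+3 = false.
  by case E: (supp v D.+3) => //; move/supp_out: E; rewrite ltnn andbF.
have v'E l : (l <= D.+1)%N ->
    supp (\row_(m < D) (unpair_at i (supp v) m.+1)%:R : V D) l = unpair_at i (supp v) l.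
  move=> lD; rewrite supp_row /unpair_at.
  case: (posnP l) => [->|l0] /=.
    by rewrite i0; case E: (supp v 0) => //; move/supp_out: E.
  case: (leqP l D) => // Dl; have {Dl lD l0} -> : l = D.+1 by apply/eqP; rewrite eqn_leq lD.
  case: ltnP => Di /=; last by rewrite vN.
  have Ei : i = D.+2 by apply/eqP; rewrite eqn_leq iD.
  by move: ci; rewrite Ei /= vN.
exists (\row_(m < D) (unpair_at i (supp v) m.+1)%:R) => // l lD.
by rewrite -(unpairK l i0 ci) /insert_pair v'E // leq_del.
Qed.

Lemma tight_dec K N c : tight K N c \/ exists2 j, (j.+2 <= N)%N &
  letter c j.+1 = (K < height c j) /\ letter c j.+2 != letter c j.+1.
Proof.
case: (boolP [forall j : 'I_N, (j.+2 <= N)%N ==>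
  (letter c j.+1 == (K < height c j)) ==> (letter c j.+2 == letter c j.+1)]).
  move=> /forallP cK; left=> j jN lj; have jN' : (j < N)%N by lia.
  by have := cK (Ordinal jN'); rewrite /= jN lj eqxx /= => /eqP.
rewrite negb_forall => /existsP[j]; rewrite !negb_imply => /and3P[jN /eqP lj ll].
by right; exists (val j).
Qed.

(** Every vector is obtained: removing adjacent pairs leads to a path without
    removable pairs, and such a path is determined by its end, so that it is the
    path of B(k) for the empty B.  For odd D and k = 0, both vectors of V_1 give
    paths with the right end; the last coordinate tells them apart. *)
Lemma Bk_surj D (v : V D) k : (odd D -> (k == 0%N) || odd k) ->
  height (supp v) D.+1 = 2 * threshold k + (~~ odd D)%:Z ->
  (odd D -> k = 0%N -> ~~ supp v D) ->
  exists B, [/\ arcs D B, kvalid D B k & eps D (Bk D B k) = v].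
Proof.
move=> ok; elim/ltn_ind: D v ok => D IH v ok hv last_v.
have v0 : supp v 0 = false by case E: (supp v 0) => //; move/supp_out: E.
have vN : supp v D.+1 = false.
  by case E: (supp v D.+1) => //; move/supp_out: E; rewrite ltnn andbF.
case: (tight_dec (threshold k) D.+1 (supp v)) => [v_tight|[j jD [lj ljj]]].
  have kv : kvalid D fset0 k.
    have := height_bound (supp v) D.+1; rewrite /kvalid cardfs0 hv /threshold.
    move: ok; case: (boolP (odd D)) => oD /= ok; case: (boolP (odd k)) => ok' /=; last first.
    - by lia.
    - by lia.
    - by have := ok isT; lia.
    by lia.
  have [_ hN] := path_Bk (arcs0 D) kv.
  exists fset0; split=> //; first exact: arcs0.
  (* The base path has no removable pairs, and its end is the one of v. *)
  have base_tight : tight (threshold k) D.+1 (supp (eps D (Bk D fset0 k))).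
    move=> l lD; rewrite !letter_base //; try lia.
    have [inv _] := path_Bk (arcs0 D) kv.
    rewrite -inv ?level_fset0 //; try lia.
    have [turn_le turn_odd _] := base_turnP kv.
    set t := base_turn D k in turn_le turn_odd *.
    case: (ltnP l k) => lk.
      have -> : odd (k - l + (l - t) + l) = odd k by lia.
      by case: (odd k).
    case: (ltnP l t) => lt.
      have -> : odd (k - l + (l - t) + l) = odd l by lia.
      by case: (odd l).
    have -> : (l.+1 < k)%N = false by lia.
    by have -> : (l.+1 < t)%N = false by lia.
  have E0 : supp (eps D (Bk D fset0 k)) 0 = supp v 0.
    by rewrite v0; case E: (supp _ 0) => //; move/supp_out: E.
  apply/suppP => j /andP[_ jD].
  by apply: (tight_unique base_tight v_tight _ E0); [rewrite hN | apply: ltnW].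
have ci : supp v j = supp v j.+2.
  move: ljj; clear; rewrite /letter /=.
  by case: (supp v j); case: (supp v j.+1); case: (supp v j.+2); case: (odd j).
case: D => [|[|D]] in v IH ok hv last_v v0 vN jD lj ljj ci *.
- by [].
- have j0 : j = 0%N by move: jD; clear; lia.
  move: lj hv; rewrite j0 /= /letter /= v0 => lj hv.
  have k0 : k = 0%N.
    move: hv (ok isT); rewrite /threshold vN; clear.
    by rewrite /step; case: (supp v 1); case: (boolP (odd k)) => /=; lia.
  move: lj (last_v isT k0); rewrite k0 /threshold /= ltxx.
  by case: (supp v 1).
clear ljj.
have i0 : (0 < j.+1)%N by [].
have [v' v'E vE] := unpair_vector (i := j.+1) jD ci.
set b := _ (+) _ in vE.
have hE l : (l <= D.+3)%N -> height (supp v) l = height (supp v') (del j.+1 l) +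
      (if l == j.+1 then step (b (+) odd j.+1) else 0).
  by move=> lD; rewrite -height_insert //; apply: (eq_height vE).
have hv' : height (supp v') D.+1 = 2 * threshold k + (~~ odd D)%:Z.
  move: hv; rewrite hE // negbK => <-.
  have -> : (D.+3 == j.+1) = false by rewrite gtn_eqF.
  by rewrite addr0 /del ltnNge (ltnW jD) gtn_eqF //= subn2.
have ok' : odd D -> (k == 0%N) || odd k by move=> oD; apply: ok; rewrite /= negbK.
have last_v' : odd D -> k = 0%N -> ~~ supp v' D.
  move=> oD k0; have {}last_v : ~~ supp v D.+2 by apply: last_v => //=; rewrite negbK.
  rewrite v'E // /unpair_at; case: ltnP => // Dj.
  have [Ej|Ej] : j = D \/ j = D.+1 by move: jD Dj; clear; lia.
    by move: ci last_v; rewrite Ej => ->.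
  have cD : supp v D.+1 = false by move: ci; rewrite Ej vN.
  have hN : height (supp v) D.+3 = height (supp v) D.+1.
    by rewrite heightS (heightS _ D.+1) /letter /= cD vN (negPf last_v) oD /= addrK.
  move: lj hv; rewrite hN Ej k0 /letter [D.+2.-1]/= cD (negPf last_v) /= negbK oD /=.
  by clear; rewrite /threshold /= => h1 h2; move: h1; rewrite h2.
have [B [BD kv EB]] := IH D (ltnW (ltnSn _)) v' ok' hv' last_v'.
exists (t_map j.+1 B); split; [exact: arcsS | by rewrite kvalid_t_map |].
apply/suppP => l /andP[_ lD]; rewrite supp_eps_t_map //; last exact: leqW.
rewrite EB vE; last exact: leqW.
congr (insert_pair _ _ _ l); have [inv _] := path_Bk BD kv.
have := inv j; rewrite EB.
have -> : height (supp v') j = height (supp v) j.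
  rewrite hE; last exact: ltnW (ltnW jD).
  by rewrite ltn_eqF // addr0 /del ltnSn.
rewrite -lj /letter /b /= => /(_ jD).
by rewrite oddD; case: (odd (level _ _ _ _)); case: (odd j); case: (supp v j); case: (supp v j.+1).
Qed.

(** * The function u *)

Definition changes (c : nat -> bool) (x : nat) : bool := c x.-1 (+) c x.

(** Without changes of coordinates the path alternates between 0 and 1; a change
    at x moves the rest of the path by 2, up or down according to the parity of x. *)
Lemma heightE c j :
  height c j = (odd j)%:Z + 2 * (\sum_(x <- iota 1 j | changes c x) (-1) ^+ x).
Proof.
elim: j => [|j IH]; first by rewrite big_nil mulr0.
have -> : iota 1 j.+1 = iota 1 j ++ [:: j.+1] by rewrite -(addn1 j) iotaD [in RHS]addnC.
rewrite heightS IH big_cat big_cons big_nil /= /letter -/(changes c j.+1).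
rewrite -[(-1) ^+ j.+1]signr_odd /=.
move: (\sum_(x <- _ | _) _ : int) => s.
case: (changes c j.+1); case: (odd j); rewrite /step /= ?expr0 ?expr1; lia.
Qed.

(** Each maximal interval [a,b] of the support gives changes at a and b + 1.  Their
    contributions to the height cancel unless a and b have different parities, when
    they add up to 4 (-1)^a. *)
Lemma ufunE D (v : V D) : 4 * ufun v + (~~ odd D)%:Z = height (supp v) D.+1.
Proof.
have v0 : ~~ supp v 0 by apply/negP => /(@supp_out D).
have vN : ~~ supp v D.+1 by apply/negP => /(@supp_out D); rewrite ltnn andbF.
rewrite heightE addrC; congr (_ + _).
suff <- : 2 * ufun v = \sum_(x <- iota 1 D.+1 | changes (supp v) x) (-1) ^+ x.
  by rewrite mulrA.
rewrite /ufun; have [-> sz] := runsE v0 vN.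
set S := [seq j <- _ | _ && ~~ _] in sz *; set T := [seq j <- _ | ~~ _ && _] in sz *.
have key (s t : seq nat) : size s = size t -> all (ltn 0) t ->
  2 * (\sum_(J <- zip s (map predn t) | odd J.1 != odd J.2) (-1) ^+ J.1) =
    \sum_(x <- s) (-1) ^+ x + \sum_(x <- t) (-1) ^+ x :> int.
  elim: s t => [|x s IH] [|[|y] t] //=; first by rewrite !big_nil mulr0.
  move=> [/IH {}IH] /IH {}IH.
  rewrite !big_cons /= -[(-1) ^+ x]signr_odd -[(-1) ^+ y.+1]signr_odd /=.
  case: ifP; rewrite ?mulrDr IH; case: (odd x); case: (odd y) => //= _;
    rewrite ?expr0 ?expr1; lia.
rewrite key //; last by apply/allP => x; rewrite mem_filter mem_iota => /andP[_ /andP[]].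
rewrite /S /T !big_filter [LHS]addrC.
rewrite [RHS](bigID (supp v)) /= [RHS]addrC.
by congr (_ + _); apply: eq_bigl => x; rewrite /changes;
  case: (supp v x); case: (supp v x.-1).
Qed.

Lemma ufun_Bk D B k : arcs D B -> kvalid D B k ->
  2 * ufun (eps D (Bk D B k)) = threshold k.
Proof.
by move=> BD kv; have [_] := path_Bk BD kv; rewrite -ufunE; case: (odd D) => /=; lia.
Qed.

Lemma threshold_inj : injective threshold.
Proof.
by move=> k l; rewrite /threshold; case: (boolP (odd k)); case: (boolP (odd l)); lia.
Qed.

Lemma utilde_even_inj D (v w : V D) : ~~ odd D -> utilde v = utilde w -> ufun v = ufun w.
Proof.
move=> /negPf oD; rewrite /utilde oD.
by case: ifP => hv; case: ifP => hw; lia.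
Qed.

(** Nonnegative even integers come from even k, negative ones from odd k. *)
Lemma threshold_even (u : int) : {k | threshold k = 2 * u}.
Proof.
case: u => u; first by exists (u.*2)%N; rewrite /threshold odd_double; lia.
by exists (u.*2.+1)%N; rewrite /threshold /= odd_double /=; lia.
Qed.

Lemma Bk_surj_even D (v : V D) : ~~ odd D ->
  exists B k, [/\ arcs D B, kvalid D B k & eps D (Bk D B k) = v].
Proof.
move=> oD; have [k kE] := threshold_even (ufun v).
have [||| B [BD kv EB]] := @Bk_surj D v k; last by exists B, k.
- by rewrite (negPf oD).
- by rewrite -ufunE kE; lia.
by rewrite (negPf oD).
Qed.

(** For odd D the path of B(k) ends at the height 2K <= K.  So a pair of points
    inserted at the end goes down and back, which gives its coordinate D the value
    1. *)
Lemma supp_last_Bk D B k : odd D -> arcs D B -> kvalid D B k ->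
  supp (eps D (Bk D B k)) D = covered B D.
Proof.
move=> oD BD; elim: BD oD => {D B} [D oD kv|D i B i_le BD IH].
  rewrite supp_eps_Bk ?level_fset0 //; try exact: arcs0.
  have -> : covered fset0 D = false by [].
  apply/eqP; rewrite eqbF_neg negb_add; apply/eqP; congr tri.
  by move: kv; rewrite /kvalid cardfs0 /base_turn oD /=; case: (posnP k) => ? /=; lia.
rewrite /= negbK kvalid_t_map => oD kv; rewrite supp_eps_t_map // /insert_pair.
rewrite covered_t_map; last by case/andP: i_le.
case: (eqVneq D.+2 i) => [<-|iD] /=; last first.
  rewrite andbF addbF /del.
  have -> : (D.+2 < i)%N = false by lia.
  by rewrite (negPf iD) subn2 IH.
rewrite andbT /del ltnn eqxx /=.
have [inv hN] := path_Bk BD kv.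
have -> : supp (eps D (Bk D B k)) D.+1 = false.
  by apply: contraNF (@supp_out _ _ _) _; rewrite ltnn andbF.
have := inv D.+1 (leqnn _); rewrite hN oD oddD /= oD addbF => ->.
move: kv; rewrite /kvalid oD /= /threshold.
by case: (boolP (odd k)) => /=; lia.
Qed.

(** * Recovering B from the subspace E_B *)

Lemma span_ind D (s : seq (V D)) (P : V D -> Prop) :
  P 0 -> (forall v w, P v -> P w -> P (v + w)) -> (forall v, v \in s -> P v) ->
  forall v, v \in <<s>>%VS -> P v.
Proof.
move=> P0 PD Ps v vs; rewrite (@coord_span _ _ _ (in_tuple s) v vs); apply: big_ind => // i _.
rewrite [coord _ _ _]F2_bool; case: (_ != 0); rewrite ?scale1r ?scale0r //.
by apply/Ps/mem_nth.
Qed.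

Lemma in_span_set D (s : seq (V D)) v : (v \in span_set s) = (v \in <<s>>%VS).
Proof. by rewrite inE. Qed.

Lemma eint_EB D B J : J \in B -> eint D J \in EB D B.
Proof. by move=> JB; rewrite in_span_set memv_span // map_f. Qed.

(** Over the field with two elements, sums of generators are enough. *)
Lemma EB_ind D B (P : V D -> Prop) :
  P 0 -> (forall v w, P v -> P w -> P (v + w)) -> (forall J, J \in B -> P (eint D J)) ->
  forall v, v \in EB D B -> P v.
Proof.
move=> P0 PD PB v; rewrite in_span_set; apply: span_ind => // w /mapP[J JB ->].
exact: PB.
Qed.

Lemma EB0 D B : 0 \in EB D B.
Proof. by rewrite in_span_set mem0v. Qed.

Lemma EB_addr D B v w : v \in EB D B -> w \in EB D B -> v + w \in EB D B.
Proof. by rewrite !in_span_set => vB wB; rewrite memvD. Qed.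

Lemma ebas_decomp D (v : V D) : v = \sum_(l < D | supp v l.+1) ebas D l.+1.
Proof.
apply/suppP => -[//|j] /= jD; rewrite supp_sum.
rewrite (eq_bigr (fun l : 'I_D => l == Ordinal jD)); last first.
  by move=> l _; rewrite supp_ebas /= jD eqSS eq_sym.
rewrite big_mkcond (bigD1 (Ordinal jD)) //= eqxx big1 ?addbF; first by case: supp.
by move=> l /negPf->; rewrite if_same.
Qed.

Lemma VdeltaP D d (v : V D) :
  reflect (forall j, supp v j -> odd j = d) (v \in Vdelta D d).
Proof.
apply: (iffP idP) => [|vd].
  rewrite in_span_set; apply: (span_ind (P := fun w => forall j, supp w j -> odd j = d)).
  - by move=> j; rewrite supp0.
  - by move=> u w ud wd j; rewrite suppD; case E: (supp u j) => /=; [move/ud: E|move/wd].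
  move=> w /mapP[i]; rewrite mem_filter => /andP[/eqP<- _] -> j.
  by rewrite supp_ebas => /andP[_ /eqP->].
rewrite in_span_set.
rewrite [v]ebas_decomp; apply: memv_suml => l vl; apply/memv_span/map_f.
by rewrite mem_filter mem_iota (vd _ vl) eqxx /= add1n ltnS ltn_ord.
Qed.

Lemma changesD D (v w : V D) x :
  changes (supp (v + w)) x = changes (supp v) x (+) changes (supp w) x.
Proof. by rewrite /changes !suppD addbACA. Qed.

Definition ends (J : intv) (x : nat) : bool := (x == J.1) || (x == J.2.+1).

Definition proper_int D (J : intv) : bool := [&& 0 < J.1, J.1 <= J.2 & J.2 <= D]%N.

Lemma changes_eint D J x : proper_int D J -> (0 < x <= D.+1)%N ->
  changes (supp (eint D J)) x = ends J x.
Proof.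
case: J => a b; case: x => // x /and3P[/= a0 ab bD] /= xD.
rewrite /changes !supp_eint /in_int /ends /=.
apply/idP/idP; lia.
Qed.

Lemma arcs_proper D B J : arcs D B -> J \in B -> proper_int D J.
Proof. by move=> BD /(arcs_mem BD)[*]; apply/and3P. Qed.

Lemma ends_xi i J x : (J.1 <= J.2)%N -> ends (xi i J) x -> 
  exists2 y, x = bump2 i y & ends J y.
Proof.
case: J => a b /= ab; rewrite /ends /= => /orP[|] /eqP->.
  exists a; rewrite ?eqxx // /xi /bump2 /=.
  by case: (leqP i a) => ?; case: (leqP b.+2 i) => ? //=.
exists b.+1; rewrite ?eqxx ?orbT // /xi /bump2 /=.
by case: (leqP i a) => ?; case: (leqP b.+2 i) => ? //=; lia.
Qed.

Lemma bump2_inj i : injective (bump2 i).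
Proof.
by move=> x y; rewrite /bump2; case: (ltnP x i) => ?; case: (ltnP y i) => ?; lia.
Qed.

Lemma ends_bump2 i y : ends (i, i) (bump2 i y) = false.
Proof. by rewrite /ends /bump2 /=; case: (ltnP y i) => ?; lia. Qed.

Lemma ends_disjoint D B I J x : arcs D B -> I \in B -> J \in B ->
  ends I x -> ends J x -> I = J.
Proof.
move=> BD; elim: BD I J x => [D'|D' i B' i_le BD' IH] I J x; first by rewrite inE.
have le12 L : L \in enum_fset B' -> (L.1 <= L.2)%N by case/(arcs_mem BD').
rewrite !mem_t_map => /orP[/eqP->|/mapP[I' IB ->]] /orP[/eqP->|/mapP[J' JB ->]] //.
- by move=> ix /(ends_xi (le12 _ JB))[y xE _]; rewrite xE ends_bump2 in ix.
- by move=> /(ends_xi (le12 _ IB))[y xE _] ix; rewrite xE ends_bump2 in ix.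
move=> /(ends_xi (le12 _ IB))[y -> yI] /(ends_xi (le12 _ JB))[z /bump2_inj<- yJ].
by rewrite (IH I' J' y).
Qed.

Lemma unmatched_ends D B J x : arcs D B -> J \in B -> x \in unmatched D B -> ~~ ends J x.
Proof.
move=> BD JB; rewrite mem_filter => /andP[/andP[cx cx1] _].
have [J0 J12 _ _] := arcs_mem BD JB.
apply/negP => /orP[/eqP xE|/eqP xE].
  by case/hasP: cx; exists J => //; rewrite xE /in_int leqnn.
by case/hasP: cx1; exists J => //; rewrite xE /in_int leqnn andbT.
Qed.

Lemma matched_ends D B x : arcs D B -> (0 < x <= D.+1)%N -> x \notin unmatched D B ->
  exists2 J, J \in B & ends J x.
Proof.
move=> BD; elim: BD x => [D'|D' i B' i_le BD' IH] x xD.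
  by rewrite unmatched0 mem_iota; lia.
rewrite unmatched_t_map //.
case: (boolP (ends (i, i) x)) => [xi _|]; first by exists (i, i); rewrite ?mem_t_map ?eqxx.
rewrite /ends negb_or /= => /andP[x_i x_i1].
pose y := if (x < i)%N then x else (x - 2)%N.
have xE : x = bump2 i y by rewrite /y /bump2; case: (ltnP x i) => ?; case: ltnP => ?; lia.
rewrite {1}xE (mem_map (@bump2_inj i)) => yU.
have [|J JB yJ] := IH y _ yU; first by rewrite /y; case: (ltnP x i) => ?; lia.
exists (xi i J); first by rewrite mem_t_map map_f ?orbT.
have [_ J12 _ _] := arcs_mem BD' JB.
move: yJ; rewrite xE /ends /bump2 /xi; case: J J12 {JB} => a b /= ab.
by case: (ltnP y i) => ?; case: (leqP i a) => ?; case: (leqP b.+2 i) => ? /=; lia.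
Qed.

(** Vectors correspond to even sets of points, and E_B consists of the unions
    of matched pairs. *)
Lemma EB_changes D B v : arcs D B -> v \in EB D B ->
  (forall x, x \in unmatched D B -> ~~ changes (supp v) x) /\
  (forall J x, J \in B -> ends J x -> changes (supp v) x = changes (supp v) J.1).
Proof.
move=> BD; move: v; apply: EB_ind.
- by split=> *; rewrite /changes !supp0.
- move=> v w [v1 v2] [w1 w2]; split=> [x xU|J x JB Jx]; rewrite !changesD.
    by rewrite (negPf (v1 _ xU)) (negPf (w1 _ xU)).
  by rewrite (v2 J) // (w2 J).
move=> I IB; have IP := arcs_proper BD IB; split=> [x xU|J x JB Jx].
  rewrite changes_eint //; first exact: (unmatched_ends BD).
  by move: xU; rewrite mem_filter mem_iota add1n => /andP[_].
have JP := arcs_proper BD JB.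
rewrite !changes_eint //; last first.
- by move: Jx JP; rewrite /ends /proper_int; case: J {JB} => a b /=; lia.
- by move: JP; rewrite /proper_int; case: J {JB Jx} => a b /=; lia.
case: (eqVneq I J) => [->|IJ].
  by rewrite Jx /ends eqxx.
have J1 : ends J J.1 by rewrite /ends eqxx.
apply/idP/idP => [/(ends_disjoint BD IB JB)/(_ Jx)|/(ends_disjoint BD IB JB)/(_ J1)] E;
  by rewrite E eqxx in IJ.
Qed.

(** An endpoint of I is matched by some J in B, as unmatched points are not
    endpoints of unions of pairs; both ends of J are then ends of I. *)
Lemma EB_eint D B I : arcs D B -> proper_int D I -> eint D I \in EB D B -> I \in B.
Proof.
move=> BD IP /(EB_changes BD)[hU hB]; have /and3P[I0 I12 ID] := IP.
have I1 : ends I I.1 by rewrite /ends eqxx.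
have I1D : (0 < I.1 <= D.+1)%N by rewrite I0 (leq_trans I12) // ltnW.
have [|J JB J1] := matched_ends BD I1D.
  by apply/negP => /hU; rewrite changes_eint // I1.
have JP := arcs_proper BD JB; have /and3P[J0 J12 JD] := JP.
have EJ : ends I J.1.
  by rewrite -(changes_eint IP) -?(hB J I.1) ?changes_eint // J0 (leq_trans J12) // ltnW.
have EJ2 : ends I J.2.+1.
  have J2 : ends J J.2.+1 by rewrite /ends eqxx orbT.
  rewrite -(changes_eint IP) ?(hB J J.2.+1) ?changes_eint //.
  by rewrite J0 (leq_trans J12) // ltnW.
suff -> : I = J by [].
move: J1 EJ EJ2 I12 J12; rewrite /ends; case: I J {JB JP J0 JD IP I0 ID I1 I1D hU hB} => a b [c d] /=.
by move=> *; congr pair; lia.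
Qed.

(** The linear map dual to the removal of i, i + 1, with 0 as coordinate i.  As
    [del] keeps the parity of all other coordinates, it respects the decomposition
    into even and odd parts. *)
Definition stretch D i (v : V D) : V D.+2 :=
  \row_l ((l.+1 != i) && supp v (del i l.+1))%:R.

Lemma supp_stretch D i (v : V D) j : (0 < i <= D.+2)%N ->
  supp (stretch i v) j = (j != i) && supp v (del i j).
Proof.
move=> i_le; rewrite (supp_row _ (fun l => (l != i) && supp v (del i l))).
case: (boolP (0 < j <= D.+2)%N) => //= jD; symmetry; apply/negbTE.
rewrite negb_and negbK; case: (eqVneq j i) => //= ji.
rewrite (contraNF (@supp_out _ _ _)) //.
by move: jD; rewrite /del; case: (ltngtP j i) => ?; lia.
Qed.

Lemma stretchD D i (v w : V D) : (0 < i <= D.+2)%N ->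
  stretch i (v + w) = stretch i v + stretch i w.
Proof.
move=> i_le; apply/suppP => j _; rewrite suppD !supp_stretch // suppD.
by case: (j != i).
Qed.

Lemma eint_xi D i J : (0 < i <= D.+2)%N -> proper_int D J ->
  eint D.+2 (xi i J) =
  stretch i (eint D J) + (if in_int i (xi i J) then ebas D.+2 i else 0).
Proof.
move=> i_le JP; apply/suppP => j jD; rewrite suppD supp_stretch //.
have -> : supp (if in_int i (xi i J) then ebas D.+2 i else 0) j =
          in_int i (xi i J) && (j == i).
  by case: ifP => _; rewrite ?supp0 // supp_ebas jD.
rewrite !supp_eint jD /=; case: (eqVneq j i) => [->|ji] /=; first by rewrite andbT.
have i0 : (0 < i)%N by case/andP: i_le.
rewrite andbF addbF in_int_xi //; symmetry; apply: andb_idl => jJ.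
by move: jJ JP; rewrite /in_int /proper_int; case: J => a b /=; lia.
Qed.

Lemma ebas_eint D i : ebas D i = eint D (i, i).
Proof.
by apply/suppP => j jD; rewrite supp_ebas supp_eint /in_int /= eqn_leq; congr andb; rewrite andbC.
Qed.

Lemma ebas_Vdelta D i : ebas D i \in Vdelta D (odd i).
Proof. by apply/VdeltaP => j; rewrite supp_ebas => /andP[_ /eqP->]. Qed.

Lemma stretch_EB D i B v : arcs D B -> (0 < i <= D.+2)%N -> v \in EB D B ->
  stretch i v \in EB D.+2 (t_map i B).
Proof.
move=> BD i_le; move: v; apply: EB_ind.
- have -> : stretch i (0 : V D) = 0; last exact: EB0.
  by apply/suppP => j _; rewrite supp_stretch // !supp0 andbF.
- by move=> v w vB wB; rewrite stretchD // EB_addr.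
move=> J JB; have JP := arcs_proper BD JB.
have -> : stretch i (eint D J) = eint D.+2 (xi i J) +
    (if in_int i (xi i J) then ebas D.+2 i else 0).
  apply/suppP => j _; rewrite (eint_xi i_le JP) !suppD -addbA addbb addbF //.
apply: EB_addr; first by apply: eint_EB; rewrite mem_t_map map_f ?orbT.
case: ifP => _; last exact: EB0.
by rewrite ebas_eint; apply: eint_EB; rewrite mem_t_map eqxx.
Qed.

Lemma stretch_Vdelta D i d (v : V D) : (0 < i <= D.+2)%N -> v \in Vdelta D d ->
  stretch i v \in Vdelta D.+2 d.
Proof.
move=> i_le /VdeltaP vd; apply/VdeltaP => j; rewrite supp_stretch // => /andP[ji /vd <-].
by rewrite odd_del ?(negPf ji) ?addbF //; case/andP: i_le.
Qed.

(** E_B is the sum of its even and odd parts: up to a multiple of e_i, which is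
    homogeneous and in E_B, each e_I comes from the matching without the pair
    inserted last. *)
Lemma EB_split D B J : arcs D B -> J \in B -> exists v : bool -> V D,
  eint D J = v true + v false /\ forall d, v d \in EB D B :&: Vdelta D d.
Proof.
move=> BD; elim: BD J => [D'|D' i B' i_le BD' IH] J; first by rewrite inE.
have eiB : ebas D'.+2 i \in EB D'.+2 (t_map i B').
  by rewrite ebas_eint; apply: eint_EB; rewrite mem_t_map eqxx.
have zV d : 0 \in Vdelta D'.+2 d by apply/VdeltaP => j; rewrite supp0.
rewrite mem_t_map => /orP[/eqP->|/mapP[L LB ->]].
  exists (fun d => if d == odd i then ebas D'.+2 i else 0); split.
    by rewrite -ebas_eint; case: (odd i); rewrite /= ?addr0 ?add0r.
  move=> d; rewrite inE; case: eqP => [->|_]; last by rewrite EB0 zV.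
  by rewrite eiB ebas_Vdelta.
have [v [EL vd]] := IH L LB.
pose c := if in_int i (xi i L) then ebas D'.+2 i else 0.
exists (fun d => stretch i (v d) + (if d == odd i then c else 0)); split.
  rewrite eint_xi ?(arcs_proper BD') // EL stretchD // -/c.
  by case: (odd i); rewrite /= ?addr0 -?addrA // [c + _]addrC.
have cB : c \in EB D'.+2 (t_map i B') by rewrite /c; case: ifP => _ //; apply: EB0.
move=> d; rewrite inE; have /setIP[vB vV] := vd d; apply/andP; split.
  by apply: EB_addr; [exact: stretch_EB | case: ifP => _ //; apply: EB0].
apply/VdeltaP => j; rewrite suppD.
have /VdeltaP sd := stretch_Vdelta i_le vV.
case E: (supp (stretch i (v d)) j) => /=; first by move/sd: E.
case: eqP => [->|_]; last by rewrite supp0.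
rewrite /c; case: ifP => _; last by rewrite supp0.
by rewrite supp_ebas => /andP[_ /eqP->].
Qed.

(** * Recovering a subspace from its annihilator *)

Lemma sformDr D (x y z : V D) : sform x (y + z) = sform x y + sform x z.
Proof.
rewrite /sform -big_split; apply: eq_bigr => i _; rewrite -big_split.
by apply: eq_bigr => j _; rewrite mxE mulrDr.
Qed.

Lemma sformDl D (x y z : V D) : sform (x + y) z = sform x z + sform y z.
Proof.
rewrite /sform -big_split; apply: eq_bigr => i _; rewrite -big_split.
by apply: eq_bigr => j _; rewrite mxE mulrDl.
Qed.

Lemma sformr0 D (x : V D) : sform x 0 = 0.
Proof. by rewrite /sform big1 // => i _; rewrite big1 // => j _; rewrite mxE mulr0. Qed.

Lemma sum_coord D (x : V D) n :
  \sum_(l < D | l == n :> nat) x 0 l = (supp x n.+1)%:R.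
Proof.
case: (ltnP n D) => nD; last first.
  rewrite big_pred0 => [|l]; last by apply: ltn_eqF; apply: leq_trans (ltn_ord l) nD.
  by rewrite (contraNF (@supp_out _ _ _)) //= -leqNgt.
rewrite (big_pred1 (Ordinal nD)) => [|l]; last by rewrite /= -val_eqE.
by rewrite -[n in supp _ n.+1]/(val (Ordinal nD)) suppE [LHS]F2_bool.
Qed.

Lemma sform_ebas D (x : V D) m : (0 < m <= D)%N ->
  sform x (ebas D m) = (supp x m.-1 (+) supp x m.+1)%:R.
Proof.
case: m => // m /andP[_ mD]; pose o := Ordinal (mD : (m < D)%N).
have -> : sform x (ebas D m.+1) = \sum_(l < D | (l == m.+1 :> nat) || (m == l.+1)) x 0 l.
  rewrite /sform [RHS]big_mkcond; apply: eq_bigr => l _.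
  rewrite big_mkcond (bigD1 o) //= big1 ?addr0 => [|j jo].
    by rewrite mxE eqxx mulr1.
  by rewrite mxE eqSS (_ : (j == m :> nat) = false) ?mulr0 ?if_same //; apply: negbTE.
rewrite (bigID (fun l : 'I_D => l == m.+1 :> nat)) /= -F2_addb addrC; congr (_ + _).
  case: m mD o => [|m] mD o.
    rewrite big_pred0 => [|l]; last by rewrite orbF andbN.
    by rewrite (contraNF (@supp_out _ _ _)).
  rewrite -sum_coord; apply: eq_bigl => l; rewrite eqSS [m == _]eq_sym.
  by case: (eqVneq (l : nat) m) => [->|]; rewrite ?orbT ?orbF ?andbN //=; lia.
by rewrite -sum_coord; apply: eq_bigl => l; case: eqP => //=; rewrite ?andbF.
Qed.

Lemma Vdelta_ind D d (P : V D -> Prop) :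
  P 0 -> (forall v w, P v -> P w -> P (v + w)) ->
  (forall m, (0 < m <= D)%N -> odd m = d -> P (ebas D m)) ->
  forall v, v \in Vdelta D d -> P v.
Proof.
move=> P0 PD Pe v; rewrite in_span_set; apply: span_ind => // w /mapP[m].
by rewrite mem_filter mem_iota add1n => /andP[/eqP md mD] ->; apply: Pe.
Qed.

(** The form pairs V^d with V^(1 - d) perfectly, except for its radical,
    which lies in V^1 when D is odd. *)
Lemma sform_represent D d (phi : V D -> 'F_2) : ~~ odd D || d ->
  phi 0 = 0 -> {morph phi : v w / v + w} ->
  exists2 x, x \in Vdelta D d & forall y, y \in Vdelta D (~~ d) -> sform x y = phi y.
Proof.
move=> Dd phi0 phiD.
(* The coordinate j of x sums the values of phi at the e_m, m of the other parity,
   over one side of j.  Since (x, e_m) is the sum of the coordinates m - 1 and m + 1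
   of x, only phi (e_m) remains.  The side is chosen such that the sum at the missing
   neighbour of the first or last m is empty. *)
pose P j m := (odd m != d) && (if d then j < m else m < j)%N.
pose f j := \big[addb/false]_(1 <= m < D.+1 | P j m) (phi (ebas D m) != 0).
pose x : V D := \row_l ((odd l.+1 == d) && f l.+1)%:R.
have xE j : supp x j = (0 < j <= D)%N && ((odd j == d) && f j).
  exact: (supp_row _ (fun j => (odd j == d) && f j)).
exists x; first by apply/VdeltaP => j; rewrite xE => /and3P[_ /eqP].
apply: Vdelta_ind => [|v w vE wE|m mD md]; first by rewrite sformr0 phi0.
  by rewrite sformDr phiD vE wE.
rewrite sform_ebas // [RHS]F2_bool; congr (nat_of_bool _)%:R.
have fP j : odd j = d -> supp x j = (0 < j <= D)%N && f j by move=> oj; rewrite xE oj eqxx.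
have -> : supp x m.-1 = f m.-1.
  rewrite fP; last by move: mD md; clear; case: m d => [|m] [] //=; lia.
  case: (boolP (0 < m.-1 <= D)%N) => // h; symmetry; rewrite /f big_nat_cond big_pred0 // => l.
  by move: h mD md Dd; rewrite /P; clear; case: d => /=; lia.
have -> : supp x m.+1 = f m.+1.
  rewrite fP /=; last by move: md; clear; case: d; lia.
  case: (ltnP m D) => // h; symmetry; rewrite /f big_nat_cond big_pred0 // => l.
  by move: h mD md Dd; rewrite /P; clear; case: d => /=; lia.
have key j l : (0 < m <= D)%N -> odd m = ~~ d -> (forall n, P j n = P l n || (n == m)) -> ~~ P l m ->
    f j = (phi (ebas D m) != 0) (+) f l.
  move=> {}mD {}md jl lm; rewrite /f.
  rewrite (bigID (pred1 m)) /=; congr (_ (+) _).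
    rewrite -big_filter (@perm_big _ _ _ _ _ [:: m]) ?big_seq1 //.
    apply: uniq_perm; rewrite ?filter_uniq ?iota_uniq // => n.
    rewrite mem_filter mem_index_iota inE jl; case: eqVneq => [->|]; rewrite ?andbF //=.
    by rewrite orbT ltnS mD.
  apply: eq_bigl => n; rewrite jl; case: (eqVneq n m) => [->|]; rewrite ?andbF ?orbF ?andbT //.
  by rewrite (negPf lm).
case: (boolP d) => hd.
  rewrite (key m.-1 m.+1) // -?addbA ?addbb ?addbF //.
    by move=> n; rewrite /P hd; move: mD md; rewrite hd; clear; lia.
  by rewrite /P hd; clear; lia.
rewrite addbC (key m.+1 m.-1) // -?addbA ?addbb ?addbF //.
  by move=> n; rewrite /P (negPf hd); move: mD md; rewrite (negPf hd); clear; lia.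
by rewrite /P (negPf hd); clear; lia.
Qed.

Lemma in_bang D d (Z : {set V D}) x :
  (x \in bang d Z) = (x \in Vdelta D d) && [forall z in Z, sform x z == 0].
Proof. by rewrite in_set. Qed.

(** If z is not in U, a coordinate of the component of z in a complement of U is a
    linear form that vanishes on U but not at z; a vector that represents it is
    orthogonal to U and not to z. *)
Lemma bang_sub D d (Z : {set V D}) (U : {vspace V D}) : ~~ odd D || d ->
  Z \subset Vdelta D (~~ d) -> (forall u, u \in U -> u \in Vdelta D (~~ d)) ->
  bang d [set u | u \in U] \subset bang d Z -> forall z, z \in Z -> z \in U.
Proof.
move=> Dd /subsetP ZV UV /subsetP UZ z zZ; apply/contraT => zU.
have [l zl] : exists l, (z - projv U z) 0 l != 0.
  apply/existsP; rewrite -negb_forall; apply: contra zU => /forallP z0.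
  suff -> : z = projv U z by apply: memv_proj.
  by apply/eqP; rewrite -subr_eq0; apply/eqP/rowP => l; rewrite (eqP (z0 l)) mxE.
pose phi v := (v - projv U v) 0 l.
have [||x xV xE] := @sform_represent D d phi Dd.
- by rewrite /phi linear0 subr0 mxE.
- by move=> v w; rewrite /phi linearD opprD addrACA mxE.
have : x \in bang d Z.
  apply: UZ; rewrite in_bang xV; apply/forall_inP => u; rewrite inE => uU.
  by rewrite xE ?UV // /phi projv_id // subrr mxE.
rewrite in_bang xV => /forall_inP /(_ z zZ).
by rewrite xE ?ZV // (negPf zl).
Qed.

Lemma EB_cap D B d : EB D B :&: Vdelta D d =
  [set v | v \in (<<[seq eint D J | J <- enum_fset B]>> :&:
                  <<[seq ebas D i | i <- iota 1 D & odd i == d]>>)%VS].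
Proof. by apply/setP => v; rewrite !inE memv_cap. Qed.

Lemma bang_EB_sub D d B1 B2 : ~~ odd D || d ->
  bang d (EB D B2 :&: Vdelta D (~~ d)) \subset bang d (EB D B1 :&: Vdelta D (~~ d)) ->
  EB D B1 :&: Vdelta D (~~ d) \subset EB D B2 :&: Vdelta D (~~ d).
Proof.
move=> Dd; rewrite [EB D B2 :&: _]EB_cap => sub; apply/subsetP => z zB; rewrite inE.
apply: (bang_sub Dd _ _ sub zB); first exact: subsetIr.
by move=> u; rewrite memv_cap => /andP[_ uV]; rewrite in_span_set.
Qed.

(** The pair of subgroups determines both homogeneous parts of E_B, hence the
    vectors e_I in E_B, hence B. *)
Lemma pairBC_inj D d B1 B2 : ~~ odd D -> arcs D B1 -> arcs D B2 ->
  pairBC d (EB D B1) = pairBC d (EB D B2) -> B1 = B2.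
Proof.
move=> oD BD1 BD2 [Ed Eb].
have sub C1 C2 : arcs D C1 -> arcs D C2 ->
    EB D C1 :&: Vdelta D d = EB D C2 :&: Vdelta D d ->
    EB D C1 :&: Vdelta D (~~ d) \subset EB D C2 :&: Vdelta D (~~ d) ->
    (C1 `<=` C2)%fset.
  move=> CD1 CD2 E1 /subsetP E2; apply/fsubsetP => J JC.
  apply: (EB_eint CD2 (arcs_proper CD1 JC)).
  have [v [-> vd]] := EB_split CD1 JC.
  have vC e : v e \in EB D C2.
    case: (eqVneq e d) => [->|ed].
      by have := vd d; rewrite E1 => /setIP[].
    have -> : e = ~~ d by move: ed; clear; case: e; case: d.
    by have /E2/setIP[] := vd (~~ d).
  exact: EB_addr.
by apply/eqP; rewrite eqEfsubset; apply/andP; split; apply: sub => //;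
  apply: bang_EB_sub; rewrite ?oD // Eb.
Qed.

(** * From injectivity of alpha to the bijection *)

(** By injectivity, the fibre over alpha m meets the series in m alone. *)
Lemma series_bijection (F : Udata_type) (g : {set Mtype F}) :
  g \subset Mset F -> {in g, forall m, alpha m \in Hbar F} ->
  {in g &, injective (@alpha F)} ->
  exists Phi : {h | h \in Hbar_gamma g} -> {m | m \in g},
    (forall h, alpha_fibre (val h) :&: g = [set val (Phi h)]) /\ bijective Phi.
Proof.
move=> /subsetP gM gH g_inj.
have fibre_g m : m \in g -> alpha_fibre (alpha m) :&: g = [set m].
  move=> mg; apply/setP => m'; rewrite !inE; apply/idP/eqP => [|->].
    by move=> /andP[/andP[_ /eqP E] m'g]; apply: g_inj.
  by rewrite gM // eqxx mg.
have PhiP (h : {h | h \in Hbar_gamma g}) :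
    {m : {m | m \in g} | alpha_fibre (val h) :&: g = [set val m]}.
  case: h => h /= hg; have /sigW[m /eqP mE] : exists m, alpha_fibre h :&: g == [set m].
    by move: hg; rewrite inE => /andP[_ /cards1P[m ->]]; exists m.
  have mg : m \in g by have := set11 m; rewrite -mE inE => /andP[].
  by exists (exist _ m mg).
have alphaP (m : {m | m \in g}) : alpha (val m) \in Hbar_gamma g.
  by rewrite inE gH ?(valP m) // fibre_g ?(valP m) // cards1 eqxx.
exists (fun h => sval (PhiP h)); split=> [h|]; first exact: (svalP (PhiP h)).
pose Psi m := exist (fun h => h \in Hbar_gamma g) (alpha (val m)) (alphaP m).
exists Psi => [h|m].
  apply: val_inj; have := set11 (val (sval (PhiP h))).
  by rewrite -(svalP (PhiP h)) !inE => /andP[/andP[_ /eqP]].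
apply: val_inj; case: (PhiP (Psi m)) => m' /= E; apply/set1P.
by rewrite -fibre_g ?(valP m) // E set11.
Qed.

Lemma preim_partition_series (T : finType) (rT : eqType) (f : T -> rT) (A g : {set T}) :
  g \in preim_partition f A -> g \subset A /\ {in g &, forall x y, f x = f y}.
Proof.
move=> gP; have /and3P[/eqP cov _ _] := preim_partitionP f A.
split; first by rewrite -cov; apply: bigcup_sup.
move: gP; rewrite /preim_partition /equivalence_partition.
case/imsetP => x xA -> y z; rewrite !inE => /andP[_ /eqP <-] /andP[_ /eqP <-] //.
Qed.

Lemma head_filter (T : eqType) (x0 : T) (p : pred T) (s : seq T) :
  has p s -> let x := head x0 [seq x <- s | p x] in x \in s /\ p x.
Proof.
elim: s => //= x s IH; case: ifP => px /=; first by rewrite mem_head px.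
by move=> /IH /= [ys py]; rewrite in_cons ys orbT.
Qed.

(** * Types B and C *)

Lemma mem_dep_pairs (S T : eqType) (s : seq S) (t : S -> seq T) x y :
  ((x, y) \in [seq (a, b) | a <- s, b <- t a]) = (x \in s) && (y \in t x).
Proof.
apply/(@allpairsPdep S (fun=> T))/andP => [[a [b [sa tb [-> ->]]]] //|[sx ty]].
by exists x, y.
Qed.

Lemma indexBCP D B k : ~~ odd D ->
  ((B, k) \in indexBC D) = (B \in Sodd D) && kvalid D B k.
Proof.
move=> oD; rewrite /indexBC mem_dep_pairs.
case: (boolP (B \in enum_fset (Sodd D))) => [BS|//].
rewrite !andTb mem_iota /kvalid (negPf oD) andbT.
by have := Sodd_even_card oD BS; clear -oD; lia.
Qed.

(** Whichever pair (B, k) the search in the list of indices returns, it gives v. *)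
Lemma alphaBCP D d (v : V D) : ~~ odd D -> exists B k,
  [/\ arcs D B, kvalid D B k, eps D (Bk D B k) = v & alphaBC d v = pairBC d (EB D B)].
Proof.
move=> oD; rewrite /alphaBC.
have [B [k [BD kv EB]]] := Bk_surj_even v oD.
have /(head_filter (fset0, 0%N)) [] :
    has (fun p => eps D (Bk D p.1 p.2) == v) (indexBC D).
  by apply/hasP; exists (B, k); rewrite ?EB //= indexBCP // arcs_Sodd.
case: (head _ _) => C l /=; rewrite indexBCP // => /andP[CS lv] /eqP CE.
exists C, l; split=> //; apply: Sodd_arcs => //; exact: Sodd_even_card.
Qed.

Lemma series_BC D d (g : {set Mtype (dataBC D d)}) : ~~ odd D ->
  g \in HCseries (dataBC D d) ->
  [/\ g \subset Mset (dataBC D d), {in g, forall m, alpha m \in Hbar (dataBC D d)} &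
      {in g &, injective (@alpha (dataBC D d))}].
Proof.
move=> oD /preim_partition_series[gM gu]; split=> //.
  move=> v _; have [B [k [BD _ _]]] := alphaBCP d v oD; rewrite /= => ->.
  apply: imset_f; rewrite inE; apply: map_f; exact: arcs_Sodd.
move=> v w vg wg /=; move: (gu _ _ vg wg) => {vg wg}.
have [B [k [BD kv <- ->]]] := alphaBCP d v oD.
have [C [l [CD lv <- ->]]] := alphaBCP d w oD.
move=> /(utilde_even_inj oD) Eu /(pairBC_inj oD BD CD) E; rewrite -{}E {C} in CD lv Eu *.
have /threshold_inj -> // : threshold k = threshold l.
by rewrite -(ufun_Bk BD kv) -(ufun_Bk BD lv) Eu.
Qed.

(** * Type D *)

Lemma supp_eta D j : supp (etaD D) j = (0 < j <= D)%N && odd j.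
Proof.
rewrite /etaD supp_sum (eq_bigr (fun i => (0 < j <= D)%N && (j == i))); last first.
  by move=> i _; rewrite supp_ebas.
case: (boolP (0 < j <= D)%N) => jD /=; last by rewrite big1_eq.
by rewrite (big_addb_pred1 _ _ _ odd) ltnS jD.
Qed.

Lemma addvv D (v : V D) : v + v = 0.
Proof. by apply/suppP => j _; rewrite suppD addbb supp0. Qed.

Lemma addvK D (v w : V D) : v + w + w = v.
Proof. by rewrite -addrA addvv addr0. Qed.

Lemma piD_eta D (v : V D) : piD (v + etaD D) = piD v.
Proof. by rewrite /piD addvK setUC. Qed.

Lemma piD_eq D (v w : V D) : piD v = piD w -> v = w \/ v = w + etaD D.
Proof. by move=> E; have := set21 v (v + etaD D); rewrite -/(piD v) E => /set2P. Qed.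

Lemma VsubP D (v : V D) : (v \in Vsub D D.-1) = ~~ supp v D.
Proof.
apply/idP/idP => [|vD].
  rewrite in_span_set; apply: (span_ind (P := fun w => ~~ supp w D)).
  - by rewrite supp0.
  - by move=> u w /negPf ud /negPf wd; rewrite suppD ud wd.
  move=> w /mapP[i]; rewrite mem_iota => iD ->.
  by rewrite supp_ebas; apply/negP => /andP[D0 /eqP Di]; move: iD D0; rewrite -Di; lia.
rewrite in_span_set [v]ebas_decomp; apply: memv_suml => l vl; apply/memv_span/map_f.
have : l.+1 != D by apply/eqP => lD; move: vl; rewrite lD (negPf vD).
by rewrite mem_iota; have := ltn_ord l; lia.
Qed.

Lemma utilde'E D (v : V D) : odd D -> ~~ supp v D -> utilde' (piD v) = utilde v.
Proof.
move=> oD vD; rewrite /utilde'; case: pickP => [w /andP[]|]; last first.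
  by move=> /(_ v); rewrite VsubP vD eqxx.
rewrite VsubP => wD /eqP/piD_eq[->//|E]; move: wD.
have D0 : (0 < D)%N by case: D oD {v vD w E}.
by rewrite E suppD supp_eta oD D0 leqnn (negPf vD).
Qed.

(** Adding eta to a vector complements its set of points. *)
Lemma changes_eta D x : odd D -> (0 < x <= D.+1)%N -> changes (supp (etaD D)) x.
Proof.
move=> oD; case: x => // x /= xD; rewrite /changes !supp_eta /=.
by move: oD; clear -xD; lia.
Qed.

(** Complementing the set of points turns the path upside down. *)
Lemma ufun_eta D (v : V D) : odd D -> ufun (v + etaD D) = - ufun v.
Proof.
move=> oD; suff key j : (j <= D.+1)%N ->
    height (supp (v + etaD D)) j = - height (supp v) j.
  have := key _ (leqnn _); rewrite -!ufunE oD /=; clear; lia.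
elim: j => // j IH jD; rewrite !heightS (IH (ltnW jD)) opprD; congr (_ + _).
rewrite /letter -!/(changes _ j.+1) changesD (@changes_eta D j.+1) // addbT.
by rewrite /step; case: (changes _ _); case: (odd _).
Qed.

Lemma indexDP D (B : {fset intv}) (k : nat) : odd D ->
  ((B, k) \in indexD D) <-> [/\ arcs D B, kvalid D B k & covered B D -> (0 < k)%N].
Proof.
move=> oD; have DE : D = D.-1.+1 by case: D oD.
have oD1 : ~~ odd D.-1 by rewrite DE /= in oD.
have oddksP : (k \in oddks D B) = odd k && (2 * k + 2 * #|` B| + 1 <= D)%N.
  by rewrite /oddks mem_filter mem_iota; clear; lia.
rewrite /indexD mem_cat !mem_dep_pairs mem_filter in_cons oddksP.
have -> : (B \in enum_fset (Sodd D `\` Sodd D.-1)%fset) =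
          (B \in Sodd D) && (B \notin Sodd D.-1) by rewrite in_fsetD andbC.
split=> [/orP[/andP[BS hk]|/andP[/andP[cB /andP[BS _]] /andP[ok kD]]]|[BD kv ck]].
- have BD1 := Sodd_arcs BS (Sodd_even_card oD1 BS).
  have BD : arcs D B by rewrite DE; apply: arcs_widen.
  split=> //; last first.
    by move=> /(covered_out BD1); move: oD; clear; lia.
  have := arcs_card BD1; rewrite /kvalid oD.
  case/orP: hk => [/eqP->|/andP[-> hk]]; rewrite ?orbT /= ?andbT.
    by clear; lia.
  by move: hk; rewrite /=; clear; lia.
- split; [apply: Sodd_arcs => // | | by case: (k) ok].
    by move: cB; clear; lia.
  by rewrite /kvalid ok orbT implybT andbT; move: kD; clear; lia.
have okD : k = 0%N \/ odd k && (2 * k + 2 * #|` B| + 1 <= D)%N.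
  by move: kv; rewrite /kvalid oD; move: oD; clear; lia.
case: (boolP (B \in Sodd D.-1)) => [BS|BS].
  by apply/orP; left; apply/andP; split=> //; case: okD => ->; rewrite ?orbT.
have cB : covered B D.
  by apply: contraR BS => cB; apply: arcs_Sodd; apply: arcs_shrink.
have k0 := ck cB; have kok : odd k && (2 * k + 2 * #|` B| + 1 <= D)%N.
  by case: okD k0 => [->|].
apply/orP; right; rewrite kok (arcs_Sodd BD) !andbT.
by move: kok k0 oD; clear; rewrite /=; lia.
Qed.

(** For odd D the paths of the B(k) end at height at most 0, so a coset is obtained
    from its representative with u <= 0; if u = 0, the two representatives differ in
    their last coordinate, and the one with last coordinate 0 is used. *)
Lemma alphaDP D (v' : {set V D}) : odd D -> v' \in VD' D -> exists B k,
  [/\ arcs D B, kvalid D B k, covered B D -> (0 < k)%N,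
      piD (eps D (Bk D B k)) = v' & alphaD v' = pairD (EB D B)].
Proof.
move=> oD /imsetP[v0 _ E0].
have [v vD {v0 E0} Ev] : exists2 v, ~~ supp v D & v' = piD v.
  case: (boolP (supp v0 D)) => vD; last by exists v0.
  exists (v0 + etaD D); last by rewrite piD_eta.
  by rewrite suppD supp_eta vD oD leqnn; case: (D) oD.
have [B [k [BD kv ck EB]]] : exists B k,
    [/\ arcs D B, kvalid D B k, covered B D -> (0 < k)%N & piD (eps D (Bk D B k)) = v'].
  pose r := if ufun v <= 0 then v else v + etaD D.
  have rv : piD r = v' by rewrite /r Ev; case: ifP => _ //; rewrite piD_eta.
  have ur : ufun r <= 0.
    by rewrite /r; case: ifP => // hv; rewrite ufun_eta //; move: hv; clear; lia.
  have [k kE] := threshold_even (ufun r).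
  have k_odd : (k == 0%N) || odd k.
    by move: kE ur; rewrite /threshold; case: (odd k); clear; lia.
  have r0 : k = 0%N -> ~~ supp r D.
    move=> k0; rewrite /r; case: ifP => // hv; move: kE.
    by rewrite k0 /threshold /= /r hv ufun_eta //; move: hv; clear; lia.
  have [||| B [BD kv EB]] := @Bk_surj D r k => //.
    by rewrite -ufunE kE oD; clear; lia.
  exists B, k; split=> //; last by rewrite EB.
  rewrite -(supp_last_Bk oD BD kv) EB => rD; rewrite lt0n; apply: contraL rD.
  by move=> /eqP/r0.
have /(head_filter (fset0, 0%N)) [] :
    has (fun p => piD (eps D (Bk D p.1 p.2)) == v') (indexD D).
  by apply/hasP; exists (B, k); [apply/(indexDP _ _ oD) | rewrite EB].
rewrite /alphaD; case: (head _ _) => C l /= /(indexDP _ _ oD)[CD lv cl] /eqP CE.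
by exists C, l.
Qed.

Lemma eta_bang D (Z : {set V D}) : odd D -> Z \subset Vdelta D false ->
  etaD D \in bang true Z.
Proof.
move=> oD /subsetP ZV; rewrite in_bang; apply/andP; split.
  by apply/VdeltaP => j; rewrite supp_eta => /andP[].
apply/forall_inP => z /ZV; apply: (Vdelta_ind (P := fun z => sform (etaD D) z == 0)).
- by rewrite sformr0.
- by move=> v w /eqP vE /eqP wE; rewrite sformDr vE wE addr0.
move=> m mD md; rewrite sform_ebas // !supp_eta.
have -> : (0 < m.-1 <= D)%N && odd m.-1 by move: mD md; clear; case: m => //=; lia.
by have -> : (0 < m.+1 <= D)%N && odd m.+1 by move: mD md oD; clear; lia.
Qed.

(** The annihilator in V^1 contains eta, the radical of the form, so it is the full
    inverse image of its image in the quotient. *)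
Lemma bang_piD D (Z1 Z2 : {set V D}) : odd D -> Z2 \subset Vdelta D false ->
  [set piD x | x in bang true Z1] = [set piD x | x in bang true Z2] ->
  bang true Z1 \subset bang true Z2.
Proof.
move=> oD ZV E; apply/subsetP => x xZ.
have /imsetP[y yZ /piD_eq[->//|->]] : piD x \in [set piD x | x in bang true Z2].
  by rewrite -E imset_f.
have := eta_bang oD ZV; move: yZ; rewrite !in_bang.
move=> /andP[/VdeltaP yV /forall_inP yZ] /andP[/VdeltaP eV /forall_inP eZ].
apply/andP; split.
  apply/VdeltaP => j; rewrite suppD.
  by case Ey: (supp y j) => /=; [move/yV: Ey | move/eV].
by apply/forall_inP => z zZ; rewrite sformDl (eqP (yZ z zZ)) (eqP (eZ z zZ)) addr0.
Qed.

(** All points other than the two ends of I are changes of e_I + eta, hence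
    matched. *)
Lemma EB_eint_eta D B I : odd D -> arcs D B -> proper_int D I ->
  eint D I + etaD D \in EB D B ->
  (D <= 2 * #|` B| + 1)%N /\ (~~ covered B D -> I.2 = D).
Proof.
move=> oD BD IP /(EB_changes BD)[hU _].
have U_ends x : x \in unmatched D B -> ends I x.
  move=> xU; have xD : (0 < x <= D.+1)%N.
    by move: xU; rewrite mem_filter mem_iota add1n => /andP[_].
  by have := hU x xU; rewrite changesD changes_eint // changes_eta // addbT negbK.
split.
  have : (size (unmatched D B) <= 2)%N.
    apply: (@uniq_leq_size _ (unmatched D B) [:: I.1; I.2.+1]) => [|x /U_ends].
      exact: unmatched_uniq.
    by rewrite !inE.
  by rewrite size_unmatched //; clear -oD; lia.
move=> cD; have : D.+1 \in unmatched D B.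
  rewrite mem_filter mem_iota add1n ltnS leqnn [D.+1.-1]/= cD !andbT.
  by apply/contraT; rewrite negbK => /(covered_out BD); rewrite ltnn andbF.
move=> /U_ends; move: IP; rewrite /proper_int /ends; case: (I) => a b /=.
by clear; lia.
Qed.

(** If an interval I of B1 lies in E_B2 only up to eta, then all but two points are
    matched in B2, the last point is not, and I covers D.  So B1 has fewer elements
    than B2.  On the other hand B1 leaves more than two points unmatched, so the
    same exception cannot occur for the intervals of B2, and B2 is contained in
    B1: a contradiction. *)
Lemma pairD_sub D B1 B2 : odd D -> arcs D B1 -> arcs D B2 ->
  (covered B1 D -> 2 * #|` B1| + 3 <= D)%N -> (covered B2 D -> 2 * #|` B2| + 3 <= D)%N ->
  (forall J, J \in B1 -> eint D J \in EB D B2 \/ eint D J + etaD D \in EB D B2) ->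
  (forall J, J \in B2 -> eint D J \in EB D B1 \/ eint D J + etaD D \in EB D B1) ->
  (B1 `<=` B2)%fset.
Proof.
move=> oD BD1 BD2 c1 c2 h1 h2; apply/fsubsetP => I IB; have IP := arcs_proper BD1 IB.
case: (h1 I IB) => [/(EB_eint BD2 IP)//|/(EB_eint_eta oD BD2 IP)[cB2 I2]].
have c2D : ~~ covered B2 D by apply/negP => /c2; move: cB2; clear; lia.
have {}I2 := I2 c2D.
have /c1 cB1 : covered B1 D.
  apply/hasP; exists I => //; move: IP I2; rewrite /proper_int /in_int.
  by case: (I) => a b /=; clear; lia.
have : (B2 `<=` B1)%fset.
  apply/fsubsetP => J JB; have JP := arcs_proper BD2 JB.
  case: (h2 J JB) => [/(EB_eint BD1 JP)//|/(EB_eint_eta oD BD1 JP)[]].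
  by move: cB1; clear; lia.
by move=> /fsubset_leq_card; move: cB1 cB2; clear; lia.
Qed.

Lemma pairD_inj D B1 B2 : odd D -> arcs D B1 -> arcs D B2 ->
  (covered B1 D -> 2 * #|` B1| + 3 <= D)%N -> (covered B2 D -> 2 * #|` B2| + 3 <= D)%N ->
  pairD (EB D B1) = pairD (EB D B2) -> B1 = B2.
Proof.
move=> oD BD1 BD2 c1 c2 [E1 E0].
have key C1 C2 : arcs D C1 -> arcs D C2 ->
    [set piD x | x in EB D C1 :&: Vdelta D true] =
      [set piD x | x in EB D C2 :&: Vdelta D true] ->
    [set piD x | x in bang true (EB D C1 :&: Vdelta D false)] =
      [set piD x | x in bang true (EB D C2 :&: Vdelta D false)] ->
    forall J, J \in C1 -> eint D J \in EB D C2 \/ eint D J + etaD D \in EB D C2.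
  move=> CD1 CD2 F1 F0 J JC; have [v [-> vd]] := EB_split CD1 JC.
  have v0 : v false \in EB D C2.
    have /subsetP/(_ _ (vd false))/setIP[] // :=
      @bang_EB_sub D true C1 C2 (orbT _) (bang_piD oD (subsetIr _ _) (esym F0)).
  have /imsetP[y /setIP[yC _] /piD_eq[E|E]] :
      piD (v true) \in [set piD x | x in EB D C2 :&: Vdelta D true].
  - by rewrite -F1 imset_f.
  - by left; rewrite E EB_addr.
  by right; rewrite E addrAC addvK EB_addr.
have h1 := key _ _ BD1 BD2 E1 E0; have h2 := key _ _ BD2 BD1 (esym E1) (esym E0).
apply/eqP; rewrite eqEfsubset; apply/andP; split.
  exact: pairD_sub oD BD1 BD2 c1 c2 h1 h2.
exact: pairD_sub oD BD2 BD1 c2 c1 h2 h1.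
Qed.

(** For odd D the function [utilde] separates the vectors on which the sign of
    [ufun] is fixed. *)
Lemma utilde_odd_inj D (v w : V D) : odd D ->
  (ufun v <= 0) && (ufun w <= 0) || (0 <= ufun v) && (0 <= ufun w) ->
  utilde v = utilde w -> ufun v = ufun w.
Proof.
move=> oD; rewrite /utilde oD; move: (ufun v) (ufun w) => x y; clear.
by case: (ltrgtP 0 x) => ?; case: (ltrgtP 0 y) => ?; lia.
Qed.

Lemma series_D D (g : {set Mtype (dataD D)}) : odd D -> g \in HCseries (dataD D) ->
  [/\ g \subset Mset (dataD D), {in g, forall m, alpha m \in Hbar (dataD D)} &
      {in g &, injective (@alpha (dataD D))}].
Proof.
move=> oD /preim_partition_series[gM gu]; split=> //.
  move=> v /(subsetP gM) vV; have [B [k [BD _ _ _]]] := alphaDP oD vV; rewrite /= => ->.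
  apply: imset_f; rewrite inE; apply: map_f; exact: arcs_Sodd.
move=> v w vg wg /=; move: (gu _ _ vg wg) (subsetP gM _ vg) (subsetP gM _ wg).
move=> Eu /(alphaDP oD)[B [k [BD kv ck Ev ->]]] /(alphaDP oD)[C [l [CD lv cl Ew ->]]].
have card3 A m : kvalid D A m -> (covered A D -> (0 < m)%N) ->
    covered A D -> (2 * #|` A| + 3 <= D)%N.
  by move=> mv cm /cm; move: mv oD; rewrite /kvalid; clear; lia.
move=> /(pairD_inj oD BD CD (card3 _ _ kv ck) (card3 _ _ lv cl)) E.
rewrite -{}E {C} in CD lv cl Ew *.
suff E : ufun (eps D (Bk D B k)) = ufun (eps D (Bk D B l)).
  have /threshold_inj kl : threshold k = threshold l.
    by rewrite -(ufun_Bk BD kv) -(ufun_Bk BD lv) E.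
  by rewrite -Ev -Ew kl.
have u_le0 m : kvalid D B m -> ufun (eps D (Bk D B m)) <= 0.
  move=> mv; have := ufun_Bk BD mv; move: mv; rewrite /kvalid oD /threshold.
  by case: (odd m); clear; lia.
move: Eu (supp_last_Bk oD BD kv) (supp_last_Bk oD BD lv) (u_le0 _ kv) (u_le0 _ lv).
rewrite -Ev -Ew; move: (eps D _) (eps D _) => r s Eu rD sD ur us.
have D0 : (0 < D)%N by case: (D) oD.
(* The representative with last coordinate 0 is r if D is not covered by B, and
   r + eta if it is; so its function u has the same sign for r and for s. *)
case: (boolP (covered B D)) => cB.
  have last0 x : supp x D = covered B D -> ~~ supp (x + etaD D) D.
    by move=> xD; rewrite suppD xD cB supp_eta oD D0 leqnn.
  apply: oppr_inj; rewrite -!ufun_eta //.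
  apply: utilde_odd_inj => //; first by rewrite !ufun_eta // !oppr_ge0 ur us orbT.
  by rewrite -!utilde'E ?last0 // !piD_eta.
by apply: utilde_odd_inj => //; rewrite ?ur ?us // -!utilde'E // ?rD ?sD.
Qed.

(** * Permutations as lists *)

Section Code.
Variable n : nat.
Implicit Types s t : {perm 'I_n.+1}.

Definition code s : seq nat := [seq val (s l) | l <- enum 'I_n.+1].

Definition all_codes : seq (seq nat) := permutations (iota 0 n.+1).

Lemma size_code s : size (code s) = n.+1.
Proof. by rewrite size_map size_enum_ord. Qed.

Lemma nth_code s (l : 'I_n.+1) : nth 0%N (code s) l = s l.
Proof. by rewrite (nth_map l) ?size_enum_ord // nth_ord_enum. Qed.

Lemma code_inj : injective code.
Proof. by move=> s t E; apply/permP => l; apply: val_inj; rewrite /= -!nth_code E. Qed.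

Lemma eq_code s (l : seq nat) : size l = n.+1 ->
  (forall j : 'I_n.+1, nth 0%N l j = s j) -> code s = l.
Proof.
move=> sl lE; apply: (@eq_from_nth _ 0%N); rewrite size_code // => j jn.
by rewrite -[j]/(val (Ordinal jn)) nth_code lE.
Qed.

Lemma code_in s : code s \in all_codes.
Proof.
rewrite mem_permutations; apply: uniq_perm; rewrite ?iota_uniq //.
  by rewrite map_inj_uniq ?enum_uniq // => x y /val_inj/perm_inj.
move=> j; rewrite mem_iota /= add0n; apply/mapP/idP => [[l _ ->]|jn].
  exact: ltn_ord.
by exists ((s^-1)%g (Ordinal jn)); rewrite ?mem_enum // permKV.
Qed.

Lemma code_onto l : l \in all_codes -> exists s, code s = l.
Proof.
rewrite mem_permutations => lP.
have sl : size l = n.+1 by rewrite (perm_size lP) size_iota.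
have lt_l (j : 'I_n.+1) : (nth 0%N l j < n.+1)%N.
  have : nth 0%N l j \in iota 0 n.+1 by rewrite -(perm_mem lP) mem_nth // sl.
  by rewrite mem_iota.
have f_inj : injective (fun j : 'I_n.+1 => Ordinal (lt_l j)).
  move=> j j' [/eqP]; rewrite nth_uniq ?sl //; first by move=> /eqP/val_inj.
  by rewrite (perm_uniq lP) iota_uniq.
by exists (perm f_inj); apply: eq_code => // j; rewrite permE.
Qed.

Definition compose (l m : seq nat) : seq nat := [seq nth 0%N m j | j <- l].

Lemma codeM s t : code (s * t)%g = compose (code s) (code t).
Proof.
rewrite /compose /code -map_comp; apply: eq_map => j /=.
by rewrite permM -[val (s j)]/(nat_of_ord (s j)) -/(code t) nth_code.
Qed.

Lemma code1 : code 1%g = iota 0 n.+1.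
Proof. by apply: eq_code => [|j]; rewrite ?size_iota // nth_iota // perm1. Qed.

Definition swap_code (a b : nat) : seq nat :=
  [seq (if j == a then b else if j == b then a else j) | j <- iota 0 n.+1].

Lemma code_tperm (a b : 'I_n.+1) : code (tperm a b) = swap_code a b.
Proof.
apply: eq_code => [|j]; first by rewrite size_map size_iota.
rewrite (nth_map 0%N) ?size_iota // nth_iota // add0n.
by rewrite permE /= -!val_eqE; do ![case: ifP => _].
Qed.

Lemma code_tperm_inord a b : (a <= n)%N -> (b <= n)%N ->
  code (tperm (inord a) (inord b)) = swap_code a b.
Proof. by move=> an bn; rewrite code_tperm !inordK. Qed.

Lemma big_codes (R : Type) (idx : R) (op : Monoid.com_law idx) (F : seq nat -> R)
    (P : pred (seq nat)) :
  \big[op/idx]_(s : {perm 'I_n.+1} | P (code s)) F (code s) =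
  \big[op/idx]_(l <- all_codes | P l) F l.
Proof.
rewrite -(big_map code P F) /=.
have -> // : \big[op/idx]_(l <- map code (index_enum _) | P l) F l =
  \big[op/idx]_(l <- all_codes | P l) F l.
apply: perm_big; apply: uniq_perm; rewrite ?permutations_uniq //.
  by rewrite map_inj_uniq ?index_enum_uniq //; apply: code_inj.
move=> l; apply/mapP/idP => [[s _ ->]|/code_onto[s <-]]; first exact: code_in.
by exists s; rewrite ?mem_index_enum.
Qed.

Definition cent_codes (x : seq nat) : seq (seq nat) :=
  [seq l <- all_codes | compose x l == compose l x].

Lemma cent1_code s t : (t \in 'C[s]%g) = (compose (code s) (code t) == compose (code t) (code s)).
Proof. by rewrite -!codeM (inj_eq code_inj); apply/cent1P/eqP. Qed.

Lemma cent_codesP s t : (code t \in cent_codes (code s)) = (t \in 'C[s]%g).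
Proof. by rewrite mem_filter code_in andbT cent1_code. Qed.

Lemma sum_cent (R : nmodType) (F : seq nat -> R) s :
  \sum_(t in 'C[s]%g) F (code t) = \sum_(l <- cent_codes (code s)) F l.
Proof.
rewrite /cent_codes big_filter -big_codes; apply: eq_bigl => t; exact: cent1_code.
Qed.

Lemma card_cent s : #|'C[s]%g| = size (cent_codes (code s)).
Proof. by rewrite -sum1_card -sum1_size; apply: (sum_cent (fun=> 1%N)). Qed.

Lemma cent_all s (P : pred (seq nat)) : all P (cent_codes (code s)) ->
  forall t, t \in 'C[s]%g -> P (code t).
Proof. by move=> /allP sP t ts; apply: sP; rewrite cent_codesP. Qed.

Lemma cent_all2 s (P : rel (seq nat)) :
  allrel P (cent_codes (code s)) (cent_codes (code s)) ->
  forall t u, t \in 'C[s]%g -> u \in 'C[s]%g -> P (code t) (code u).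
Proof. by move=> /allrelP sP t u ts us; apply: sP; rewrite cent_codesP. Qed.

(** ** Sign *)

Fixpoint inversions (l : seq nat) : bool :=
  if l is x :: l' then odd (count (fun y => y < x)%N l') (+) inversions l' else false.

Definition sign_check : bool :=
  ~~ inversions (iota 0 n.+1) &&
  all (fun l => all (fun a => all (fun b =>
     inversions (compose (swap_code a b) l) == (a != b) (+) inversions l)
     (iota 0 n.+1)) (iota 0 n.+1)) all_codes.

(** The parity of the number of inversions changes with each transposition. *)
Lemma odd_code s : sign_check -> odd_perm s = inversions (code s).
Proof.
case/andP=> /negPf inv1 /allP invM.
have [ts -> _] := prod_tpermP s.
elim: ts => [|[a b] ts IH]; first by rewrite big_nil odd_perm1 code1 inv1.
rewrite big_cons odd_mul_tperm IH codeM code_tperm /=.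
have in_n (x : 'I_n.+1) : val x \in iota 0 n.+1 by rewrite mem_iota /= ltn_ord.
have /allP/(_ _ (in_n a))/allP/(_ _ (in_n b))/eqP := invM _ (code_in (\prod_(t <- ts) tperm t.1 t.2)%g).
by rewrite /= => ->.
Qed.

(** ** Fixed points and fixed pairs *)

Definition fix_code (l : seq nat) : nat := count (fun j => nth 0%N l j == j) (iota 0 (size l)).

Lemma fixpts_code s : fixpts s = fix_code (code s).
Proof.
rewrite /fixpts cardsE -sum1_card /fix_code size_code -sum1_count.
rewrite -[iota 0 n.+1]/(index_iota 0 n.+1) big_mkord; apply: eq_bigl => j.
by rewrite nth_code.
Qed.

Definition pair_fixed (l : seq nat) (p : nat * nat) : bool :=
  (p.1 < p.2)%N && (((nth 0%N l p.1 == p.1) && (nth 0%N l p.2 == p.2)) ||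
                    ((nth 0%N l p.1 == p.2) && (nth 0%N l p.2 == p.1))).

Definition fix_pairs_code (l : seq nat) : nat :=
  count (pair_fixed l) [seq (a, b) | a <- iota 0 (size l), b <- iota 0 (size l)].

Lemma fixpairs_code s : fixpairs s = fix_pairs_code (code s).
Proof.
pose Q := [set p : 'I_n.+1 * 'I_n.+1 | pair_fixed (code s) (val p.1, val p.2)].
pose f (p : 'I_n.+1 * 'I_n.+1) := [set p.1; p.2].
have QE a b : ((a, b) \in Q) = (a < b)%N && (s @: f (a, b) == f (a, b)).
  rewrite inE /pair_fixed /= !nth_code; case: ltnP => //= ab.
  have anb : a != b by rewrite -val_eqE neq_ltn ab.
  rewrite /f /= imsetU !imset_set1 !val_eqE; apply/orP/eqP.
    by case=> /andP[/eqP-> /eqP->]; rewrite // setUC.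
  move=> E; have : s a \in [set a; b] by rewrite -E set21.
  have : s b \in [set a; b] by rewrite -E set22.
  rewrite !inE => /orP[/eqP sb|/eqP sb] /orP[/eqP sa|/eqP sa].
  - by case/eqP: anb; apply: (@perm_inj _ s); rewrite sa sb.
  - by right; rewrite sa sb !eqxx.
  - by left; rewrite sa sb !eqxx.
  by case/eqP: anb; apply: (@perm_inj _ s); rewrite sa sb.
have f_inj : {in Q &, injective f}.
  move=> [a b] [c d]; rewrite !QE => /andP[ab _] /andP[cd _] E.
  have : a \in f (c, d) by rewrite -E set21.
  have : b \in f (c, d) by rewrite -E set22.
  rewrite !inE /= => /orP[/eqP bE|/eqP bE] /orP[/eqP aE|/eqP aE]; subst => //.
  - by rewrite ltnn in ab.
  - by have := ltn_trans ab cd; rewrite ltnn.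
  by rewrite ltnn in ab.
have -> : fixpairs s = #|Q|.
  rewrite /fixpairs -(card_in_imset f_inj); apply: eq_card => A; rewrite inE.
  apply/andP/imsetP => [[/cards2P[a [b [anb ->]]] sA]|[[a b]]].
    have [ab|ba] : (a < b)%N \/ (b < a)%N.
      by move: anb; rewrite -val_eqE neq_ltn => /orP[]; [left|right].
    - by exists (a, b); rewrite // QE ab.
    exists (b, a); last by rewrite /f setUC.
    by rewrite QE ba /f /= setUC.
  rewrite QE => /andP[ab fs] ->; split=> //.
  by rewrite cards2 -val_eqE neq_ltn ab.
rewrite cardsE -sum1_card /fix_pairs_code size_code -sum1_count.
rewrite big_mkcond [RHS]big_mkcond big_allpairs.
rewrite -(pair_bigA _ (fun a b : 'I_n.+1 => if pair_fixed (code s) (val a, val b) then 1 else 0)%N).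
rewrite -[iota 0 n.+1]/(index_iota 0 n.+1) big_mkord; apply: eq_bigr => a _.
by rewrite big_mkord.
Qed.

End Code.

(** * Irreducible characters given by their values *)

Section CharacterValues.
Variables (gT : finGroupType) (G : {group gT}).
Implicit Types f g : gT -> algC.

Definition irr_on f : Prop := exists i, {in G, 'chi[G]_i =1 f}.

Definition vchar_on f : Prop := exists2 phi : 'CF(G), phi \in 'Z[irr G]%g & {in G, phi =1 f}.

Lemma eq_vchar_on f g : {in G, f =1 g} -> vchar_on f -> vchar_on g.
Proof. by move=> fg [phi phiZ phif]; exists phi => // x xG; rewrite phif ?fg. Qed.

Lemma vchar_on1 : vchar_on (fun=> 1).
Proof. by exists 1 => [|x xG]; rewrite ?rpred1 // cfun1E xG. Qed.

Lemma vchar_onB f g : vchar_on f -> vchar_on g -> vchar_on (fun x => f x - g x).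
Proof.
move=> [phi phiZ phif] [psi psiZ psig]; exists (phi - psi) => [|x xG].
  exact: rpredB.
by rewrite !cfunE phif ?psig.
Qed.

Lemma vchar_onM f g : vchar_on f -> vchar_on g -> vchar_on (f \* g).
Proof.
move=> [phi phiZ phif] [psi psiZ psig]; exists (phi * psi) => [|x xG].
  exact: rpredM.
by rewrite cfunE phif ?psig.
Qed.

Lemma irr_vchar_on f : irr_on f -> vchar_on f.
Proof. by move=> [i fi]; exists 'chi_i => //; apply: irr_vchar. Qed.

Lemma lin_irr_on f : f 1%g = 1 -> {in G &, {morph f : x y / (x * y)%g >-> x * y}} ->
  irr_on f.
Proof.
move=> f1 fM.
have repf : mx_repr G (fun x => (f x)%:M : 'M_1).
  by split=> [|x y xG yG]; rewrite ?f1 // fM // scalar_mxM.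
pose rG := MxRepresentation repf.
have lin : cfRepr rG \is a linear_char.
  by rewrite qualifE /= cfRepr_char cfRepr1 eqxx.
have /irrP[i rE] := lin_char_irr lin; exists i => x xG.
by rewrite -rE cfunE xG mulr1n /= mxtrace_scalar mulr1n.
Qed.

Lemma perm_vchar_on (T : finType) (to : T -> gT -> T) :
  (forall t, to t 1%g = t) ->
  (forall t x y, to t (x * y)%g = to (to t x) y) ->
  vchar_on (fun x => #|[set t | to t x == t]|%:R).
Proof.
move=> to1 toM.
pose r x := \matrix_(a < #|T|, b < #|T|) (to (enum_val a) x == enum_val b)%:R : 'M[algC]_#|T|.
have rep : mx_repr G r.
  split=> [|x y _ _]; apply/matrixP => a b; rewrite !mxE.
    by rewrite to1 (inj_eq enum_val_inj).
  rewrite (bigD1 (enum_rank (to (enum_val a) x))) //= !mxE enum_rankK eqxx mul1r toM.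
  rewrite big1 ?addr0 // => c ca; rewrite !mxE; case: eqP => [E|]; rewrite ?mul0r //.
  by rewrite E enum_valK eqxx in ca.
exists (cfRepr (MxRepresentation rep)); first exact/char_vchar/cfRepr_char.
move=> x xG; rewrite cfunE xG mulr1n /mxtrace /=.
rewrite (eq_bigr (fun a => (to (enum_val a) x == enum_val a)%:R)); last first.
  by move=> a _; rewrite mxE.
rewrite -natr_sum; congr _%:R; rewrite -[RHS]sum1_card [RHS]big_mkcond.
rewrite [RHS](reindex (@enum_val T T)) /=; last exact/onW_bij/enum_val_bij.
by apply: eq_bigr => a _; rewrite inE; case: eqP.
Qed.

(** A virtual character of norm 1 is irreducible up to sign, and its value at 1
    gives the sign. *)
Lemma irr_on_norm f (c : gT -> int) : vchar_on f -> {in G, forall x, f x = (c x)%:~R} ->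
  \sum_(x in G) c x ^+ 2 = #|G| -> 0 < c 1%g -> irr_on f.
Proof.
move=> [phi phiZ phif] fc c2 c1.
have norm1 : '[phi] = 1.
  rewrite cfdotE (eq_bigr (fun x => (c x ^+ 2)%:~R)) => [|x xG]; last first.
    by rewrite phif // fc // conj_intr ?intr_int // -rmorphM.
  rewrite -(big_morph (fun z : int => z%:~R : algC) (@rmorphD _ _ _) (rmorph0 _)) c2.
  by rewrite mulVf // pnatr_eq0 -lt0n cardG_gt0.
have [b [i phiE]] := vchar_norm1P phiZ norm1.
exists i => x xG; rewrite -phif // phiE.
have := irr1_gt0 i; have := phif 1%g (group1 G); rewrite phiE fc ?group1 //.
case: b {phiE} => [E chi0|_ _]; last by rewrite expr0 scale1r.
have : 0 < (c 1%g)%:~R :> algC by rewrite ltr0z.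
by rewrite -E expr1 scaleN1r cfunE oppr_gt0 => /(lt_trans chi0); rewrite ltxx.
Qed.

(** The regular character contains every irreducible character, with its degree
    as multiplicity; so a list of irreducible characters which adds up to it is
    complete and without repetition. *)
Lemma irr_list_complete (f0 : gT -> algC) (fs : seq (gT -> algC)) :
  (forall a, (a < size fs)%N -> irr_on (nth f0 fs a)) ->
  {in G, forall x, \sum_(f <- fs) f 1%g * f x = (#|G| * (x == 1%g))%:R} ->
  (forall i : Iirr G, exists2 a, (a < size fs)%N & {in G, 'chi_i =1 nth f0 fs a}) /\
  (forall a b, (a < size fs)%N -> (b < size fs)%N ->
     {in G, nth f0 fs a =1 nth f0 fs b} -> a = b).
Proof.
move=> irr_fs reg.
have [s [ss sE]] : exists s : seq (Iirr G), size s = size fs /\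
    forall a, (a < size fs)%N -> {in G, 'chi_(nth 0 s a) =1 nth f0 fs a}.
  elim: (fs) irr_fs => [|f r IH] irr_r; first by exists [::].
  have [i iE] := irr_r 0%N isT; have [|s [ss sE]] := IH; first by move=> a; apply: (irr_r a.+1).
  by exists (i :: s); split=> [|[|a]] //=; [rewrite ss | apply: sE].
have count1 j : count_mem j s = 1%N.
  have regE : cfReg G = \sum_(i <- s) 'chi_i 1%g *: 'chi_i.
    apply/cfun_inP => x xG; rewrite cfRegE sum_cfunE.
    have -> : \sum_(i <- s) ('chi_i 1%g *: 'chi_i) x = \sum_(f <- fs) f 1%g * f x.
      rewrite (big_nth 0) (big_nth f0) ss; apply: eq_big_nat => a /andP[_ aP].
      by rewrite cfunE !(sE a) ?group1.
    by rewrite reg // natrM mulr_natr.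
  have /eqP : '[cfReg G, 'chi_j] = 'chi_j 1%g * (count_mem j s)%:R.
    rewrite regE cfdot_suml -sum1_count natr_sum mulr_sumr [RHS]big_mkcond /=.
    apply: eq_bigr => i _; rewrite cfdotZl cfdot_irr.
    by case: eqP => [->|]; rewrite ?mulr1 ?mulr0.
  rewrite cfReg_sum cfdot_suml (bigD1 j) //= cfdotZl cfnorm_irr mulr1 big1 ?addr0.
    move=> /eqP E; have /eqP := mulfI (irr1_neq0 j) (etrans (mulr1 _) E).
    by rewrite -[X in X == _]/(1%:R) eqr_nat => /eqP.
  by move=> i /negPf ij; rewrite cfdotZl cfdot_irr ij mulr0.
have us : uniq s by apply/count_mem_uniq => j; rewrite -has_pred1 has_count count1.
split=> [i|a b aP bP ab].
  have iS : i \in s by rewrite -has_pred1 has_count count1.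
  by exists (index i s); rewrite -?ss ?index_mem // => x xG; rewrite -sE ?nth_index // -ss index_mem.
apply/eqP; rewrite -(nth_uniq 0 _ _ us) ?ss //; apply/eqP/irr_inj/cfun_inP => x xG.
by rewrite !sE // ab.
Qed.

End CharacterValues.

Lemma fixpts_vchar n (G : {group {perm 'I_n.+1}}) :
  vchar_on G (fun s => (fixpts s)%:R).
Proof.
by apply: (@perm_vchar_on _ G 'I_n.+1 (fun j s => s j)) => [j|j s t];
  rewrite ?perm1 ?permM.
Qed.

Lemma fixpairs_vchar n (G : {group {perm 'I_n.+1}}) :
  vchar_on G (fun s => (fixpairs s)%:R).
Proof.
pose T := {A : {set 'I_n.+1} | #|A| == 2%N}.
have actP (A : T) (s : {perm 'I_n.+1}) : #|s @: val A| == 2%N.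
  by rewrite card_imset ?(valP A) //; apply: perm_inj.
pose to (A : T) (s : {perm 'I_n.+1}) : T := Sub (s @: val A) (actP A s).
apply: eq_vchar_on (@perm_vchar_on _ G T to _ _) => [s _|A|A s t].
- congr _%:R; rewrite /fixpairs -(card_imset _ (@val_inj _ _ T)); apply: eq_card => A.
  rewrite inE; apply/imsetP/andP => [[B]|[A2 sA]].
    by rewrite inE -val_eqE => sB ->; rewrite (valP B).
  by exists (Sub A A2 : T); rewrite // inE -val_eqE.
- by apply: val_inj; rewrite /= (eq_imset (g := id)) ?imset_id // => j; rewrite perm1.
by apply: val_inj; rewrite /= -imset_comp; apply: eq_imset => j; rewrite /= permM.
Qed.

(** * The set M(Gamma) from lists of irreducible characters *)

Section MSet.
Variable gT : finGroupType.
Implicit Types (x y h : gT) (f : gT -> algC).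

Definition Mclass (p : Mpair gT) : {set Mpair gT} := [set q in setT | Mconj p q].

Lemma Mclass_in p : Mclass p \in Mgrp gT.
Proof. by apply: imset_f. Qed.

Lemma Melt_class x (i : Iirr 'C[x]%g) f : {in 'C[x]%g, 'chi_i =1 f} ->
  Melt x f = Mclass (Tagged (fun y => Iirr 'C[y]%g) i).
Proof.
move=> fi; apply/setP => q; rewrite !inE /=; apply: eq_existsb => h; congr (_ && _).
by apply: eq_forallb => z; case: (boolP (z \in _)) => //= zC; rewrite fi.
Qed.

Lemma Melt_in x f : irr_on 'C[x]%G f -> Melt x f \in Mgrp gT.
Proof. by move=> [i fi]; rewrite (Melt_class fi) Mclass_in. Qed.

(** Every class of pairs has a member over a given representative of the
    conjugacy class of its first component. *)
Lemma Mclass_Melt x h (p : Mpair gT) : tag p = (x ^ h)%g ->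
  exists i : Iirr 'C[x]%g, Mclass p = Melt x 'chi_i.
Proof.
case: p => y j /= yE.
have iso : isom 'C[y]%G 'C[x]%G (conjgm 'C[y]%G h^-1%g).
  have := conj_isom 'C[y]%G h^-1%g; congr (isom _ _ _).
  by rewrite /= -cent1J yE conjgK.
have /irrP[i iE] : cfIsom iso 'chi_j \in irr 'C[x]%G by rewrite cfIsom_irr mem_irr.
have zyC z : z \in 'C[x]%g -> (z ^ h)%g \in 'C[y]%g by rewrite yE cent1J memJ_conjg.
have chiE z : z \in 'C[x]%g -> 'chi_i z = 'chi_j (z ^ h)%g.
  by move=> zC; rewrite -iE -(cfIsomE iso 'chi_j (zyC z zC)) /= conjgmE conjgK.
exists i; apply/setP => q; rewrite !inE /=; apply/existsP/existsP.
  move=> [g /andP[/eqP qE /forall_inP chiq]]; exists (h * g)%g.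
  apply/andP; split; first by rewrite qE /= yE conjgM.
  apply/forall_inP => z zC.
  by rewrite conjgM chiE // (eqP (chiq _ (zyC z zC))).
move=> [g /andP[/eqP qE /forall_inP chiq]]; exists (h^-1 * g)%g.
apply/andP; split; first by rewrite qE /= yE conjgM conjgK.
apply/forall_inP => z /=; rewrite {1}yE cent1J mem_conjg => zC.
by rewrite conjgM (eqP (chiq _ zC)) chiE // conjgKV.
Qed.

(** Two descriptions of the same class have conjugate first components; when these
    are equal, the conjugating element centralizes them and fixes the character. *)
Lemma Melt_eq x y f f' : irr_on 'C[x]%G f -> Melt x f = Melt y f' ->
  (exists h, x = (y ^ h)%g) /\ (x = y -> {in 'C[x]%g, f =1 f'}).
Proof.
move=> [i fi] E.
have : Tagged (fun y => Iirr 'C[y]%g) i \in Melt y f'.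
  rewrite -E (Melt_class fi) !inE; apply/existsP; exists 1%g.
  by rewrite conjg1 eqxx; apply/forall_inP => z _; rewrite conjg1.
rewrite inE => /existsP[h /= /andP[/eqP xE /forall_inP chiE]]; split; first by exists h.
move=> xy; subst y; have hC : h \in 'C[x]%G.
  by apply/cent1P; rewrite /commute (conjgC x h) -xE.
by move=> z zC; rewrite -fi // -(eqP (chiE z zC)) cfunJ.
Qed.

Definition complete_irr x (fs : seq (gT -> algC)) : Prop :=
  [/\ forall a, (a < size fs)%N -> irr_on 'C[x]%G (nth (fun=> 0) fs a),
      forall i : Iirr 'C[x]%G, exists2 a, (a < size fs)%N &
        {in 'C[x]%g, 'chi_i =1 nth (fun=> 0) fs a} &
      forall a b, (a < size fs)%N -> (b < size fs)%N ->
        {in 'C[x]%g, nth (fun=> 0) fs a =1 nth (fun=> 0) fs b} -> a = b].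

(** The entries of cd are meant to consist of a representative of a conjugacy class
    and the irreducible characters of its centralizer. *)
Definition Melts (cd : seq (gT * seq (gT -> algC))) : seq {set Mpair gT} :=
  flatten [seq [seq Melt p.1 f | f <- p.2] | p <- cd].

Lemma Melts_complete (cd : seq (gT * seq (gT -> algC))) :
  foldr (fun p P => complete_irr p.1 p.2 /\ P) True cd ->
  pairwise (fun x y => ~~ [exists h, x == (y ^ h)%g]) (map fst cd) ->
  (forall y, exists2 x, x \in map fst cd & exists h, y = (x ^ h)%g) ->
  uniq (Melts cd) /\ Mgrp gT =i Melts cd.
Proof.
move=> cdP cd_conj cover.
have [Lu LM ML] : [/\ uniq (Melts cd),
    forall A, A \in Melts cd -> exists x f,
      [/\ x \in map fst cd, irr_on 'C[x]%G f & A = Melt x f] &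
    forall x (i : Iirr 'C[x]%G), x \in map fst cd -> Melt x 'chi_i \in Melts cd].
  elim: cd cdP cd_conj {cover} => [|[x fs] cd IH] //= [[fsI fsC fsD] cdP] /andP[x_cd cd_conj].
  have [Lu LM ML] := IH cdP cd_conj.
  have memE A : A \in [seq Melt x f | f <- fs] ->
      exists2 a, (a < size fs)%N & A = Melt x (nth (fun=> 0) fs a).
    move=> /(nthP set0)[a]; rewrite size_map => aP <-; exists a => //.
    by rewrite (nth_map (fun=> 0)).
  rewrite /Melts /= -/(Melts cd); split=> [|A|y i].
  - rewrite cat_uniq Lu andbT; apply/andP; split.
      apply/(uniqP set0) => a b; rewrite !inE size_map => aP bP.
      rewrite !(nth_map (fun=> 0)) // => /(Melt_eq (fsI a aP))[_ /(_ erefl)].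
      exact: fsD.
    apply/hasPn => A /LM[y [f [ycd fI ->]]]; apply/negP => /memE[a aP E].
    have [[h yE] _] := Melt_eq (fsI a aP) (esym E).
    by have /allP/(_ _ ycd)/existsPn/(_ h)/eqP := x_cd.
  - rewrite mem_cat => /orP[/memE[a aP ->]|/LM[y [f [ycd fI ->]]]].
      by exists x, (nth (fun=> 0) fs a); rewrite mem_head; split=> //; apply: fsI.
    by exists y, f; rewrite in_cons ycd orbT.
  rewrite in_cons mem_cat => /orP[/eqP E|ycd]; last by rewrite ML ?orbT.
  subst y; have [a aP chiE] := fsC i; apply/orP; left.
  have -> : Melt x 'chi_i = Melt x (nth (fun=> 0) fs a).
    rewrite (Melt_class chiE); exact: Melt_class.
  by apply/(nthP set0); exists a; rewrite ?size_map // (nth_map (fun=> 0)).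
split=> // A; apply/idP/idP => [/imsetP[p _ ->]|/LM[x [f [_ fI ->]]]].
  have [x xcd [h pE]] := cover (tag p).
  by rewrite -/(Mclass p); have [i ->] := Mclass_Melt pE; apply: ML.
exact: Melt_in.
Qed.

End MSet.

(** * Tables with lists of positions *)

Lemma uniq_map_inj (T T' : eqType) (f : T -> T') (s : seq T) :
  uniq (map f s) -> {in s &, injective f}.
Proof.
move=> us x y xs ys fxy.
have E : index x s = index y s.
  apply/eqP; rewrite -(nth_uniq (f x) _ _ us) ?size_map ?index_mem //.
  by rewrite !(nth_map x) ?index_mem // !nth_index // fxy.
by rewrite -(nth_index x xs) E nth_index.
Qed.

(** Rows of the table and series are given by the positions of their elements
    in a list of all elements of M; the series meets each row at most once. *)
Section Table.
Variables (gT : finGroupType) (L : seq {set Mpair gT}).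
Hypotheses (Lu : uniq L) (LM : Mgrp gT =i L).

Definition at_pos (s : seq nat) : seq {set Mpair gT} := [seq nth set0 L a | a <- s].

Definition row_meets (rows : seq (seq nat)) (s : seq nat) : bool :=
  all (fun r => size [seq a <- r | a \in s] <= 1)%N rows.

Lemma table_series (t : alpha_table gT) (rows : seq (seq nat)) (s : seq nat)
    (g : {set {set Mpair gT}}) :
  uniq (map fst t) -> map snd t = map at_pos rows ->
  all (fun r => all (fun a => a < size L)%N r) rows -> all (fun a => a < size L)%N s ->
  all (fun a => has (fun r => a \in r) rows) s -> row_meets rows s ->
  g =i at_pos s ->
  [/\ g \subset Mgrp gT,
      {in g, forall m, table_alpha t m \in [set:: map fst t]} &
      {in g &, injective (table_alpha t)}].
Proof.
move=> keys_u tE rowsL sL s_rows /allP s_meets gE.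
have in_row m : m \in g -> has (fun r : _ * seq {set Mpair gT} => m \in r.2) t.
  rewrite gE => /mapP[a sa ->]; have /hasP[r rr ar] := allP s_rows a sa.
  have : at_pos r \in map snd t by rewrite tE map_f.
  by move=> /mapP[k kt kE]; apply/hasP; exists k; rewrite // -kE map_f.
have alphaE m : m \in g -> exists2 k, k \in t & m \in k.2 /\ table_alpha t m = k.1.
  move=> mg; rewrite /table_alpha.
  have [] := head_filter ((set0, set0), [::]) (in_row m mg).
  by set k := head _ _; exists k.
split.
- apply/subsetP => m; rewrite gE LM => /mapP[a sa ->]; apply: mem_nth.
  exact: (allP sL).
- by move=> m /alphaE[k kt [_ ->]]; rewrite inE map_f.
move=> m m' mg m'g; have [k kt [mk ->]] := alphaE m mg.
have [k' kt' [mk' ->]] := alphaE m' m'g.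
move=> E; have {k' kt' E} mk' : m' \in k.2.
  by rewrite (uniq_map_inj keys_u kt kt' E).
have /mapP[r rr kE] : k.2 \in map at_pos rows by rewrite -tE map_f.
move: mg m'g mk mk'; rewrite !gE kE => /mapP[a sa ->] /mapP[b sb ->].
have pos_in c : c \in s -> nth set0 L c \in at_pos r -> c \in r.
  move=> sc /mapP[d rd /eqP]; rewrite nth_uniq //; first by move=> /eqP->.
    exact: (allP sL).
  by have /allP/(_ _ rr)/allP/(_ _ rd) := rowsL.
move=> /(pos_in a sa) ra /(pos_in b sb) rb; have := s_meets r rr.
have : a \in [seq c <- r | c \in s] by rewrite mem_filter sa.
have : b \in [seq c <- r | c \in s] by rewrite mem_filter sb.
by case: [seq c <- r | c \in s] => [//|c [|//]]; rewrite !inE => /eqP-> /eqP->.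
Qed.

End Table.

(** * Characters of centralizers in symmetric groups *)

Section SymmetricCharacters.
Variable n : nat.
Implicit Types (s x : {perm 'I_n.+1}) (f : {perm 'I_n.+1} -> algC) (c : seq nat -> int).

Notation id_code := (iota 0 n.+1).

Definition has_values f c : Prop := forall s, f s = (c (code s))%:~R.

Definition isum (T : Type) (F : T -> int) (s : seq T) : int :=
  foldr (fun y z => F y + z) 0 s.

Lemma isumE (T : Type) (F : T -> int) (r : seq T) : isum F r = \sum_(y <- r) F y.
Proof. by elim: r => [|y r IH]; rewrite ?big_nil // big_cons -IH. Qed.

Definition sgn_code (l : seq nat) : int := if inversions l then -1 else 1.
Definition lam1_code (l : seq nat) : int := (fix_code l)%:Z - 1.
Definition two_code (l : seq nat) : int := (fix_pairs_code l)%:Z - (fix_code l)%:Z.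
Definition lam2_code (l : seq nat) : int := lam1_code l ^+ 2 - (fix_pairs_code l)%:Z.
Definition neg_code (l : seq nat) : int := if odd (nth 0%N l 0) then -1 else 1.
Definition dih''_code (l : seq nat) : int := if (1 < nth 0%N l 0)%N then -1 else 1.
Definition refl3_code (l : seq nat) : int :=
  (count (fun j => (1 < j)%N && (nth 0%N l j == j)) id_code)%:Z - 1.
Definition dih_r_code (z l : seq nat) : int :=
  if l == id_code then 2 else if l == z then - 2%:Z else 0.

Lemma values_mul f g c d : has_values f c -> has_values g d ->
  has_values (f \* g) (fun l => c l * d l).
Proof. by move=> fc gd s; rewrite /= fc gd -rmorphM. Qed.

Lemma values_sub f g c d : has_values f c -> has_values g d ->
  has_values (fun s => f s - g s) (fun l => c l - d l).
Proof. by move=> fc gd s; rewrite fc gd -rmorphB. Qed.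

Lemma values_chi1 : has_values chi1 (fun=> 1).
Proof. by []. Qed.

Lemma values_sgn : sign_check n -> has_values sgn sgn_code.
Proof.
by move=> nP s; rewrite /sgn (odd_code _ nP) /sgn_code; case: inversions.
Qed.

Lemma values_pairs : has_values (fun s => (fixpairs s)%:R) (fun l => (fix_pairs_code l)%:Z).
Proof. by move=> s; rewrite fixpairs_code pmulrn. Qed.

Lemma values_lam1 : has_values lam1 lam1_code.
Proof. by move=> s; rewrite /lam1 fixpts_code /lam1_code rmorphB /= pmulrn. Qed.

Lemma values_two : has_values chi_two two_code.
Proof.
by move=> s; rewrite /chi_two fixpts_code fixpairs_code /two_code rmorphB /= !pmulrn.
Qed.

Lemma values_neg : has_values (cych (-1)) neg_code.
Proof.
move=> s; rewrite /cych /neg_code -signr_odd -(nth_code s (inord 0)) inordK //.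
by case: odd.
Qed.

Lemma values_dih'' : has_values dih'' dih''_code.
Proof.
move=> s; rewrite /dih'' /dih''_code -(nth_code s (inord 0)) inordK //.
by case: (1 < _)%N.
Qed.

Lemma values_refl3 : has_values refl3 refl3_code.
Proof.
move=> s; rewrite /refl3 /refl3_code rmorphB pmulrn; congr (_%:~R - _).
rewrite cardsE -sum1_card -sum1_count -[id_code]/(index_iota 0 n.+1) big_mkord.
by congr Posz; apply: eq_bigl => j; rewrite nth_code.
Qed.

Lemma values_dih_r : has_values dih_r (dih_r_code (code (@g2' n))).
Proof.
move=> s; rewrite /dih_r /dih_r_code -(inj_eq (@code_inj n)) code1.
by case: ifP => // _; rewrite -(inj_eq (@code_inj n)); case: ifP.
Qed.

(** The symmetric square of the reflection representation has the character of the
    permutation representation on pairs, so [lam2], the exterior square, is a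
    virtual character. *)
Definition lam2_check : bool :=
  all (fun l => lam2_code l *+ 2 == lam1_code l ^+ 2 - lam1_code (compose l l)) (all_codes n).

Lemma values_lam2 : lam2_check -> has_values lam2 lam2_code.
Proof.
move=> /allP ck s; rewrite /lam2 !values_lam1 codeM.
have /eqP E := ck _ (code_in s).
apply: (mulIf (_ : 2 != 0 :> algC)); rewrite ?pnatr_eq0 // divfK ?pnatr_eq0 //.
by rewrite -rmorphXn -rmorphB -E rmorphMn mulr_natr.
Qed.

(** ** Linear characters *)

Definition lin_on x f : Prop :=
  f 1%g = 1 /\ {in 'C[x]%g &, {morph f : s t / (s * t)%g >-> s * t}}.

Lemma lin_on_irr x f : lin_on x f -> irr_on 'C[x]%G f.
Proof. by case=> f1 fM; apply: lin_irr_on. Qed.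

Lemma lin_on_chi1 x : lin_on x chi1.
Proof. by split=> // s t _ _; rewrite /chi1 mulr1. Qed.

Lemma lin_on_sgn x : lin_on x sgn.
Proof.
by split=> [|s t _ _]; rewrite /sgn ?odd_perm1 // odd_permM signr_addb.
Qed.

Lemma lin_on_mul x f g : lin_on x f -> lin_on x g -> lin_on x (f \* g).
Proof.
move=> [f1 fM] [g1 gM]; split=> [|s t sC tC]; first by rewrite /= f1 g1 mulr1.
by rewrite /= fM // gM // mulrACA.
Qed.

Definition additive_check (z : seq nat) (m : nat) : bool :=
  allrel (fun l k => nth 0%N (compose l k) 0 == ((nth 0 l 0 + nth 0 k 0) %% m)%N)
    (cent_codes n z) (cent_codes n z).

Lemma lin_on_cych x m (w : algC) : additive_check (code x) m -> w ^+ m = 1 ->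
  lin_on x (cych w).
Proof.
move=> ck wm; split=> [|s t sC tC]; first by rewrite /cych perm1 inordK.
have /eqP := cent_all2 ck sC tC; rewrite -codeM /cych.
rewrite -(nth_code _ (inord 0)) -!(nth_code _ (inord 0 : 'I_n.+1)) !inordK // => ->.
by rewrite -exprD (expr_mod _ wm).
Qed.

Definition mult_check (z : seq nat) c : bool :=
  (c id_code == 1) &&
  allrel (fun l k => c (compose l k) == c l * c k) (cent_codes n z) (cent_codes n z).

Lemma lin_on_values x f c : has_values f c -> mult_check (code x) c -> lin_on x f.
Proof.
move=> fc /andP[/eqP c1 ck]; split=> [|s t sC tC]; first by rewrite fc code1 c1.
by have /eqP := cent_all2 ck sC tC; rewrite !fc -codeM => ->; rewrite rmorphM.
Qed.

(** ** Virtual characters of norm 1 *)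

Lemma vchar_values x f g c d : has_values f c -> has_values g d ->
  all (fun l => c l == d l) (cent_codes n (code x)) ->
  vchar_on 'C[x]%G f -> vchar_on 'C[x]%G g.
Proof.
move=> fc gd ck; apply: eq_vchar_on => s sC; rewrite fc gd.
by have /eqP -> := cent_all ck sC.
Qed.

Definition norm_check (z : seq nat) c : bool :=
  (isum (fun l => c l * c l) (cent_codes n z) == size (cent_codes n z)) && (0 < c id_code).

Lemma irr_on_values x f c : has_values f c -> vchar_on 'C[x]%G f ->
  norm_check (code x) c -> irr_on 'C[x]%G f.
Proof.
move=> fc vf /andP[/eqP nc c1].
apply: (irr_on_norm (c := fun s => c (code s)) vf) => [s _||]; first exact: fc.
  rewrite (sum_cent (fun l => c l ^+ 2)) card_cent -nc isumE.
  by apply: eq_bigr => l _; rewrite expr2.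
by rewrite code1.
Qed.

Lemma vchar_lam1 x : vchar_on 'C[x]%G lam1.
Proof. exact: vchar_onB (fixpts_vchar _) (vchar_on1 _). Qed.

Lemma vchar_two x : vchar_on 'C[x]%G chi_two.
Proof. exact: vchar_onB (fixpairs_vchar _) (fixpts_vchar _). Qed.

Lemma vchar_lam2 x : lam2_check -> vchar_on 'C[x]%G lam2.
Proof.
move=> ck; apply: eq_vchar_on (vchar_onB (vchar_onM (vchar_lam1 x) (vchar_lam1 x))
                                (fixpairs_vchar _)) => s _.
rewrite (values_lam2 ck) /lam2_code rmorphB rmorphXn /= -values_lam1 expr2.
by rewrite values_pairs.
Qed.

(** ** Completeness *)

Lemma complete_regular x (fs : seq ({perm 'I_n.+1} -> algC)) :
  (forall a, (a < size fs)%N -> irr_on 'C[x]%G (nth (fun=> 0) fs a)) ->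
  (forall s, s \in 'C[x]%g ->
     \sum_(f <- fs) f 1%g * f s = (size (cent_codes n (code x)) * (code s == id_code))%:R) ->
  complete_irr x fs.
Proof.
move=> fsI reg; have [fsC fsD] : (forall i : Iirr 'C[x]%G, exists2 a, (a < size fs)%N &
      {in 'C[x]%G, 'chi_i =1 nth (fun=> 0) fs a}) /\
  (forall a b, (a < size fs)%N -> (b < size fs)%N ->
     {in 'C[x]%G, nth (fun=> 0) fs a =1 nth (fun=> 0) fs b} -> a = b).
  apply: irr_list_complete => // s sC; rewrite reg // card_cent.
  by rewrite -code1 (inj_eq (@code_inj n)).
by split.
Qed.

(** The sum of the characters, weighted by their degrees, is the regular
    character. *)
Definition regular_check (z : seq nat) (cs : seq (seq nat -> int)) : bool :=
  all (fun l => isum (fun c : seq nat -> int => c id_code * c l) cs ==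
                (size (cent_codes n z) * (l == id_code))%N) (cent_codes n z).

Lemma complete_values x (fs : seq ({perm 'I_n.+1} -> algC)) cs :
  size fs = size cs ->
  (forall a, (a < size fs)%N -> has_values (nth (fun=> 0) fs a) (nth (fun=> 0) cs a)) ->
  (forall a, (a < size fs)%N -> irr_on 'C[x]%G (nth (fun=> 0) fs a)) ->
  regular_check (code x) cs -> complete_irr x fs.
Proof.
move=> sz fc fsI ck; apply: complete_regular => // s sC.
have /eqP E := cent_all ck sC; rewrite pmulrn -E isumE.
rewrite (big_nth (fun=> 0)) [in RHS](big_nth (fun=> 0)) -sz rmorph_sum.
by apply: eq_big_nat => a /andP[_ aP]; rewrite !(fc a aP) code1 rmorphM.
Qed.

End SymmetricCharacters.

(** ** Cycles and conjugacy classes *)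

Section Classes.
Variable n : nat.
Implicit Types (x y : {perm 'I_n.+1}).

(** The same product of transpositions as in [gcyc]. *)
Definition cycle_code (m : nat) : seq nat :=
  foldr (fun k l => compose (swap_code n 0 k) l) (iota 0 n.+1) (index_iota 1 m).

Lemma code_gcyc m : (m <= n.+1)%N -> code (@gcyc n m) = cycle_code m.
Proof.
rewrite /gcyc /cycle_code => mn; have : all (fun k => k <= n)%N (index_iota 1 m).
  by apply/allP => k; rewrite mem_index_iota => /andP[_ km]; rewrite -ltnS (leq_trans km).
elim: (index_iota 1 m) => [|k ks IH] /=; first by rewrite big_nil code1.
by move=> /andP[kn /IH {}IH]; rewrite big_cons codeM IH code_tperm_inord.
Qed.

Lemma code_g2' : (2 < n)%N ->
  code (@g2' n) = compose (swap_code n 0 1) (swap_code n 2 3).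
Proof. by move=> n2; rewrite /g2' codeM !code_tperm_inord //; lia. Qed.

Lemma code_g6 : (3 < n)%N -> code (@g6 n) = compose (cycle_code 3) (swap_code n 3 4).
Proof. by move=> n3; rewrite /g6 codeM code_gcyc ?code_tperm_inord //; lia. Qed.

Lemma conj_code x y h : (x == (y ^ h)%g) = (compose (code h) (code x) == compose (code y) (code h)).
Proof.
rewrite -!codeM (inj_eq (@code_inj n)); apply/eqP/eqP => [->|E].
  by rewrite conjgE mulKVg.
by rewrite conjgE -E mulKg.
Qed.

Definition conj_codes (l z : seq nat) : bool :=
  has (fun h => compose h l == compose z h) (all_codes n).

Lemma conj_codesP x y : conj_codes (code x) (code y) = [exists h, x == (y ^ h)%g].
Proof.
apply/hasP/existsP => [[l /code_onto[h <-] E]|[h E]].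
  by exists h; rewrite conj_code.
by exists (code h); rewrite ?code_in // -conj_code.
Qed.

Definition classes_check (zs : seq (seq nat)) : bool :=
  pairwise (fun l z => ~~ conj_codes l z) zs &&
  all (fun l => has (conj_codes l) zs) (all_codes n).

Lemma classesP (xs : seq {perm 'I_n.+1}) : classes_check (map (@code n) xs) ->
  pairwise (fun x y => ~~ [exists h, x == (y ^ h)%g]) xs /\
  forall y, exists2 x, x \in xs & exists h, y = (x ^ h)%g.
Proof.
move=> /andP[sep /allP cov]; split=> [|y].
  by move: sep; rewrite pairwise_map; apply: sub_pairwise => x y; rewrite /= conj_codesP.
have := cov _ (code_in y); rewrite has_map => /hasP[x x_xs].
by rewrite /= conj_codesP => /existsP[h /eqP yE]; exists x => //; exists h.
Qed.

(** ** Subgroups *)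

Definition on_code (P : pred nat) (l : seq nat) : bool :=
  all (fun j => (nth 0%N l j != j) ==> P j) (iota 0 n.+1).

Lemma Sym_code (P : pred nat) x : (x \in perm.Sym [set j : 'I_n.+1 | P j]) = on_code P (code x).
Proof.
rewrite inE; apply/subsetP/allP => [xP j|xP j].
  rewrite mem_iota => /andP[_ jn]; pose o := Ordinal (jn : (j < n.+1)%N).
  rewrite -[j]/(val o) nth_code; apply/implyP => xo.
  by have := xP o; rewrite !inE => ->.
rewrite !inE => xj; have := xP j; rewrite mem_iota ltn_ord nth_code => /(_ isT)/implyP -> //.
Qed.

Definition has_code (A : {set {perm 'I_n.+1}}) (P : pred (seq nat)) : Prop :=
  forall x, (x \in A) = P (code x).

Lemma has_code_Hone : has_code Hone (pred1 (iota 0 n.+1)).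
Proof. by move=> x; rewrite inE -(inj_eq (@code_inj n)) code1. Qed.

Lemma has_code_Hfirst k : has_code (Hfirst k) (on_code (fun j => j < k)%N).
Proof. by move=> x; apply: (Sym_code (fun j => j < k)%N). Qed.

Lemma has_code_H2 : has_code H2 (on_code (fun j => n <= j.+1)%N).
Proof. by move=> x; apply: (Sym_code (fun j => n <= j.+1)%N). Qed.

Lemma has_code_mul A B P Q : has_code A P -> has_code B Q ->
  has_code (A * B)%g (fun l => has (fun a => P a && has (fun b => Q b && (compose a b == l))
     (all_codes n)) (all_codes n)).
Proof.
move=> AP BQ x; apply/mulsgP/hasP => [[a b aA bB ->]|[l /code_onto[a <-] /andP[aA]]].
  exists (code a); first exact: code_in.
  rewrite -AP aA; apply/hasP; exists (code b); first exact: code_in.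
  by rewrite -BQ bB codeM eqxx.
move=> /hasP[m /code_onto[b <-] /andP[bB]]; rewrite -codeM (inj_eq (@code_inj n)) => /eqP <-.
by exists a b; rewrite ?AP ?BQ.
Qed.

End Classes.

(** * Series given by positions *)

Section Exceptional.
Variable gT : finGroupType.

Definition rest_pos (N : nat) (sers : seq (seq nat)) : seq nat :=
  [seq a <- iota 0 N | a \notin flatten sers].

Lemma rest_series (L : seq {set Mpair gT}) (sers : seq (seq nat)) :
  uniq L -> Mgrp gT =i L -> all (all (fun a => a < size L)%N) sers ->
  Mgrp gT :\: \bigcup_(A <- [seq [set:: at_pos L r] | r <- sers]) A =i
  at_pos L (rest_pos (size L) sers).
Proof.
move=> Lu LM sersL m; rewrite inE LM big_map.
have -> : (m \in \bigcup_(r <- sers) [set:: at_pos L r]) = (m \in at_pos L (flatten sers)).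
  elim: (sers) => [|r s IH]; first by rewrite big_nil inE.
  by rewrite big_cons inE IH inE /at_pos /= map_cat mem_cat.
apply/andP/mapP => [[mN mL]|[a]].
  exists (index m L); last by rewrite nth_index.
  rewrite mem_filter mem_iota /= index_mem mL andbT.
  by apply: contra mN => mi; apply/mapP; exists (index m L); rewrite ?nth_index.
rewrite mem_filter mem_iota /= => /andP[aN aL] ->; split; last exact: mem_nth.
apply: contra aN => /mapP[b bS /eqP]; rewrite nth_uniq //; first by move=> /eqP ->.
by have /flattenP[r rs br] := bS; apply: (allP (allP sersL r rs)).
Qed.

Lemma with_rest_pos (L : seq {set Mpair gT}) (sers : seq (seq nat)) s g :
  uniq L -> Mgrp gT =i L -> all (all (fun a => a < size L)%N) sers ->
  s = [seq [set:: at_pos L r] | r <- sers] -> g \in [set:: with_rest s] ->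
  exists2 r, r \in rest_pos (size L) sers :: sers & g =i at_pos L r.
Proof.
move=> Lu LM sersL ->; rewrite inE in_cons => /orP[/eqP->|/mapP[r rs ->]].
  exists (rest_pos (size L) sers); rewrite ?mem_head //; exact: rest_series.
by exists r => [|m]; rewrite ?inE ?rs ?orbT.
Qed.

Lemma alone_pos (L : seq {set Mpair gT}) (s : seq nat) :
  alone (at_pos L s) = [seq [set:: at_pos L r] | r <- [seq [:: a] | a <- s]].
Proof.
rewrite /alone /at_pos -!map_comp; apply: eq_map => a /=.
by apply/setP => m; rewrite !inE.
Qed.

Definition series_check (N : nat) (rows sers : seq (seq nat)) : bool :=
  all (all (fun a => a < N)%N) rows &&
  all (fun s => [&& all (fun a => a < N)%N s, all (fun a => has (fun r => a \in r) rows) s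
                  & row_meets rows s]) sers.

Lemma exceptional_bijection (L : seq {set Mpair gT}) (t : alpha_table gT)
    (rows sers : seq (seq nat)) (g : {set {set Mpair gT}}) s :
  uniq L -> Mgrp gT =i L -> uniq (map fst t) -> map snd t = map (at_pos L) rows ->
  series_check (size L) rows sers -> (exists2 r, r \in sers & g =i at_pos L r) ->
  exists Phi : {h | h \in @Hbar_gamma (dataExc t s) g} -> {m | m \in g},
    (forall h, @alpha_fibre (dataExc t s) (val h) :&: g = [set val (Phi h)]) /\ bijective Phi.
Proof.
move=> Lu LM tu tE /andP[rowsL /allP sersP] [r /sersP/and3P[rL r_rows r_meets] gE].
have [gM gH gI] := table_series Lu LM tu tE rowsL rL r_rows r_meets gE.
exact: (@series_bijection (dataExc t s) g).
Qed.

End Exceptional.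

(** * Centralizers with linear characters *)

Lemma sum_prim_root (m a : nat) (w : algC) : m.-primitive_root w ->
  \sum_(j <- iota 0 m) (w ^+ j) ^+ a = (m * (m %| a))%:R.
Proof.
move=> wP; have -> : iota 0 m = index_iota 0 m by rewrite /index_iota subn0.
rewrite big_mkord.
rewrite (eq_bigr (fun j : 'I_m => (w ^+ a) ^+ j)) => [|j _]; last by rewrite exprAC.
have wm : (w ^+ a) ^+ m = 1 by rewrite exprAC (prim_expr_order wP) expr1n.
case: (boolP (m %| a)%N) => ma.
  have -> : w ^+ a = 1 by apply/eqP; rewrite -(prim_order_dvd wP).
  by under eq_bigr do rewrite expr1n; rewrite sumr_const card_ord muln1.
have w1 : w ^+ a - 1 != 0 by rewrite subr_eq0 -(prim_order_dvd wP).
rewrite muln0; apply: (mulfI w1).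
by rewrite -subrX1 wm subrr mulr0.
Qed.

Section Cyclic.
Variables (n : nat) (x : {perm 'I_n.+1}).

Lemma eq_irr_on (f g : {perm 'I_n.+1} -> algC) : f =1 g -> irr_on 'C[x]%G f -> irr_on 'C[x]%G g.
Proof. by move=> fg [i fi]; exists i => s sC; rewrite fi ?fg. Qed.

Lemma cych1 : @cych n 1 =1 chi1.
Proof. by move=> s; rewrite /cych expr1n. Qed.

Lemma cych_at1 w : @cych n w 1%g = 1.
Proof. by rewrite /cych perm1 inordK. Qed.

Lemma cych_code (w : algC) s : @cych n w s = w ^+ nth 0%N (code s) 0.
Proof. by rewrite /cych -(nth_code s (inord 0)) inordK. Qed.

(** The image of 0 identifies the centralizer with Z/m. *)
Definition cyclic_check (z : seq nat) (m : nat) : bool :=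
  [&& size (cent_codes n z) == m, additive_check n z m &
      all (fun l => (nth 0%N l 0 < m)%N && ((l == iota 0 n.+1) == (nth 0%N l 0 == 0%N)))
        (cent_codes n z)].

(** The characters of a cyclic group are the powers of a faithful one, and the sum
    of the powers of a primitive root of 1 gives the regular character. *)
Lemma complete_cyclic m w (fs : seq ({perm 'I_n.+1} -> algC)) (js : seq nat) :
  m.-primitive_root w -> cyclic_check (code x) m -> perm_eq js (iota 0 m) ->
  size fs = size js ->
  (forall a, (a < size fs)%N -> nth (fun=> 0) fs a =1 cych (w ^+ nth 0%N js a)) ->
  complete_irr x fs.
Proof.
move=> wP /and3P[/eqP szC addC ck] jsP szf fE; have wm := prim_expr_order wP.
apply: complete_regular => [a aP|s sC].
  apply: eq_irr_on (fun s => esym (fE a aP s)) _.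
  by apply/lin_on_irr/(lin_on_cych addC); rewrite exprAC wm expr1n.
have /andP[am /eqP aE] := cent_all ck sC; rewrite szC aE.
set a := nth 0%N _ 0 in am *.
have -> : \sum_(f <- fs) f 1%g * f s = \sum_(j <- js) (w ^+ j) ^+ a.
  rewrite (big_nth (fun=> 0)) [RHS](big_nth 0%N) -szf; apply: eq_big_nat => b /andP[_ bP].
  by rewrite !(fE b bP) cych_at1 mul1r cych_code.
rewrite (perm_big _ jsP) sum_prim_root //; congr (_ * _)%:R.
by case: (a) am => [|b] am; [rewrite dvdn0 | rewrite gtnNdvd].
Qed.

Definition twisted_check (z : seq nat) : bool :=
  [&& sign_check n, size (cent_codes n z) == 6%N, additive_check n z 3 &
      all (fun l => (nth 0%N l 0 < 3)%N &&
        ((l == iota 0 n.+1) == (nth 0%N l 0 == 0%N) && ~~ inversions l))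
        (cent_codes n z)].

(** The image of 0 and the sign identify the centralizer with the product of Z/3 and
    a group of order 2. *)
Lemma complete_twisted theta : 3.-primitive_root theta -> twisted_check (code x) ->
  complete_irr x [:: chi1; cych theta; cych (theta ^+ 2);
    sgn; sgn \* cych theta; sgn \* cych (theta ^+ 2)].
Proof.
move=> tP /and4P[sC /eqP szC addC ck]; have t3 := prim_expr_order tP.
have l1 := lin_on_cych addC t3.
have l2 : lin_on x (cych (theta ^+ 2)) by apply: (lin_on_cych addC); rewrite exprAC t3 expr1n.
have lS := lin_on_sgn x.
apply: complete_regular => [[|[|[|[|[|[|//]]]]]] /= _|s xC].
- exact/lin_on_irr/lin_on_chi1.
- exact: lin_on_irr.
- exact: lin_on_irr.
- exact: lin_on_irr.
- exact/lin_on_irr/lin_on_mul.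
- exact/lin_on_irr/lin_on_mul.
have /andP[am /eqP aE] := cent_all ck xC; rewrite szC aE.
rewrite !big_cons big_nil /= !cych_at1 /chi1 /sgn odd_perm1 expr0 !mul1r addr0.
rewrite !cych_code (odd_code _ sC); set a := nth 0%N _ 0 in am *.
have := sum_prim_root a tP; rewrite /= !big_cons big_nil /= addr0 !expr0 expr1n expr1.
have -> : (3 %| a)%N = (a == 0%N) by case: (a) am => [|[|[|]]].
move: (theta ^+ a) ((theta ^+ 2) ^+ a) => u v E.
case: (inversions _); rewrite ?expr0 ?expr1 ?mul1r ?mulN1r /= ?andbF ?andbT.
  by rewrite muln0; ring.
have -> : (6 * (a == 0) = 3 * (a == 0) + 3 * (a == 0))%N by rewrite -mulnDl.
by rewrite natrD -E; ring.
Qed.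

End Cyclic.

Lemma complete_cube_root n (x : {perm 'I_n.+1}) (theta : algC) : 3.-primitive_root theta ->
  cyclic_check n (code x) 3 -> complete_irr x [:: chi1; cych theta; cych (theta ^+ 2)].
Proof.
move=> tP ck; apply: (complete_cyclic tP ck (js := iota 0 3)) => // -[|[|[|//]]] _ s /=.
- by rewrite expr0 cych1.
- by rewrite expr1.
by [].
Qed.

Lemma complete_fourth_root n (x : {perm 'I_n.+1}) (i : algC) : 4.-primitive_root i ->
  cyclic_check n (code x) 4 -> complete_irr x [:: chi1; cych (-1); cych i; cych (- i)].
Proof.
move=> iP ck; have i2 : i ^+ 2 = -1.
  have /eqP : (i ^+ 2) ^+ 2 = 1 by rewrite -exprM (prim_expr_order iP).
  by rewrite sqrf_eq1 -(prim_order_dvd iP) /= => /eqP.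
apply: (complete_cyclic iP ck (js := [:: 0; 2; 1; 3]%N)) => // -[|[|[|[|//]]]] _ s /=.
- by rewrite expr0 cych1.
- by rewrite i2.
- by rewrite expr1.
by rewrite exprS i2 mulrN1.
Qed.

(** * The exceptional groups *)

Lemma Melts_check n (cd : seq ({perm 'I_n.+1} * seq ({perm 'I_n.+1} -> algC))) zs :
  map (@code n) (map fst cd) = zs -> classes_check n zs ->
  foldr (fun p P => complete_irr p.1 p.2 /\ P) True cd ->
  uniq (Melts cd) /\ Mgrp {perm 'I_n.+1} =i Melts cd.
Proof. by move=> <- /classesP[sep cov] cdP; apply: Melts_complete. Qed.

(** ** S_1 *)

Definition classes_S1 : seq ({perm 'I_1} * seq ({perm 'I_1} -> algC)) :=
  [:: (1%g, [:: chi1])].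

Lemma Melts_S1 : uniq (Melts classes_S1) /\ Mgrp {perm 'I_1} =i Melts classes_S1.
Proof.
apply: (@Melts_check 0 _ [:: iota 0 1]); first by rewrite /= code1.
  by vm_compute.
split=> //; apply: (@complete_values _ _ _ [:: fun=> 1]) => //.
- by case=> [|//] _ /=; apply: values_chi1.
- by case=> [|//] _ /=; apply/lin_on_irr/lin_on_chi1.
by rewrite code1; vm_compute.
Qed.

Lemma bijection_S1 (g : {set Mtype dataS1}) : g \in HCseries dataS1 ->
  exists Phi : {h | h \in Hbar_gamma g} -> {m | m \in g},
    (forall h, alpha_fibre (val h) :&: g = [set val (Phi h)]) /\ bijective Phi.
Proof.
have [Lu LM] := Melts_S1; rewrite inE => /predU1P[->|//].
apply: (exceptional_bijection (rows := [:: [:: 0%N]]) (sers := [:: [:: 0%N]]) _ Lu LM) => //.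
by exists [:: 0%N] => // m; rewrite LM.
Qed.

(** ** S_2 *)

Definition classes_S2 : seq ({perm 'I_2} * seq ({perm 'I_2} -> algC)) :=
  [:: (1%g, [:: chi1; sgn]); (gcyc 2, [:: chi1; sgn])].

Lemma Melts_S2 : uniq (Melts classes_S2) /\ Mgrp {perm 'I_2} =i Melts classes_S2.
Proof.
apply: (@Melts_check 1 _ [:: iota 0 2; cycle_code 1 2]).
- by rewrite /= code1 code_gcyc.
- by vm_compute.
have sC : sign_check 1 by vm_compute.
have key (x : {perm 'I_2}) : regular_check 1 (code x) [:: fun=> 1; sgn_code] ->
    complete_irr x [:: chi1; sgn].
  move=> ck; apply: (@complete_values _ _ _ [:: fun=> 1; sgn_code]) => //.
    by case=> [|[|//]] _ /=; [apply: values_chi1 | apply: values_sgn].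
  by case=> [|[|//]] _ /=; apply: lin_on_irr; [apply: lin_on_chi1 | apply: lin_on_sgn].
by split; [|split=> //]; apply: key; rewrite /= ?code1 ?code_gcyc //; vm_compute.
Qed.

(** Subgroups are told apart by a few of their elements. *)
Lemma keys_uniq (T : finType) (gs : seq T) (ks : seq ({set T} * {set T})) :
  let test (A : {set T}) := [seq g \in A | g <- gs] in
  uniq [seq (test k.1, test k.2) | k <- ks] -> uniq ks.
Proof. exact: map_uniq. Qed.

Lemma has_code_seq n (A : {set {perm 'I_n.+1}}) P gs : has_code A P ->
  [seq g \in A | g <- gs] = map P (map (@code n) gs).
Proof. by move=> AP; rewrite -map_comp; apply: eq_map => g; apply: AP. Qed.

Lemma keys_S2 : uniq (map fst tableS2).
Proof.
apply: (keys_uniq (gs := [:: gcyc 2])); rewrite [map _ (map _ _)]/=.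
by rewrite !has_code_Hone !has_code_H2 code_gcyc.
Qed.

Lemma bijection_S2_3 (g : {set Mtype dataS2_3}) : g \in HCseries dataS2_3 ->
  exists Phi : {h | h \in Hbar_gamma g} -> {m | m \in g},
    (forall h, alpha_fibre (val h) :&: g = [set val (Phi h)]) /\ bijective Phi.
Proof.
have [Lu LM] := Melts_S2; pose L := Melts classes_S2.
(* Positions 0 to 3 are (1, 1), (1, epsilon), (g_2, 1), (g_2, epsilon). *)
rewrite inE => gs; have {gs} : g \in [seq [set:: at_pos L r] | r <- [:: [:: 0; 2; 1]; [:: 3]]%N].
  move: gs; rewrite !inE => /orP[/eqP->|/eqP->]; first by rewrite eqxx.
  by apply/orP; right; apply/eqP/setP => m; rewrite !inE.
case/mapP => r r_in ->.
apply: (exceptional_bijection (rows := [:: [:: 0; 3]; [:: 2]; [:: 1]]%N)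
  (sers := [:: [:: 0; 2; 1]; [:: 3]]%N) _ Lu LM keys_S2) => //.
by exists r => // m; rewrite inE.
Qed.

Lemma bijection_S2_2 (g : {set Mtype dataS2_2}) : g \in HCseries dataS2_2 ->
  exists Phi : {h | h \in Hbar_gamma g} -> {m | m \in g},
    (forall h, alpha_fibre (val h) :&: g = [set val (Phi h)]) /\ bijective Phi.
Proof.
have [Lu LM] := Melts_S2; pose L := Melts classes_S2.
rewrite inE => gs; have {gs} : g \in [seq [set:: at_pos L r] | r <- [:: [:: 0; 2]; [:: 3]; [:: 1]]%N].
  move: gs; rewrite !inE => /or3P[] /eqP->; first by rewrite eqxx.
    by apply/orP; right; apply/orP; left; apply/eqP/setP => m; rewrite !inE.
  by apply/orP; right; apply/orP; right; apply/eqP/setP => m; rewrite !inE.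
case/mapP => r r_in ->.
apply: (exceptional_bijection (rows := [:: [:: 0; 3]; [:: 2]; [:: 1]]%N)
  (sers := [:: [:: 0; 2]; [:: 3]; [:: 1]]%N) _ Lu LM keys_S2) => //.
by exists r => // m; rewrite inE.
Qed.

(** ** S_3 *)

Section S3.
Variables (theta : algC) (tP : 3.-primitive_root theta).

Definition classes_S3 : seq ({perm 'I_3} * seq ({perm 'I_3} -> algC)) :=
  [:: (1%g, [:: chi1; lam1; sgn]); (gcyc 2, [:: chi1; sgn]);
      (gcyc 3, [:: chi1; cych theta; cych (theta ^+ 2)])].

Lemma Melts_S3 : uniq (Melts classes_S3) /\ Mgrp {perm 'I_3} =i Melts classes_S3.
Proof.
apply: (@Melts_check 2 _ [:: iota 0 3; cycle_code 2 2; cycle_code 2 3]).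
- by rewrite /= code1 !code_gcyc.
- by vm_compute.
have sC : sign_check 2 by vm_compute.
split; [|split; [|split=> //]].
- apply: (@complete_values _ _ _ [:: fun=> 1; lam1_code; sgn_code]) => //.
  + case=> [|[|[|//]]] _ /=; [exact: values_chi1 | exact: values_lam1 | exact: values_sgn].
  + case=> [|[|[|//]]] _ /=.
    * exact/lin_on_irr/lin_on_chi1.
    * by apply: (irr_on_values (@values_lam1 2) (vchar_lam1 _)); rewrite code1; vm_compute.
    * exact/lin_on_irr/lin_on_sgn.
  by rewrite code1; vm_compute.
- apply: (@complete_values _ _ _ [:: fun=> 1; sgn_code]) => //.
  + by case=> [|[|//]] _ /=; [apply: values_chi1 | apply: values_sgn].
  + by case=> [|[|//]] _ /=; apply: lin_on_irr; [apply: lin_on_chi1 | apply: lin_on_sgn].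
  by rewrite code_gcyc //; vm_compute.
by apply: (complete_cube_root tP); rewrite code_gcyc //; vm_compute.
Qed.

Lemma keys_S3 : uniq (map fst (tableS3 theta)).
Proof.
apply: (keys_uniq (gs := [:: gcyc 2; tperm (inord 1) (inord 2)])); rewrite [map _ (map _ _)]/=.
by rewrite !has_code_Hone !has_code_H2 !has_code_Hfirst code_gcyc // code_tperm_inord.
Qed.

(** The two families with group S_3 have the same table; ones lists the positions
    of the elements that form a series alone. *)
Lemma bijection_S3 (ones : seq nat)
    (g : {set Mtype (dataExc (tableS3 theta) (with_rest (alone (at_pos (Melts classes_S3) ones))))}) :
  let sers := [seq [:: a] | a <- ones] in
  all (all (fun a => a < 8)%N) sers ->
  series_check 8 [:: [:: 0; 6; 7]; [:: 5]; [:: 1; 4]; [:: 3]; [:: 2]]%N (rest_pos 8 sers :: sers) ->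
  g \in HCseries (dataExc (tableS3 theta) (with_rest (alone (at_pos (Melts classes_S3) ones)))) ->
  exists Phi : {h | h \in Hbar_gamma g} -> {m | m \in g},
    (forall h, alpha_fibre (val h) :&: g = [set val (Phi h)]) /\ bijective Phi.
Proof.
have [Lu LM] := Melts_S3 => sers sers8 ck gs.
apply: (exceptional_bijection _ Lu LM keys_S3 _ ck) => //.
by apply: (with_rest_pos Lu LM sers8 (alone_pos _ _)).
Qed.

End S3.

(** ** The subgroup of order 8 *)

Definition H22_code n (l : seq nat) : bool :=
  has (fun a => on_code n (fun j => j < 2)%N a &&
    has (fun b => on_code n (fun j => n <= j.+1)%N b && (compose a b == l)) (all_codes n))
    (all_codes n).

Definition H23_code n (l : seq nat) : bool :=
  has (fun a => on_code n (fun j => n <= j.+1)%N a &&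
    has (fun b => on_code n (fun j => j < 3)%N b && (compose a b == l)) (all_codes n))
    (all_codes n).

Lemma has_code_H22 n : has_code (@H22 n) (H22_code n).
Proof. exact: has_code_mul (@has_code_Hfirst n 2) (@has_code_H2 n). Qed.

Lemma has_code_H23 n : has_code (@H23 n) (H23_code n).
Proof. exact: has_code_mul (@has_code_H2 n) (@has_code_Hfirst n 3). Qed.

Definition H8_extra n : {perm 'I_n.+1} :=
  (tperm (inord 0) (inord n.-1) * tperm (inord 1) (inord n))%g.

(** The dihedral group of order 8 centralizes a product of two transpositions. *)
Definition H8_check n (z l : seq nat) : bool :=
  all (fun k => H22_code n k ==> (compose z k == compose k z)) (all_codes n) &&
  (compose z l == compose l z).

Lemma H8_cent n (x : {perm 'I_n.+1}) : H8_check n (code x) (code (H8_extra n)) ->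
  H8 \subset 'C[x]%g.
Proof.
move=> /andP[/allP ck22 ck]; rewrite gen_subG subUset sub1set cent1_code ck.
apply/subsetP => y; rewrite has_code_H22 cent1_code => yH.
by have /implyP -> := ck22 _ (code_in y).
Qed.

Lemma H8_extra_in n : H8_extra n \in H8.
Proof. by rewrite mem_gen // inE set11. Qed.

Lemma H22_H8 n : {subset @H22 n <= H8}.
Proof. by move=> g gH; rewrite mem_gen // inE gH orbT. Qed.

(** ** S_4 *)

Section S4.
Variables (i theta : algC).
Hypotheses (iP : 4.-primitive_root i) (tP : 3.-primitive_root theta).

Definition classes_S4 : seq ({perm 'I_4} * seq ({perm 'I_4} -> algC)) :=
  [:: (1%g, [:: chi1; chi_two; lam1; lam2; sgn]);
      (gcyc 2, [:: chi1; cych (-1); sgn; cych (-1) \* sgn]);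
      (g2', [:: chi1; dih'; dih_eps; dih''; dih_r]);
      (gcyc 3, [:: chi1; cych theta; cych (theta ^+ 2)]);
      (gcyc 4, [:: chi1; cych (-1); cych i; cych (- i)])].

Lemma Melts_S4 : uniq (Melts classes_S4) /\ Mgrp {perm 'I_4} =i Melts classes_S4.
Proof.
apply: (@Melts_check 3 _ [:: iota 0 4; cycle_code 3 2;
  compose (swap_code 3 0 1) (swap_code 3 2 3); cycle_code 3 3; cycle_code 3 4]).
- by rewrite /= code1 !code_gcyc // code_g2'.
- by vm_compute.
have sC : sign_check 3 by vm_compute.
have l2C : lam2_check 3 by vm_compute.
have vS := values_sgn sC.
split; [|split; [|split; [|split; [|split=> //]]]].
- apply: (@complete_values _ _ _ [:: fun=> 1; two_code; lam1_code; lam2_code; sgn_code]) => //.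
  + case=> [|[|[|[|[|//]]]]] _ /=; [exact: values_chi1 | exact: values_two |
      exact: values_lam1 | exact: values_lam2 | exact: vS].
  + case=> [|[|[|[|[|//]]]]] _ /=.
    * exact/lin_on_irr/lin_on_chi1.
    * by apply: (irr_on_values (@values_two 3) (vchar_two _)); rewrite code1; vm_compute.
    * by apply: (irr_on_values (@values_lam1 3) (vchar_lam1 _)); rewrite code1; vm_compute.
    * by apply: (irr_on_values (values_lam2 l2C) (vchar_lam2 _ l2C)); rewrite code1; vm_compute.
    * exact/lin_on_irr/lin_on_sgn.
  by rewrite code1; vm_compute.
- have lN : lin_on (gcyc 2 : {perm 'I_4}) (cych (-1)).
    by apply: (lin_on_values (@values_neg 3)); rewrite code_gcyc //; vm_compute.
  apply: (@complete_values _ _ _ [:: fun=> 1; neg_code; sgn_code;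
    fun l => neg_code l * sgn_code l]) => //.
  + case=> [|[|[|[|//]]]] _ /=; [exact: values_chi1 | exact: values_neg | exact: vS |].
    exact: values_mul (@values_neg 3) vS.
  + case=> [|[|[|[|//]]]] _ /=; apply: lin_on_irr => //; first exact: lin_on_chi1.
      exact: lin_on_sgn.
    exact/lin_on_mul/lin_on_sgn.
  by rewrite code_gcyc //; vm_compute.
- have lD : lin_on (g2' : {perm 'I_4}) dih''.
    by apply: (lin_on_values (@values_dih'' 3)); rewrite code_g2' //; vm_compute.
  apply: (@complete_values _ _ _ [:: fun=> 1; sgn_code; fun l => sgn_code l * dih''_code l;
    dih''_code; dih_r_code 3 (code (@g2' 3))]) => //.
  + case=> [|[|[|[|[|//]]]]] _ /=; [exact: values_chi1 | exact: vS | |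
      exact: values_dih'' | exact: values_dih_r].
    exact: values_mul vS (@values_dih'' 3).
  + case=> [|[|[|[|[|//]]]]] _ /=.
    * exact/lin_on_irr/lin_on_chi1.
    * exact/lin_on_irr/lin_on_sgn.
    * exact/lin_on_irr/lin_on_mul/lD/lin_on_sgn.
    * exact: lin_on_irr.
    (* The permutation representation on four points is the sum of 1, dih'' and
       dih_r. *)
    apply: (irr_on_values (@values_dih_r 3)); last by rewrite code_g2' //; vm_compute.
    apply: (vchar_values (values_sub (@values_lam1 3) (@values_dih'' 3)) (@values_dih_r 3)).
      by rewrite code_g2' //; vm_compute.
    exact/(vchar_onB (vchar_lam1 _))/irr_vchar_on/lin_on_irr.
  by rewrite code_g2' //; vm_compute.
- by apply: (complete_cube_root tP); rewrite code_gcyc //; vm_compute.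
by apply: (complete_fourth_root iP); rewrite code_gcyc //; vm_compute.
Qed.

Lemma keys_S4 : uniq (map fst (tableS4 i theta)).
Proof.
have [gs [gsE gsH8]] : exists gs : seq {perm 'I_4},
    map (@code 3) gs = [:: cycle_code 3 2; swap_code 3 2 3; cycle_code 3 3;
      compose (swap_code 3 0 2) (swap_code 3 1 3)] /\
    [seq g \in H8 | g <- gs] = [:: true; true; false; true].
  exists [:: gcyc 2; tperm (inord 2) (inord 3); gcyc 3; H8_extra 3]; split.
    by rewrite /= /H8_extra codeM !code_gcyc // !code_tperm_inord.
  rewrite /= H8_extra_in; congr [:: _; _; _; _].
  - by apply: H22_H8; rewrite has_code_H22 code_gcyc //; vm_compute.
  - by apply: H22_H8; rewrite has_code_H22 code_tperm_inord //; vm_compute.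
  have g3C : (gcyc 3 \in 'C[g2' : {perm 'I_4}]%g) = false.
    by rewrite cent1_code code_g2' // code_gcyc //; vm_compute.
  apply: contraFF g3C => /(subsetP (@H8_cent 3 g2' _)); apply.
  by rewrite code_g2' // /H8_extra codeM !code_tperm_inord //; vm_compute.
apply: (keys_uniq (gs := gs)); cbn [map fst tableS4].
rewrite !gsH8 !(has_code_seq gs (@has_code_Hone 3)) !(has_code_seq gs (@has_code_H2 3)).
rewrite !(has_code_seq gs (@has_code_Hfirst 3 _)) !(has_code_seq gs (@has_code_H22 3)) gsE.
by vm_compute.
Qed.

Lemma bijection_S4 (g : {set Mtype (dataS4 i theta)}) : g \in HCseries (dataS4 i theta) ->
  exists Phi : {h | h \in Hbar_gamma g} -> {m | m \in g},
    (forall h, alpha_fibre (val h) :&: g = [set val (Phi h)]) /\ bijective Phi.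
Proof.
have [Lu LM] := Melts_S4.
(* The numbers are positions in Melts classes_S4: rows are the fibres in the order
   of the table, sers the series other than the one of the remaining elements. *)
pose rows := [:: [:: 0; 19; 20]; [:: 17]; [:: 9; 18]; [:: 10]; [:: 1; 6; 11]; [:: 5; 13];
  [:: 12]; [:: 2; 15; 16]; [:: 14]; [:: 3; 7]; [:: 8]; [:: 4]]%N.
pose ones := [:: 19; 20; 15; 16; 11; 7; 4]%N.
pose sers := [:: 6; 13; 18]%N :: [seq [:: a] | a <- ones].
move=> gs; apply: (exceptional_bijection (rows := rows) (sers := rest_pos 21 sers :: sers)
  _ Lu LM keys_S4) => //.
apply: (with_rest_pos Lu LM _ _ gs) => //.
by rewrite /sers map_cons -alone_pos.
Qed.

End S4.

(** ** S_5 *)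

Section S5.
Variables (i theta zeta : algC).
Hypotheses (iP : 4.-primitive_root i) (tP : 3.-primitive_root theta)
  (zP : 5.-primitive_root zeta).

Definition classes_S5 : seq ({perm 'I_5} * seq ({perm 'I_5} -> algC)) :=
  [:: (1%g, [:: chi1; lam1; chi_two; lam2; chi_two \* sgn; lam1 \* sgn; sgn]);
      (gcyc 2, [:: chi1; cych (-1); refl3; cych (-1) \* refl3; sgn; cych (-1) \* sgn]);
      (g2', [:: chi1; dih'; dih_eps; dih''; dih_r]);
      (gcyc 3, [:: chi1; cych theta; cych (theta ^+ 2);
                   sgn; sgn \* cych theta; sgn \* cych (theta ^+ 2)]);
      (gcyc 4, [:: chi1; cych (-1); cych i; cych (- i)]);
      (gcyc 5, [:: chi1; cych zeta; cych (zeta ^+ 2); cych (zeta ^+ 3); cych (zeta ^+ 4)]);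
      (g6, [:: chi1; cych theta; cych (theta ^+ 2);
               sgn; sgn \* cych theta; sgn \* cych (theta ^+ 2)])].

Lemma complete_S5_1 : complete_irr (1%g : {perm 'I_5})
  [:: chi1; lam1; chi_two; lam2; chi_two \* sgn; lam1 \* sgn; sgn].
Proof.
have sC : sign_check 4 by vm_compute.
have l2C : lam2_check 4 by vm_compute.
have vS := values_sgn sC.
have v2S := values_mul (@values_two 4) vS; have v1S := values_mul (@values_lam1 4) vS.
have vcS : vchar_on 'C[1%g : {perm 'I_5}]%G sgn by apply/irr_vchar_on/lin_on_irr/lin_on_sgn.
apply: (@complete_values _ _ _ [:: fun=> 1; lam1_code; two_code; lam2_code;
  fun l => two_code l * sgn_code l; fun l => lam1_code l * sgn_code l; sgn_code]); first by [].
- case=> [|[|[|[|[|[|[|//]]]]]]] _ /=; [exact: values_chi1 | exact: values_lam1 |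
    exact: values_two | exact: values_lam2 | exact: v2S | exact: v1S | exact: vS].
- case=> [|[|[|[|[|[|[|//]]]]]]] _ /=.
  + exact/lin_on_irr/lin_on_chi1.
  + by apply: (irr_on_values (@values_lam1 4) (vchar_lam1 _)); rewrite code1; vm_compute.
  + by apply: (irr_on_values (@values_two 4) (vchar_two _)); rewrite code1; vm_compute.
  + by apply: (irr_on_values (values_lam2 l2C) (vchar_lam2 _ l2C)); rewrite code1; vm_compute.
  + apply: (irr_on_values v2S); first exact: vchar_onM (vchar_two _) vcS.
    by rewrite code1; vm_compute.
  + apply: (irr_on_values v1S); first exact: vchar_onM (vchar_lam1 _) vcS.
    by rewrite code1; vm_compute.
  exact/lin_on_irr/lin_on_sgn.
by rewrite code1; vm_compute.
Qed.

Lemma complete_S5_2 : complete_irr (gcyc 2 : {perm 'I_5})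
  [:: chi1; cych (-1); refl3; cych (-1) \* refl3; sgn; cych (-1) \* sgn].
Proof.
have sC : sign_check 4 by vm_compute.
have vS := values_sgn sC; have vN := @values_neg 4; have vR := @values_refl3 4.
have lN : lin_on (gcyc 2 : {perm 'I_5}) (cych (-1)).
  by apply: (lin_on_values vN); rewrite code_gcyc //; vm_compute.
have vcN := irr_vchar_on (lin_on_irr lN).
(* On this centralizer the points 0, 1 and 2, 3, 4 are permuted separately, so
   the reflection representation is the sum of 1, neg and refl3. *)
have vcR : vchar_on 'C[gcyc 2 : {perm 'I_5}]%G refl3.
  apply: (vchar_values (values_sub (values_sub (@values_lam1 4) (@values_chi1 4)) vN) vR).
    by rewrite code_gcyc //; vm_compute.
  exact: vchar_onB (vchar_onB (vchar_lam1 _) (vchar_on1 _)) vcN.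
apply: (@complete_values _ _ _ [:: fun=> 1; neg_code; refl3_code 4;
  fun l => neg_code l * refl3_code 4 l; sgn_code; fun l => neg_code l * sgn_code l]); first by [].
- case=> [|[|[|[|[|[|//]]]]]] _ /=; [exact: values_chi1 | exact: vN | exact: vR |
    exact: values_mul vN vR | exact: vS | exact: values_mul vN vS].
- case=> [|[|[|[|[|[|//]]]]]] _ /=.
  + exact/lin_on_irr/lin_on_chi1.
  + exact: lin_on_irr.
  + by apply: (irr_on_values vR vcR); rewrite code_gcyc //; vm_compute.
  + apply: (irr_on_values (values_mul vN vR) (vchar_onM vcN vcR)).
    by rewrite code_gcyc //; vm_compute.
  + exact/lin_on_irr/lin_on_sgn.
  exact/lin_on_irr/lin_on_mul/lin_on_sgn.
by rewrite code_gcyc //; vm_compute.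
Qed.

Lemma complete_S5_22 : complete_irr (g2' : {perm 'I_5}) [:: chi1; dih'; dih_eps; dih''; dih_r].
Proof.
have sC : sign_check 4 by vm_compute.
have vS := values_sgn sC; have vD := @values_dih'' 4.
have lD : lin_on (g2' : {perm 'I_5}) dih''.
  by apply: (lin_on_values vD); rewrite code_g2' //; vm_compute.
apply: (@complete_values _ _ _ [:: fun=> 1; sgn_code; fun l => sgn_code l * dih''_code l;
  dih''_code; dih_r_code 4 (code (@g2' 4))]); first by [].
- case=> [|[|[|[|[|//]]]]] _ /=; [exact: values_chi1 | exact: vS |
    exact: values_mul vS vD | exact: vD | exact: values_dih_r].
- case=> [|[|[|[|[|//]]]]] _ /=.
  + exact/lin_on_irr/lin_on_chi1.
  + exact/lin_on_irr/lin_on_sgn.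
  + exact/lin_on_irr/lin_on_mul/lD/lin_on_sgn.
  + exact: lin_on_irr.
  (* The four points moved by g2' carry the sum of 1, dih'' and dih_r. *)
  apply: (irr_on_values (@values_dih_r 4)); last by rewrite code_g2' //; vm_compute.
  apply: (vchar_values (values_sub (values_sub (@values_lam1 4) (@values_chi1 4)) vD)
    (@values_dih_r 4)); first by rewrite code_g2' //; vm_compute.
  exact: vchar_onB (vchar_onB (vchar_lam1 _) (vchar_on1 _)) (irr_vchar_on (lin_on_irr lD)).
by rewrite code_g2' //; vm_compute.
Qed.

Lemma Melts_S5 : uniq (Melts classes_S5) /\ Mgrp {perm 'I_5} =i Melts classes_S5.
Proof.
apply: (@Melts_check 4 _ [:: iota 0 5; cycle_code 4 2;
  compose (swap_code 4 0 1) (swap_code 4 2 3); cycle_code 4 3; cycle_code 4 4;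
  cycle_code 4 5; compose (cycle_code 4 3) (swap_code 4 3 4)]).
- by rewrite /= code1 !code_gcyc // code_g2' // code_g6.
- by vm_compute.
split; first exact: complete_S5_1.
split; first exact: complete_S5_2.
split; first exact: complete_S5_22.
split; first by apply: (complete_twisted tP); rewrite code_gcyc; vm_compute.
split; first by apply: (complete_fourth_root iP); rewrite code_gcyc; vm_compute.
split; last split=> //.
  apply: (complete_cyclic zP (js := iota 0 5)) => //.
    by rewrite code_gcyc //; vm_compute.
  by case=> [|[|[|[|[|//]]]]] _ s //=; rewrite ?expr0 ?expr1 ?cych1.
by apply: (complete_twisted tP); rewrite code_g6; vm_compute.
Qed.

Lemma keys_S5 : uniq (map fst (tableS5 i theta zeta)).
Proof.
(* As H8 is given by generators, an element is shown to lie outside it by a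
   permutation x that commutes with H8 but not with this element. *)
have [gs [gsE gsH8]] : exists gs : seq {perm 'I_5},
    map (@code 4) gs = [:: cycle_code 4 2; swap_code 4 3 4; cycle_code 4 3;
      compose (swap_code 4 0 3) (swap_code 4 1 4); cycle_code 4 4] /\
    [seq g \in H8 | g <- gs] = [:: true; true; false; true; false].
  exists [:: gcyc 2; tperm (inord 3) (inord 4); gcyc 3; H8_extra 4; gcyc 4]; split.
    by rewrite /= /H8_extra codeM !code_gcyc // !code_tperm_inord.
  pose x : {perm 'I_5} := (tperm (inord 0) (inord 1) * tperm (inord 3) (inord 4))%g.
  have xE : code x = compose (swap_code 4 0 1) (swap_code 4 3 4).
    by rewrite /x codeM !code_tperm_inord.
  have H8x : H8 \subset 'C[x]%g.
    by apply: H8_cent; rewrite xE /H8_extra codeM !code_tperm_inord; vm_compute.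
  have out m : (m <= 5)%N -> compose (code x) (cycle_code 4 m) != compose (cycle_code 4 m) (code x) ->
      (@gcyc 4 m \in H8) = false.
    move=> m5 mx; apply: contraNF mx => mH; have := subsetP H8x _ mH.
    by rewrite cent1_code code_gcyc.
  cbn [map].
  have out3 : (@gcyc 4 3 \in H8) = false by apply: out; rewrite // xE; vm_compute.
  have out4 : (@gcyc 4 4 \in H8) = false by apply: out; rewrite // xE; vm_compute.
  rewrite H8_extra_in out3 out4; congr [:: _, _, false & _]; apply: H22_H8.
    by rewrite has_code_H22 code_gcyc //; vm_compute.
  by rewrite has_code_H22 code_tperm_inord //; vm_compute.
apply: (keys_uniq (gs := gs)); cbn [map fst tableS5].
rewrite !gsH8 !(has_code_seq gs (@has_code_Hone 4)) !(has_code_seq gs (@has_code_H2 4)).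
rewrite !(has_code_seq gs (@has_code_Hfirst 4 _)) !(has_code_seq gs (@has_code_H22 4)).
by rewrite !(has_code_seq gs (@has_code_H23 4)) gsE; vm_compute.
Qed.

Lemma bijection_S5 (g : {set Mtype (dataS5 i theta zeta)}) :
  g \in HCseries (dataS5 i theta zeta) ->
  exists Phi : {h | h \in Hbar_gamma g} -> {m | m \in g},
    (forall h, alpha_fibre (val h) :&: g = [set val (Phi h)]) /\ bijective Phi.
Proof.
have [Lu LM] := Melts_S5.
(* The numbers are positions in Melts classes_S5: rows are the fibres in the order
   of the table, sers the series other than the one of the remaining elements. *)
pose rows := [:: [:: 0; 29; 30; 31; 32]; [:: 28]; [:: 1; 26; 27]; [:: 24];
  [:: 2; 8; 19; 20; 37; 38]; [:: 7; 34; 35]; [:: 18; 36]; [:: 33]; [:: 13; 25]; [:: 14];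
  [:: 4; 10; 15]; [:: 9; 17]; [:: 16]; [:: 3; 22; 23]; [:: 21]; [:: 5; 11]; [:: 12];
  [:: 6]]%N.
pose ones := [:: 29; 30; 31; 32; 26; 27; 37; 38; 22; 23; 15; 11; 6]%N.
pose sers := [:: 19; 34]%N :: [:: 20; 35]%N :: [:: 8; 10; 17; 25; 36]%N ::
  [seq [:: a] | a <- ones].
move=> gs; apply: (exceptional_bijection (rows := rows) (sers := rest_pos 39 sers :: sers)
  _ Lu LM keys_S5) => //.
apply: (with_rest_pos Lu LM _ _ gs) => //.
by rewrite /sers 3!map_cons -alone_pos.
Qed.

End S5.

(** * The bijection for all families *)

Theorem mainTheorem3 (i theta zeta : algC)
    (hi : 4.-primitive_root i) (htheta : 3.-primitive_root theta)
    (hzeta : 5.-primitive_root zeta)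
    (c : Wfamily) (g : {set Mtype (Udata i theta zeta c)})
    (hg : g \in HCseries (Udata i theta zeta c)) :
  exists Phi : {h | h \in Hbar_gamma g} -> {m | m \in g},
    (forall h, alpha_fibre (val h) :&: g = [set val (Phi h)]) /\
    bijective Phi.
Proof.
case: c g hg => [|D delta oD|D oD|||||||] g hg.
- apply: series_bijection => [|m _|[] []//]; first exact: subsetT.
  by rewrite !inE.
- by have [gM gH gI] := series_BC oD hg; apply: series_bijection.
- by have [gM gH gI] := series_D oD hg; apply: series_bijection.
- exact: bijection_S1.
- exact: bijection_S2_3.
- exact: bijection_S2_2.
- by apply: (bijection_S3 htheta (ones := [:: 6; 7; 4]%N)).
- by apply: (bijection_S3 htheta (ones := [:: 2; 6; 7; 4]%N)).
- exact: bijection_S4 hi htheta _ hg.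
exact: bijection_S5 hi htheta hzeta _ hg.
Qed.
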